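(* Consider the growing-sample-size model described in the context, and assume that $$\sum_{n\ge N}\frac{k_n}{s_{n+1}}\ \text{diverges},\qquad \sum_{n\ge N}\frac{k_n^2}{s_{n+1}^2}\ \text{converges},\qquad 0<\eta_1:=\inf_{n\ge N}\frac{s_{n+1}}{(n+1)k_n}\le \eta_2:=\sup_{n\ge N}\frac{s_{n+1}}{(n+1)k_n}<\infty .$$ Assume that one of the following is true: (A1) $g$ is Lipschitz on $[0,1]$, and each of the series $\sum_{n\ge N}(n+1)^{-1}k_n^{-1/2}$ and $\sum_{n\ge N}s_{n+1}^{-1}k_n^{1/2}$ converges. (A2) $g\in\mathcal C^{(1)}[0,1]$, and each of the series $$\sum_{n\ge N}(n+1)^{-1}k_n^{-1/2}\omega_{g'}(k_n^{-1/2}),\quad \sum_{n\ge N}s_{n+1}^{-1}k_n^{1/2}\omega_{\varphi'}(k_n^{-1/2}),\quad \sum_{n\ge N}s_{n+1}^{-1}k_n^{1/2}\omega_{\psi'}(k_n^{-1/2})$$ converges, where $\varphi(x)=xg(x)$ and $\psi(x)=xg(x)+(1-x)\{1-g(x)\}$ for $x\in[0,1]$. (If $g\in\mathcal C^{(1)}[0,1]$ and each of $\sum_{n\ge N}s_{n+1}^{-1}$ and $\sum_{n\ge N}s_{n+1}^{-1}k_n^{1/2}\omega_{g'}(k_n^{-1/2})$ converges, then so do the second and third of these series.) (A3) $g\in\mathcal C^{(2)}[0,1]$, and each of the series $\sum_{n\ge N}(n+1)^{-1}k_n^{-1}$ and $\sum_{n\ge N}s_{n+1}^{-1}$ converges.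 Then the sequence $\{(n^{-1}A_n,s_n^{-1}B_n,s_n^{-1}C_n)\}_{n\ge N+1}$ converges almost surely to a (possibly path dependent) compact, connected, internally chain transitive invariant set, contained in $\hat{\mathcal S}$, corresponding to the differential inclusion $(\dot a(t),\dot b(t),\dot c(t))\in F(a(t),b(t),c(t))$ for $t\ge0$, where $$F(a,b,c)=\big\{(\eta\hat h_1(a,b,c),\hat h_2(a,b,c),\hat h_3(a,b,c)):\eta\in[\eta_1,\eta_2]\big\},\qquad (a,b,c)\in\hat{\mathcal S}.$$
   Context: **Model (growing sample size).** Fix an integer $N\ge1$, a sequence $\{k_n:n\ge N\}$ of positive integers growing with $n$, a constant $\alpha>0$, a memory parameter $p\in[0,1]\setminus\{1/2\}$ and a reinforcement function $f:[0,1]\to[0,1]$. Put $g(x)=pf(x)+(1-p)\{1-f(x)\}$ (so $g:[0,1]\to[0,1]$), $s_n=\sum_{i=N+1}^nk_{i-1}$ for $n\ge N+1$, and let $\{\beta_n:n\ge N\}$ be positive reals with $n\beta_n=\alpha s_n$ for all $n\ge N+1$. $G_N$ is the graph with vertices $v_1,\dots,v_N$ and no edges; each $v_i$ ($i\le N$) has an arbitrary state $X_i\in\{+1,-1\}$. For $n\ge N$, given the $\sigma$-field $\mathcal F_n$ of all information up to and including epoch $n$ (the directed multigraph $G_n$ on $v_1,\dots,v_n$, its states and its history), a new vertex $v_{n+1}$ arrives and indices $U_{n,1},\dots,U_{n,k_n}$ are drawn, conditionally i.i.d. given $\mathcal F_n$, with $$\mathbf P[U_{n,1}=m\mid\mathcal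 F_n]=\frac{\mathrm{indeg}_n(v_m)+\beta_n}{\sum_{j=1}^n\mathrm{indeg}_n(v_j)+n\beta_n},\quad m\in\{1,\dots,n\},$$ where $\mathrm{indeg}_n(v)$ is the in-degree of $v$ in $G_n$, counted with multiplicity. Let $P_n=\#\{i\le k_n:X_{U_{n,i}}=+1\}$. Given $\mathcal F_n$ and the sample, $X_{n+1}=+1$ with probability $g(P_n/k_n)$ and $X_{n+1}=-1$ with probability $1-g(P_n/k_n)$. Then for each $i\in\{1,\dots,k_n\}$ with $X_{U_{n,i}}=X_{n+1}$ a directed edge from $v_{n+1}$ to $v_{U_{n,i}}$ is added (repeated edges kept), giving $G_{n+1}$. States never change afterwards. **Statistics.** $A_n=\#\{i\le n:X_i=+1\}$, $B_n=\sum_{i\le n,\,X_i=+1}\mathrm{indeg}_n(v_i)$, $C_n=\sum_{i\le n}\mathrm{indeg}_n(v_i)$. **Drift.** $\hat{\mathcal S}=\{(a,b,c)\in[0,1]^3:c\ge b\}$; $q_\alpha=q_\alpha(a,b,c)=\frac{b+\alpha a}{c+\alpha}\in[0,1]$; on $\hat{\mathcal S}$, $\hat h_1(a,b,c)=g(q_\alpha)-a$, $\hat h_2(a,b,c)=q_\alpha g(q_\alpha)-b$, $\hat h_3(a,b,c)=q_\alpha g(q_\alpha)+(1-q_\alpha)\{1-g(q_\alpha)\}-c$. **Function classes.** $\mathcal C^{(i)}[0,1]$ is the set of functions on $[0,1]$ that extend to a function on an open set containing $[0,1]$ with continuous $i$-th derivative. For continuous $u$ on $[0,1]$ and $\delta>0$,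 $\omega_u(\delta)=\sup\{|u(x)-u(y)|:x,y\in[0,1],|x-y|<\delta\}$. **Differential inclusions.** A solution of $\dot{\mathbf x}\in F(\mathbf x)$ with initial value $\mathbf u$ is an absolutely continuous map $\mathbf x$ with $\mathbf x(0)=\mathbf u$ and $\dot{\mathbf x}(t)\in F(\mathbf x(t))$ for almost every $t$. A set $A$ is *invariant* if for every $\mathbf u\in A$ there is at least one solution $\mathbf x:\mathbb R\to A$ with $\mathbf x(0)=\mathbf u$. A compact set $A$ is *internally chain transitive* if for all $\epsilon>0$, $T>0$, $\mathbf u,\mathbf v\in A$ there are $m\ge1$, points $\mathbf u_0=\mathbf u,\mathbf u_1,\dots,\mathbf u_m=\mathbf v$ in $A$, solutions $\mathbf x_i$ with $\mathbf x_i(0)=\mathbf u_{i-1}$, and times $t_1,\dots,t_m>T$ such that, for each $i\in\{1,\dots,m\}$, $\mathbf x_i(s)\in A$ for all $0\le s\le t_i$ and $\|\mathbf x_i(t_i)-\mathbf u_i\|<\epsilon$. A sequence $z_n$ converges to a set $L$ if $\inf_{\mathbf w\in L}\|z_n-\mathbf w\|\to0$. *)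

(* Defs.v *)
From HB Require Import structures.
From mathcomp Require Import all_boot all_order all_algebra.
From mathcomp Require Import all_classical all_reals all_analysis.
Set Implicit Arguments.
Unset Strict Implicit.
Unset Printing Implicit Defensive.
Import Order.TTheory GRing.Theory Num.Theory.
Import numFieldNormedType.Exports.
Local Open Scope classical_set_scope.
Local Open Scope ring_scope.

(** * The random graph, path by path

  A state is a boolean ([true] is +1, [false] is -1).  Vertices, and the
  positions of a sample, are numbered from 1.  A path consists of the states
  [x i] of the vertices and the indices [u n i], [1 <= i <= k n], drawn at
  epoch [n]. *)
Section Graph.
Variables (N : nat) (k : nat -> nat) (x : nat -> bool) (u : nat -> nat -> nat).

(* The edges (source, target) of G_n, listed with repetition. *)
Fixpoint edges (n : nat) : seq (nat * nat) :=
  if n is m.+1 then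
    if (m < N)%N then [::]
    else edges m ++ [seq (m.+1, u m i) | i <- iota 1 (k m) & x (u m i) == x m.+1]
  else [::].

Definition indeg (n v : nat) : nat := count (fun e => e.2 == v) (edges n).

Definition posSample (n : nat) : nat := count (fun i => x (u n i)) (iota 1 (k n)).

Definition statA (n : nat) : nat := (\sum_(1 <= i < n.+1 | x i) 1)%N.
Definition statB (n : nat) : nat := (\sum_(1 <= i < n.+1 | x i) indeg n i)%N.
Definition statC (n : nat) : nat := (\sum_(1 <= i < n.+1) indeg n i)%N.

Definition attach (R : realType) (beta : nat -> R) (n m : nat) : R :=
  ((indeg n m)%:R + beta n) /
  ((\sum_(1 <= j < n.+1) (indeg n j)%:R) + n%:R * beta n).

End Graph.

Definition sizeSum (N : nat) (k : nat -> nat) (n : nat) : nat :=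
  (\sum_(N.+1 <= i < n.+1) k i.-1)%N.

Definition reinforce (R : realType) (p : R) (f : R -> R) (x : R) : R :=
  p * f x + (1 - p) * (1 - f x).

(** * The random process *)
Section Process.
Context (d : measure_display) (T : measurableType d) (R : realType).
Variable P : probability T R.

(* [q] is a version of the conditional probability of [E] given the
   sub-sigma-algebra [G]. *)
Definition isCondProb (G : set (set T)) (E : set T) (q : T -> R) : Prop :=
  (forall B : set R, measurable B -> G (q @^-1` B)) /\
  (forall D, G D -> P (D `&` E) = (\int[P]_(w in D) (q w)%:E)%E).

Variables (N : nat) (k : nat -> nat).
Variables (X : nat -> T -> bool) (U : nat -> nat -> T -> nat).

(* The sigma-algebra generated by the states of v_1, ..., v_n and by the
   samples drawn at the epochs j with N <= j < m.  [info n n] is F_n, which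
   makes G_N, ..., G_n measurable; [info n n.+1] adds the sample of epoch n. *)
Definition info (n m : nat) : set (set T) :=
  <<s [set E | (exists2 i, (0 < i <= n)%N & E = X i @^-1` [set true]) \/
               (exists j i v, [/\ (N <= j < m)%N, (0 < i <= k j)%N &
                                  E = U j i @^-1` [set v]])] >>.

(* In [sample_law], conditionally i.i.d. sampling is the product form of the
   joint conditional law of the sample. *)
Record reinforcedGraph (g : R -> R) (beta : nat -> R) : Prop := {
  state_measurable : forall i, (0 < i)%N ->
    measurable (X i @^-1` [set true]);
  sample_measurable : forall n i v, (N <= n)%N -> (0 < i <= k n)%N ->
    measurable (U n i @^-1` [set v]);
  sample_range : forall n i w, (N <= n)%N -> (0 < i <= k n)%N ->
    (0 < U n i w <= n)%N;
  sample_law : forall n (m : nat -> nat), (N <= n)%N ->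
    (forall i, (0 < i <= k n)%N -> (0 < m i <= n)%N) ->
    isCondProb (info n n)
      [set w | forall i, (0 < i <= k n)%N -> U n i w = m i]
      (fun w => \prod_(1 <= i < (k n).+1)
         attach N k (X ^~ w) (fun j i => U j i w) beta n (m i));
  state_law : forall n, (N <= n)%N ->
    isCondProb (info n n.+1)
      (X n.+1 @^-1` [set true])
      (fun w =>
         g ((posSample k (X ^~ w) (fun j i => U j i w) n)%:R / (k n)%:R))
}.

(* (A_n / n, B_n / s_n, C_n / s_n) *)
Definition proportions (n : nat) (w : T) : R * R * R :=
  let x := X ^~ w in let u := fun j i => U j i w in
  let s := (sizeSum N k n)%:R in
  ((statA x n)%:R / n%:R, (statB N k x u n)%:R / s, (statC N k x u n)%:R / s).

End Process.

(** * Functions on [0, 1] *)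
Section Functions.
Context (R : realType).

Definition seriesCvg (N : nat) (a : nat -> R) : Prop :=
  cvgn (fun n => \sum_(N <= i < n) a i).

Definition C_class (i : nat) (u : R -> R) : Prop :=
  exists (V : set R) (v : R -> R),
    [/\ open V, `[0, 1] `<=` V, {in `[0, 1], v =1 u},
        (forall j x, (j < i)%N -> V x -> derivable (derive1n j v) x 1) &
        (forall x, V x -> {for x, continuous (derive1n i v)})].

(* The derivative of [u] as a function on [0, 1]: one-sided at 0 and 1, so
   that the values of [u] outside [0, 1] play no role. *)
Definition deriv01 (u : R -> R) (x : R) : R :=
  lim ((fun y => (u y - u x) / (y - x)) @ within `[0, 1] x^').

Definition modulus (u : R -> R) (delta : R) : R :=
  sup [set e | exists x y, [/\ x \in `[0, 1], y \in `[0, 1],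
                               `|x - y| < delta & e = `|u x - u y|]].

End Functions.

(** * Differential inclusions *)
Section Inclusions.
Context (R : realType) (E : normedModType R).
Implicit Types (F : E -> set E) (A : set E) (x : R -> E).

Definition absContOn (a b : R) x : Prop :=
  forall e : R, 0 < e -> exists2 delta : R, 0 < delta &
    forall (n : nat) (l r : 'I_n -> R),
      (forall i, [/\ a <= l i, l i <= r i & r i <= b]) ->
      trivIset setT (fun i => `]l i, r i[%classic) ->
      \sum_(i < n) (r i - l i) < delta ->
      \sum_(i < n) `|x (r i) - x (l i)| < e.

(* Solution on the interval [J]; absolute continuity is meant on the compact
   subintervals of [J]. *)
Definition isSolution F (J : set R) x : Prop :=
  (forall a b, a <= b -> `[a, b] `<=` J -> absContOn a b x) /\
  {ae lebesgue_measure, forall t, J t -> derivable x t 1 /\ F (x t) (derive1 x t)}.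

Definition invariantSet F A : Prop :=
  forall u, A u -> exists x, [/\ isSolution F setT x, x 0 = u & forall t, A (x t)].

Definition chainTransitive F A : Prop :=
  forall (e tau : R) (u v : E), 0 < e -> 0 < tau -> A u -> A v ->
  exists (m : nat) (pt : nat -> E) (x : nat -> R -> E) (t : nat -> R),
    [/\ (1 <= m)%N, pt 0%N = u, pt m = v, (forall i, (i <= m)%N -> A (pt i)) &
        forall i, (1 <= i <= m)%N ->
          [/\ isSolution F `[0, +oo[ (x i), x i 0 = pt i.-1, tau < t i,
              (forall s, 0 <= s <= t i -> A (x i s)) &
              `|x i (t i) - pt i| < e]].

(* The infimum over the empty set is +oo, so only nonempty sets qualify. *)
Definition convergesTo (z : nat -> E) (L : set E) : Prop :=
  (fun n => ereal_inf [set `|z n - w|%:E | w in L]) @ \oo --> 0%E.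

End Inclusions.

(** * The drift *)
Section Drift.
Context (R : realType).

Definition Shat : set (R * R * R) :=
  [set z | [/\ z.1.1 \in `[0, 1], z.1.2 \in `[0, 1], z.2 \in `[0, 1] &
               z.1.2 <= z.2]].

Variables (g : R -> R) (alpha : R).

Definition qalpha (z : R * R * R) : R := (z.1.2 + alpha * z.1.1) / (z.2 + alpha).

Definition phi (x : R) : R := x * g x.
Definition psi (x : R) : R := x * g x + (1 - x) * (1 - g x).

Definition h1 z : R := g (qalpha z) - z.1.1.
Definition h2 z : R := qalpha z * g (qalpha z) - z.1.2.
Definition h3 z : R :=
  qalpha z * g (qalpha z) + (1 - qalpha z) * (1 - g (qalpha z)) - z.2.

(* The inclusion lives on [Shat]: empty values elsewhere force the solutions
   to stay in [Shat]. *)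
Definition drift (eta1 eta2 : R) (z : R * R * R) : set (R * R * R) :=
  [set v | Shat z /\
     exists2 eta, eta \in `[eta1, eta2] & v = (eta * h1 z, h2 z, h3 z)].

End Drift.

(* Main.v *)
Require Import Defs.
From HB Require Import structures.
From mathcomp Require Import all_boot all_order all_algebra.
From mathcomp Require Import all_classical all_reals all_analysis.
From mathcomp Require Import measurable_realfun.
From mathcomp Require Import ring lra.
Set Implicit Arguments.
Unset Strict Implicit.
Unset Printing Implicit Defensive.
Import Order.TTheory GRing.Theory Num.Theory.
Import numFieldNormedType.Exports.
Local Open Scope classical_set_scope.
Local Open Scope ring_scope.

(** Let [z n] be the vector of the three proportions and [gam n] the ratio of
    [k n] to the total of the sample sizes up to epoch [n]. Since the normalising
    constants grow by 1 and by [k n], [proportions_step] writes [z] as an Euler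
    scheme with steps [gam n] for the inclusion, where the coefficient [eta] of
    the first coordinate is the given ratio at epoch [n], plus two perturbations.

    The first is a martingale difference. Given the past, a draw is positive with
    probability [qalpha (z n)] ([posProbE]), so the number of positive draws is
    binomial ([sample_mean]). Since the squares of the steps are summable,
    Kolmogorov's maximal inequality makes the sums of these differences converge
    almost surely ([martingale_cauchy], [noise_cauchy]). All variables depend on
    finitely many finite-valued coordinates, which replaces measurability with
    respect to the past by a condition of dependence.

    The second is the bias caused by sampling: the error of Bernstein's operator
    of order [k n] applied to [g], [phi g] or [psi g]. It is at most
    [L / sqrt k] for an [L]-Lipschitz function ([binExp_lipschitz]) and at most
    [3 / sqrt k] times the modulus of continuity of the derivative at
    [1 / sqrt k] for a differentiable one ([binExp_smooth]); assumptions (A1) and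
    (A2) say that these bounds are summable, and (A3) implies (A2).

    On almost every path what remains is deterministic ([LimitSet]). The limit
    set [L] of [z] is compact, connected and attracts [z]. Take an ultrafilter on
    the indices along which [z n] tends to [p] in [L]: the translates of the
    scheme by the time [tau n] converge along it, at every time, to a curve in
    [L] through [p]. Its increments are Euler steps up to a quadratic error, so
    its derivative belongs to the inclusion wherever it exists
    ([quasi_solution_isSolution]), and it exists almost everywhere because the
    curve is Lipschitz ([lipschitz_ae_derivable]). This gives invariance. The
    same limits show that every late stretch of the sequence is tracked at both
    ends by a solution inside [L]; stringing such solutions together along [z]
    gives chain transitivity. *)

(** * Lipschitz functions of a real variable are differentiable almost everywhere *)

Lemma lipschitz_continuous {R : realType} {E : normedModType R} (x : R -> E) (C : R) :
  (forall s t, `|x s - x t| <= C * `|s - t|) -> continuous x.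
Proof.
move=> xC t; apply/cvgrPdist_lt => e e0.
have C1 : 0 < `|C| + 1 by rewrite ltr_wpDl.
near=> s; apply: (le_lt_trans (xC t s)).
apply: (@le_lt_trans _ _ ((`|C| + 1) * `|t - s|)).
  by rewrite ler_wpM2r// ler_wpDr// ler_norm.
rewrite mulrC -ltr_pdivlMr//; near: s.
by apply/nbhs_normP; exists (e / (`|C| + 1)); rewrite /= ?divr_gt0.
Unshelve. all: by end_near. Qed.

Section Rademacher.
Context {R : realType}.
Local Notation mu := (@lebesgue_measure R).

Section NondecreasingParts.
Variables (F : R -> R).
Hypotheses (ndF : {homo F : s t / s <= t}) (ndG : {homo (fun t => t - F t) : s t / s <= t}).

Let F1 s t : `|F s - F t| <= 1 * `|s - t|.
Proof.
rewrite mul1r; wlog st : s t / s <= t.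
  by move=> h; have [/h //|/ltW/h] := leP s t; rewrite distrC [`|t - s|]distrC.
rewrite distrC [`|s - t|]distrC !ger0_norm ?subr_ge0// ?ndF//.
by have := ndG st; lra.
Qed.

Let G2 s t : `|(s - F s) - (t - F t)| <= 2 * `|s - t|.
Proof.
have -> : (s - F s) - (t - F t) = (s - t) - (F s - F t) by ring.
by rewrite (le_trans (ler_normB _ _))// mulr_natl mulr2n lerD// -[leRHS]mul1r.
Qed.

Let rcF : right_continuous F.
Proof. by apply: right_continuousW; exact: lipschitz_continuous F1. Qed.

Let G := fun t => t - F t.
Let rcG : right_continuous G.
Proof. by apply: right_continuousW; exact: lipschitz_continuous G2. Qed.

HB.instance Definition _ := isCumulative.Build R _ R F ndF rcF.
HB.instance Definition _ := isCumulative.Build R _ R G ndG rcG.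

Let LF : {measure set (measurableTypeR R) -> \bar R} := lebesgue_stieltjes_measure F.
Let LG : {measure set (measurableTypeR R) -> \bar R} := lebesgue_stieltjes_measure G.

Let LF_itv (a b : R) : a <= b -> LF `]a, b]%classic = (F b - F a)%:E.
Proof.
move=> ab; rewrite /LF/= /lebesgue_stieltjes_measure /measure_extension/= measurable_mu_extE/=; last exact: is_ocitv.
by rewrite wlength_itv_bnd.
Qed.

Let LG_itv (a b : R) : a <= b -> LG `]a, b]%classic = (G b - G a)%:E.
Proof.
move=> ab; rewrite /LG/= /lebesgue_stieltjes_measure /measure_extension/= measurable_mu_extE/=; last exact: is_ocitv.
by rewrite wlength_itv_bnd.
Qed.

Let LFG A : measurable A -> (LF A <= mu A)%E.
Proof.
move=> mA.
rewrite (@lebesgue_measure_unique _ (measure_add LF LG)) => [|X [[a b] _ <-]|//].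
  rewrite -[leRHS]/(measure_add LF LG A) measure_addE.
  exact: leeDl.
have [ab|ba] := leP a b.
  rewrite -[RHS]/(measure_add LF LG _) measure_addE/= LF_itv// LG_itv// lebesgue_measure_itv/= lte_fin.
  case: ltP => [_|ba]; rewrite -?EFinD; first by congr EFin; rewrite /G; ring.
  by have -> : a = b by [apply/le_anti; rewrite ab ba]; rewrite !subrr addr0.
by rewrite set_itv_ge ?measure0//= bnd_simp -leNgt ltW.
Qed.

(** The Stieltjes measures of [F] and of [t - F t] add up to the Lebesgue
    measure, which therefore dominates that of [F]; the Radon-Nikodym density
    is then the derivative of [F] at every Lebesgue point of the density. *)
Lemma nondecreasing_parts_ae_derivable (m : R) (m0 : 0 <= m) :
  {ae mu, forall t, - m < t < m -> derivable F t 1}.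
Proof.
have mE : measurable (`](- m), m]%classic : set (measurableTypeR R)) by [].
pose E := `](- m), m]%classic.
have LEoo : (LF E < +oo)%E.
  by rewrite LF_itv ?ltry//; move: m0; lra.
pose nu : {finite_measure set (measurableTypeR R) -> \bar R} := mfrestr mE LEoo.
pose nuc := charge_of_finite_measure nu.
have dom : nuc `<< mu.
  apply/null_content_dominatesP => A mA A0; apply/eqP; rewrite -measure_le0.
  rewrite /nuc/= /charge_of_finite_measure/= /mfrestr /mrestr.
  by rewrite (le_trans (LFG _))// ?A0 -?A0 ?le_measure ?inE//; exact: measurableI.
pose f := fine \o Radon_Nikodym nuc mu.
have fE : EFin \o f = Radon_Nikodym nuc mu.
  by apply/funext => t/=; rewrite fineK// Radon_Nikodym_fin_num.
have intf : mu.-integrable setT (EFin \o f).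
  by rewrite fE; exact: Radon_Nikodym_integrable.
have locf : locally_integrable setT f by apply: open_integrable_locally => //; exact: openT.
have := @FTC1 R f (BRight (- m)) _ locf.
have intf' y : mu.-integrable [set` Interval (BRight (- m)) (BRight y)] (EFin \o f).
  exact: integrableS intf.
move=> /(_ intf'); apply: filterS; first exact: (ae_filter_ringOfSetsType mu).
move=> t FTC /andP[nt tn].
have [+ _] := FTC nt.
set F0 := (X in derivable X _ _) => dF0.
have F0E : {near t, F0 =1 (fun y => F y - F (- m))}.
  have ntn : t \in `](- m), m[ by rewrite in_itv/= nt.
  near=> y.
  have : y \in `](- m), m[ by near: y; exact: near_in_itvoo.
  rewrite in_itv/= => /andP[ny yn].
  rewrite /F0 /Rintegral (_ : (fun t0 => (f t0)%:E) = Radon_Nikodym nuc mu)//.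
  rewrite -Radon_Nikodym_integral// /nuc/=.
  rewrite /charge_of_finite_measure/= /mfrestr /mrestr.
  rewrite setIidl; last by apply: subset_itvl; rewrite bnd_simp ltW.
  by have := LF_itv (ltW ny); rewrite /LF/= => ->.
rewrite (_ : F = (fun y => F y - F (- m)) \+ cst (F (- m))); last first.
  by apply/funext => y /=; rewrite subrK.
apply: derivableD; last exact: derivable_cst.
exact: near_eq_derivable F0E dF0.
Unshelve. all: by end_near. Qed.
End NondecreasingParts.

(** After scaling to slope at most 1, [x] becomes [F = (x + t) / 2], for which
    both [F] and [t - F] are nondecreasing. *)
Lemma lipschitz_ae_derivable (x : R -> R) (C : R) :
  (forall s t, `|x s - x t| <= C * `|s - t|) ->
  {ae mu, forall t, derivable x t 1}.
Proof.
move=> xC.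
pose D := `|C| + 1.
have D0 : 0 < D by rewrite ltr_wpDl.
have xD s t : `|x s - x t| <= D * `|s - t|.
  by apply: (le_trans (xC s t)); rewrite ler_wpM2r// ler_wpDr// ler_norm.
pose F t := 2^-1 * (D^-1 * x t + t).
have bnd s t : s <= t -> `|D^-1 * x t - D^-1 * x s| <= t - s.
  move=> st; rewrite -mulrBr normrM gtr0_norm ?invr_gt0// ler_pdivrMl//.
  by rewrite (le_trans (xD _ _))// ger0_norm ?subr_ge0.
have ndF : {homo F : s t / s <= t}.
  move=> s t st; have := bnd _ _ st; rewrite ler_norml /F => /andP[].
  by lra.
have ndG : {homo (fun t => t - F t) : s t / s <= t}.
  move=> s t st; have := bnd _ _ st; rewrite ler_norml /F => /andP[].
  by lra.
have key : {ae mu, forall t, forall n : nat, - n%:R < t < n%:R -> derivable F t 1}.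
  by apply: ae_foralln => n; exact: nondecreasing_parts_ae_derivable.
apply: filterS key; first exact: (ae_filter_ringOfSetsType mu).
move=> t key.
have dF : derivable F t 1.
  apply: (key (Num.truncn `|t|).+1); rewrite -ltr_norml.
  exact: truncnS_gt.
have -> : x = (fun t => D * (2 * F t - t)).
  by apply/funext => y; rewrite /F mulVKf ?pnatr_eq0// addrK mulVKf ?gt_eqF.
by apply: derivableM; [exact: derivable_cst | apply: derivableB => //; apply: derivableM].
Qed.
End Rademacher.

(** * Limits along ultrafilters *)

Section Ultrafilters.

(** Ultrafilters on [nat] stand for subsequences. Along one of them every
    sequence in a compact set converges, so a whole family of sequences, one for
    each time [t], has limits at once without a diagonal extraction. *)
Lemma ultra_frequently (P : set nat) : (forall n0, exists2 n, (n0 <= n)%N & P n) ->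
  exists G : set_system nat, [/\ UltraFilter G, \oo `<=` G & G P].
Proof.
move=> iP.
have pF : ProperFilter (within P \oo).
  apply: Build_ProperFilter_ex => A [n0 _ n0A].
  by have [n n0n Pn] := iP n0; exists n; exact: n0A.
have [G [uG sG]] := ultraFilterLemma pF.
exists G; split => //.
  move=> A [n0 _ n0A]; apply: sG; exists n0 => // n n0n Pn; exact: n0A.
by apply: sG; exists 0%N.
Qed.

Lemma ultra_compact_cvg (E : topologicalType) (G : set_system nat) (S : set E) (u : nat -> E) :
  UltraFilter G -> compact S -> (\forall n \near G, S (u n)) ->
  exists2 p, S p & u @ G --> p.
Proof.
move=> uG cS uS.
have [p [Sp clp]] := cS (u @ G) _ uS.
exists p => // B pB; have [//|nB] := in_ultra_setVsetC (u @^-1` B) uG.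
by have [x [nBx Bx]] := clp (~` B) B nB pB.
Qed.

(** The traces on [nat] of the neighbourhoods of [p] meet every tail, so they
    generate with the tails a proper filter. *)
Lemma ultra_cluster (E : topologicalType) (u : nat -> E) (p : E) :
  cluster (u @ \oo) p ->
  exists G : set_system nat, [/\ UltraFilter G, \oo `<=` G & u @ G --> p].
Proof.
move=> clp.
pose F := filter_from [set AB : set nat * set E | \oo AB.1 /\ nbhs p AB.2]
  (fun AB => AB.1 `&` u @^-1` AB.2).
have pF : ProperFilter F.
  apply: filter_from_proper; first apply: filter_from_filter.
  - by exists (setT, setT) => /=; split; exact: filterT.
  - move=> [A B] [A' B'] /= [oA pB] [oA' pB']; exists (A `&` A', B `&` B') => /=.
      by split; exact: filterI.
    by move=> n [[? ?] [? ?]].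
  move=> [A B] /= [oA pB]; have oA' : (u @ \oo) (u @` A) by apply: filterS oA => n An; exists n.
  by have [x [[n An <-] Bx]] := clp _ _ oA' pB; exists n.
have [G [uG sG]] := ultraFilterLemma pF.
exists G; split => //.
  by move=> A oA; apply: sG; exists (A, setT) => [|n []//]; split => //; exact: filterT.
by move=> B pB; apply: sG; exists (setT, B) => [|n []//]; split => //; exact: filterT.
Qed.

End Ultrafilters.

(** * Solutions of differential inclusions with one free scalar *)

Section QuasiSolutions.
Context {R : realType} {E : normedModType R}.
Variables (S : set E) (a b : E -> E) (eta1 eta2 : R).

(** The set of velocities is empty outside [S], so that solutions stay in [S]. *)
Definition affineDrift (z : E) : set E :=
  [set v | S z /\ exists2 eta, eta \in `[eta1, eta2] & v = a z + eta *: b z].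

(** Rademacher's theorem for curves; it is a property of [E]. *)
Definition aeDerivable : Prop := forall (x : R -> E) (C : R),
  (forall s t, `|x s - x t| <= C * `|s - t|) ->
  {ae lebesgue_measure, forall t, derivable x t 1}.

Lemma lipschitz_absCont (C x0 y0 : R) (x : R -> E) :
  (forall s t, `|x s - x t| <= C * `|s - t|) -> absContOn x0 y0 x.
Proof.
move=> xC e e0; have C0 : 0 < `|C| + 1 by rewrite ltr_wpDl.
exists (e / (`|C| + 1)); first by rewrite divr_gt0.
move=> n l r lr _; rewrite ltr_pdivlMr// => h; apply: le_lt_trans h.
rewrite mulr_suml ler_sum// => i _; apply: (le_trans (xC _ _)).
have [_ h _] := lr i; rewrite mulrC ger0_norm ?subr_ge0//.
by rewrite ler_wpM2l ?subr_ge0// ler_wpDr// ler_norm.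
Qed.

(** An increment that is an Euler step up to a quadratic error forces the
    derivative, wherever it exists, into the compact segment of velocities at the
    current point. The coefficient [eta] is thus found pointwise, and never has
    to be exhibited as a measurable function of time. *)
Lemma quasi_solution_isSolution (K C : R) (y : R -> E) :
  aeDerivable ->
  (forall t, S (y t)) ->
  (forall s t, `|y s - y t| <= C * `|s - t|) ->
  (forall s t, s <= t -> exists2 H, eta1 * (t - s) <= H <= eta2 * (t - s) &
     `|y t - y s - ((t - s) *: a (y s) + H *: b (y s))| <= K * (t - s) ^+ 2) ->
  isSolution affineDrift setT y.
Proof.
move=> rad Sy yC yq; split; first by move=> *; exact: lipschitz_absCont yC.
have := rad _ _ yC; apply: filterS; first exact: (ae_filter_ringOfSetsType lebesgue_measure).
move=> t dt _; split => //; split => //.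
pose A := (fun eta => a (y t) + eta *: b (y t)) @` `[eta1, eta2].
suff [eta eI <-] : A (derive1 y t) by exists eta.
have cA : closed A.
  apply: compact_closed; first exact: norm_hausdorff.
  apply: continuous_compact; last exact: segment_compact.
  apply: continuous_subspaceT => eta.
  by apply: cvgD; [exact: cvg_cst|apply: cvgZl; exact: cvg_id].
apply: cA => B /nbhs_normP[e /= e0 eB].
have /cvgrPdist_lt /(_ (e / 2)) := dt.
rewrite -/(derive _ _ _) -derive1E divr_gt0// => /(_ isT) [d /= d0 dy].
have K0 : 0 < `|K| + 1 by rewrite ltr_wpDl.
(* [h] lies in the range where the difference quotient is [e / 2]-close to the
   derivative, and makes the relative error [K * h] at most [e / 2]. *)
pose h := Num.min (d / 2) (e / 2 / (`|K| + 1)).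
have h0 : 0 < h by rewrite lt_min !divr_gt0.
have hd : h < d by rewrite gt_min ltr_pdivrMr// mulr2n mulrDr mulr1 ltrDr d0.
have hK : h * (`|K| + 1) <= e / 2 by rewrite -ler_pdivlMr// ge_min lexx orbT.
have := dy h; rewrite /ball/= sub0r normrN gtr0_norm// => /(_ hd).
rewrite gt_eqF// => /(_ isT).
have [|H Hi yH] := yq t (h + t); first by rewrite lerDr ltW.
rewrite addrK in Hi yH.
rewrite [h *: 1]mulr1 /= => dist.
exists (a (y t) + (H / h) *: b (y t)); split.
  exists (H / h) => //=; rewrite in_itv/= ler_pdivlMr// ler_pdivrMr//.
apply: eB => /=.
set q := h^-1 *: _ in dist.
have -> : derive1 y t - (a (y t) + H / h *: b (y t)) =
  (derive1 y t - q) + h^-1 *: (y (h + t) - y t - (h *: a (y t) + H *: b (y t))).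
  rewrite scalerBr -/q scalerDr !scalerA mulVf ?gt_eqF// scale1r [_ * H]mulrC.
  by rewrite addrA subrK.
apply: (le_lt_trans (ler_normD _ _)).
rewrite (splitr e) ltr_leD// normrZ gtr0_norm ?invr_gt0// ler_pdivrMl//.
apply: (le_trans yH); rewrite expr2 mulrCA ler_pM2l//; apply: le_trans hK.
by rewrite mulrC ler_pM2l// ler_wpDr// ler_norm.
Qed.

End QuasiSolutions.

Lemma subrACA (V : zmodType) (x y z t : V) : x - y - (z - t) = x - z - (y - t).
Proof. by rewrite !opprD !opprK addrACA. Qed.

(** * Limit sets of perturbed Euler schemes *)

Section LimitSet.
Context {R : realType} {E : normedModType R}.
Variables (S : set E) (a b : E -> E) (eta1 eta2 C Lam : R).
Variables (z w : nat -> E) (gam eta : nat -> R).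
Hypothesis rad : @aeDerivable R E.
Hypothesis cS : compact S.
Hypothesis C0 : 0 <= C.
Hypothesis Lam0 : 0 <= Lam.
Hypothesis drift_bounded : forall e p, S p -> eta1 <= e <= eta2 -> `|a p + e *: b p| <= C.
Hypothesis drift_lipschitz : forall e p q, S p -> S q -> eta1 <= e <= eta2 ->
  `|(a p + e *: b p) - (a q + e *: b q)| <= Lam * `|p - q|.
Hypothesis aLip : forall p q, S p -> S q -> `|a p - a q| <= Lam * `|p - q|.
Hypothesis bLip : forall p q, S p -> S q -> `|b p - b q| <= Lam * `|p - q|.
Hypothesis zS : forall n, S (z n).
Hypothesis gam_gt0 : forall n, 0 < gam n.
Hypothesis gam_cvg0 : gam @ \oo --> 0.
Hypothesis gam_div : forall M, exists n, M <= \sum_(0 <= i < n) gam i.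
Hypothesis etaI : forall n, eta1 <= eta n <= eta2.
Hypothesis w_cauchy : forall e, 0 < e ->
  exists n0, forall n m, (n0 <= n)%N -> (n0 <= m)%N -> `|w n - w m| <= e.
(* The perturbation enters as the increments of a Cauchy sequence [w], which
   covers both a convergent martingale and a summable bias. *)
Hypothesis z_step : forall n,
  z n.+1 - z n = gam n *: (a (z n) + eta n *: b (z n)) + (w n.+1 - w n).

Let tau (n : nat) : R := \sum_(0 <= i < n) gam i.
Let heta (n : nat) : R := \sum_(0 <= i < n) gam i * eta i.

Let tauS n : tau n.+1 = tau n + gam n.
Proof. by rewrite /tau big_nat_recr. Qed.

Let hetaS n : heta n.+1 = heta n + gam n * eta n.
Proof. by rewrite /heta big_nat_recr. Qed.

Let tau_lt : {homo tau : n m / (n < m)%N >-> n < m}.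
Proof. by apply: homo_ltn => [x y t|n]; [exact: lt_trans|rewrite tauS ltrDl]. Qed.

Let tau_le : {mono tau : n m / (n <= m)%N >-> n <= m}.
Proof. exact: le_mono tau_lt. Qed.

Let heta_bounds n m : (n <= m)%N ->
  eta1 * (tau m - tau n) <= heta m - heta n <= eta2 * (tau m - tau n).
Proof.
elim: m => [|m IH]; first by rewrite leqn0 => /eqP->; rewrite !subrr !mulr0 lexx.
rewrite leq_eqVlt => /predU1P[->|]; first by rewrite !subrr !mulr0 lexx.
rewrite ltnS => /IH /andP[h1 h2]; have /andP[e1 e2] := etaI m.
rewrite tauS hetaS.
have g1 : eta1 * gam m <= gam m * eta m by rewrite mulrC ler_pM2l.
have g2 : gam m * eta m <= eta2 * gam m by rewrite [leRHS]mulrC ler_pM2l.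
by apply/andP; split; lra.
Qed.

Let u n := z n - w n.

Let uS n : u n.+1 = u n + gam n *: (a (z n) + eta n *: b (z n)).
Proof.
have -> : gam n *: (a (z n) + eta n *: b (z n)) = u n.+1 - u n.
  by rewrite /u -[RHS]subrACA z_step addrK.
by rewrite addrC subrK.
Qed.

Let zE n m : z m - z n = (u m - u n) + (w m - w n).
Proof. by rewrite /u -subrACA subrK. Qed.

Let u_bound n m : (n <= m)%N -> `|u m - u n| <= C * (tau m - tau n).
Proof.
elim: m => [|m IH]; first by rewrite leqn0 => /eqP->; rewrite !subrr normr0 mulr0.
rewrite leq_eqVlt => /predU1P[->|]; first by rewrite !subrr normr0 mulr0.
rewrite ltnS => /IH {}IH; rewrite uS tauS addrAC.
apply: (le_trans (ler_normD _ _)).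
rewrite [tau m + _ - _]addrAC mulrDr lerD// normrZ gtr0_norm// mulrC ler_pM2r//.
exact: drift_bounded.
Qed.

Let z_bound n m : (n <= m)%N -> `|z m - z n| <= C * (tau m - tau n) + `|w m - w n|.
Proof. by move=> nm; rewrite zE (le_trans (ler_normD _ _))// lerD2r u_bound. Qed.

(** Over a block of length [D] the process moves by at most [C * D + e], so the
    velocities of the block differ from those at its start by [Lam] times this:
    the block is one Euler step with an averaged coefficient. *)
Let z_quasi e n0 n m : (n0 <= n)%N -> (n <= m)%N ->
  (forall i j, (n0 <= i)%N -> (n0 <= j)%N -> `|w i - w j| <= e) ->
  `|z m - z n - ((tau m - tau n) *: a (z n) + (heta m - heta n) *: b (z n))| <=
  Lam * C * (tau m - tau n) ^+ 2 + e * (1 + Lam * (tau m - tau n)).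
Proof.
move=> n0n nm we.
suff h : `|u m - u n - ((tau m - tau n) *: a (z n) + (heta m - heta n) *: b (z n))| <=
    Lam * (C * (tau m - tau n) + e) * (tau m - tau n).
  rewrite zE addrAC (le_trans (ler_normD _ _))//.
  have := we _ _ (leq_trans n0n nm) n0n; lra.
have e0 : 0 <= e by apply: le_trans (we _ _ n0n n0n).
elim: m nm => [|m IH].
  by rewrite leqn0 => /eqP->; rewrite !subrr !scale0r addr0 subrr normr0 mulr0.
rewrite leq_eqVlt => /predU1P[->|].
  by rewrite !subrr !scale0r addr0 subrr normr0 mulr0.
rewrite ltnS => nm; have {}IH := IH nm.
rewrite uS [u m + _ - _]addrAC tauS hetaS.
rewrite [tau m + _ - _]addrAC [heta m + _ - _]addrAC.
have t0 : 0 <= tau m - tau n by rewrite subr_ge0 tau_le.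
have zb := z_bound nm.
set Dt := tau m - tau n in IH t0 zb *; set Dh := heta m - heta n in IH *.
rewrite (scalerDl _ Dt) (scalerDl _ Dh).
rewrite [_ *: a (z n) + _ + _]addrACA -scalerA -scalerDr.
rewrite [- (Dt *: _ + _ + _)]opprD [X in `|X|]addrACA -scalerBr.
apply: (le_trans (ler_normD _ _)).
have g0 := gam_gt0 m.
have : `|gam m *: (a (z m) + eta m *: b (z m) - (a (z n) + eta m *: b (z n)))| <=
  gam m * (Lam * (C * Dt + e)).
  rewrite normrZ gtr0_norm// ler_pM2l//.
  rewrite (le_trans (drift_lipschitz _ _ _))// ler_wpM2l//.
  by rewrite (le_trans zb)// lerD2l we// (leq_trans n0n).
set q := `|_ *: _| => q1.
have LC : 0 <= Lam * C by rewrite mulr_ge0.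
have Le : 0 <= Lam * e by rewrite mulr_ge0.
have x1 : 0 <= Lam * C * gam m by rewrite mulr_ge0// ltW.
have x2 : 0 <= Lam * C * gam m * Dt by rewrite mulr_ge0.
have x3 : 0 <= Lam * C * gam m * gam m by rewrite mulr_ge0// ltW.
have x4 : 0 <= Lam * e * gam m by rewrite mulr_ge0// ltW.
by nra.
Qed.

(** * The time change: [idx s] is the first step at time [s] or later *)
Let idx_ex (s : R) : exists n, s <= tau n. Proof. exact: gam_div. Qed.
Let idx (s : R) : nat := ex_minn (idx_ex s).

Let idx_ge s : s <= tau (idx s).
Proof. by rewrite /idx; case: ex_minnP. Qed.

Let idx_min s n : s <= tau n -> (idx s <= n)%N.
Proof. by move=> sn; rewrite /idx; case: ex_minnP => k _; apply. Qed.

Let idx_lt s n : tau n < s -> (n < idx s)%N.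
Proof.
move=> ns; rewrite ltnNge -tau_le -ltNge.
exact: lt_le_trans ns (idx_ge s).
Qed.

Let idx_near e : 0 < e -> exists n0, forall s, tau n0 < s -> tau (idx s) < s + e.
Proof.
move=> e0; have /cvgrPdist_lt /(_ _ e0) [n0 _ gn0] := gam_cvg0.
exists n0 => s n0s; have := idx_lt n0s.
case E0 : (idx s) => [//|j]; rewrite ltnS => n0j.
rewrite tauS; apply: ler_ltD.
  by rewrite leNgt; apply/negP => /ltW/idx_min; rewrite E0 ltnn.
by have := gn0 j n0j; rewrite sub0r normrN gtr0_norm.
Qed.

Let tau_infty M : \forall n \near \oo, M <= tau n.
Proof.
have [n0 h] := gam_div M; exists n0 => // n /= n0n.
by rewrite (le_trans h)// tau_le.
Qed.

Let idx_infty t n0 : \forall n \near \oo, (n0 <= idx (tau n + t))%N.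
Proof.
have := tau_infty (tau n0 - t + 1); apply: filterS => n h.
by apply: ltnW; apply: idx_lt; lra.
Qed.

Let idx_cvg t : (fun n => tau (idx (tau n + t)) - tau n) @ \oo --> t.
Proof.
apply/cvgrPdist_lt => e e0; have [n0 hn0] := idx_near e0.
have := tau_infty (tau n0 - t + 1); apply: filterS => n h.
have h1 : tau n0 < tau n + t by lra.
have := hn0 _ h1; have := idx_ge (tau n + t).
by rewrite ltr_norml => *; apply/andP; split; lra.
Qed.


(** * Limit trajectories along an ultrafilter *)
Section UltraLimit.
Variable G : set_system nat.
Hypotheses (uG : UltraFilter G) (oG : \oo `<=` G).

Let cvgG (T : topologicalType) (f : nat -> T) (p : T) : f @ \oo --> p -> f @ G --> p.
Proof. by move=> h B /h oB; exact: oG. Qed.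

(* The translates of the process by [tau n] converge pointwise along [G]. *)
Let limit_ex t : {p : E | S p /\ (fun n => z (idx (tau n + t))) @ G --> p}.
Proof.
apply: cid; have [p Sp pG] := ultra_compact_cvg uG cS (nearW _ (fun n => zS (idx (tau n + t)))).
by exists p.
Qed.

Let y t : E := sval (limit_ex t).

Let yS t : S (y t). Proof. by rewrite /y; case: limit_ex => p []. Qed.

Let y_cvg t : (fun n => z (idx (tau n + t))) @ G --> y t.
Proof. by rewrite /y; case: limit_ex => p []. Qed.

Let w_cvg0 (l1 l2 : nat -> nat) :
  (forall n0, G [set n | (n0 <= l1 n)%N]) -> (forall n0, G [set n | (n0 <= l2 n)%N]) ->
  (fun n => `|w (l1 n) - w (l2 n)|) @ G --> 0.
Proof.
move=> h1 h2; apply/cvgrPdist_lt => e e0.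
have e20 : 0 < e / 2 by rewrite divr_gt0.
have [n0 hn0] := w_cauchy e20.
apply: filterS (filterI (h1 n0) (h2 n0)) => n [/= n1 n2].
rewrite sub0r normrN normr_id (le_lt_trans (hn0 _ _ n1 n2))//.
by rewrite ltr_pdivrMr// mulr2n mulrDr mulr1 ltrDr.
Qed.

Let idx_G t n0 : G [set n | (n0 <= idx (tau n + t))%N].
Proof. exact/oG/idx_infty. Qed.

Let idx_diff s t :
  (fun n => tau (idx (tau n + t)) - tau (idx (tau n + s))) @ G --> t - s.
Proof.
rewrite (_ : (fun n => _) = (fun n => tau (idx (tau n + t)) - tau n) \-
   (fun n => tau (idx (tau n + s)) - tau n)); last first.
  by apply/funext => n /=; ring.
by apply: cvgB; exact/cvgG/idx_cvg.
Qed.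

Let limit_lipschitz s t : `|y s - y t| <= C * `|s - t|.
Proof.
wlog st : s t / s <= t.
  by move=> h; have [/h //|/ltW/h] := leP s t; rewrite distrC [`|t - s|]distrC.
rewrite distrC [`|s - t|]distrC [`|t - s|]ger0_norm ?subr_ge0//.
pose proof (cvg_norm (cvgB (@y_cvg t) (@y_cvg s))) as c1.
pose proof (cvgD (cvgM (cvg_cst C) (@idx_diff s t)) (w_cvg0 (idx_G t) (idx_G s))) as c2.
rewrite addr0 in c2.
apply: ler_cvg_to c1 c2 _; apply: nearW => n; apply: z_bound.
by apply: idx_min; rewrite (le_trans _ (idx_ge _))// lerD2l.
Qed.

Let lip_cvg (f : E -> E) (v : nat -> E) p :
  (forall p q, S p -> S q -> `|f p - f q| <= Lam * `|p - q|) ->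
  (forall n, S (v n)) -> S p -> v @ G --> p -> (fun n => f (v n)) @ G --> f p.
Proof.
move=> fL Sv Sp vp; apply/cvgrPdist_lt => e e0.
have L0 : 0 < Lam + 1 by rewrite ltr_wpDl.
have /cvgrPdist_lt /(_ (e / (Lam + 1))) := vp.
rewrite divr_gt0// => /(_ isT); apply: filterS => n.
rewrite ltr_pdivlMr// mulrC; apply: le_lt_trans.
by rewrite (le_trans (fL _ _ _ _))// ler_wpM2r// lerDl.
Qed.

Let limit_quasi s t : s <= t ->
  exists2 H, eta1 * (t - s) <= H <= eta2 * (t - s) &
  `|y t - y s - ((t - s) *: a (y s) + H *: b (y s))| <= Lam * C * (t - s) ^+ 2.
Proof.
move=> st.
have st' n : (idx (tau n + s) <= idx (tau n + t))%N.
  by apply: idx_min; rewrite (le_trans _ (idx_ge _))// lerD2l.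
pose Hn n := heta (idx (tau n + t)) - heta (idx (tau n + s)).
pose D n := tau (idx (tau n + t)) - tau (idx (tau n + s)).
have Db n : eta1 * D n <= Hn n <= eta2 * D n by exact: heta_bounds.
have c1 : (fun n => eta1 * D n) @ G --> eta1 * (t - s).
  by apply: cvgM; [exact: cvg_cst|exact: idx_diff].
have c2 : (fun n => eta2 * D n) @ G --> eta2 * (t - s).
  by apply: cvgM; [exact: cvg_cst|exact: idx_diff].
have [H HH] : exists H : R, Hn @ G --> H.
  have sH : \forall n \near G, Hn n \in `[eta1 * (t - s) - 1, eta2 * (t - s) + 1].
    have h1 : \forall n \near G, eta1 * (t - s) - 1 <= eta1 * D n.
      by apply: cvgr_ge c1 _ _; rewrite gtrBl.
    have h2 : \forall n \near G, eta2 * D n <= eta2 * (t - s) + 1.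
      by apply: cvgr_le c2 _ _; rewrite ltrDl.
    apply: filterS2 h1 h2 => n n1 n2; have /andP[b1 b2] := Db n.
    by rewrite /= in_itv/= (le_trans n1 b1) (le_trans b2 n2).
  have [H _ HH] := ultra_compact_cvg uG (@segment_compact R _ _) sH.
  by exists H.
exists H.
  apply/andP; split; [apply: ler_cvg_to c1 HH _|apply: ler_cvg_to HH c2 _].
    by apply: nearW => n; have /andP[] := Db n.
  by apply: nearW => n; have /andP[] := Db n.
have ca := lip_cvg aLip (fun n => zS (idx (tau n + s))) (yS s) (@y_cvg s).
have cb := lip_cvg bLip (fun n => zS (idx (tau n + s))) (yS s) (@y_cvg s).
pose proof (cvg_norm (cvgB (cvgB (@y_cvg t) (@y_cvg s)) 
  (cvgD (cvgZ (@idx_diff s t) ca) (cvgZ HH cb)))) as c3.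
pose proof (cvgM (cvg_cst (Lam * C)) (cvgM (@idx_diff s t) (@idx_diff s t))) as c4.
have bnd e : 0 < e -> `|y t - y s - ((t - s) *: a (y s) + H *: b (y s))| <=
    Lam * C * (t - s) ^+ 2 + e * (1 + Lam * (t - s)).
  move=> e0; have [n0 we] := w_cauchy e0.
  pose proof (cvgD c4 (cvgM (cvg_cst e) (cvgD (cvg_cst (1 : R)) (cvgM (cvg_cst Lam) (@idx_diff s t))))) as c5.
  apply: ler_cvg_to c3 c5 _.
  apply: filterS (idx_G s n0) => n n0n; have := z_quasi n0n (st' n).
  by apply => i j; exact: we.
apply/ler_addgt0Pl => e e0.
have q0 : 0 < 1 + Lam * (t - s) by rewrite ltr_pwDl// mulr_ge0// subr_ge0.
by have := bnd _ (divr_gt0 e0 q0); rewrite divfK ?gt_eqF// [e + _]addrC.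
Qed.


Let z_dist n m : `|z m - z n| <= C * `|tau m - tau n| + `|w m - w n|.
Proof.
have [nm|/ltnW mn] := leqP n m.
  by rewrite [X in C * X]ger0_norm ?z_bound// subr_ge0 tau_le.
rewrite distrC [`|tau m - _|]distrC [`|w m - _|]distrC.
by rewrite [X in C * X]ger0_norm ?z_bound// subr_ge0 tau_le.
Qed.

(** The trajectory seen from a point of the sequence converges along the
    ultrafilter to a complete solution inside the limit set. The last clause
    allows any indexing with the right asymptotic times, not only [idx]. *)
Lemma limit_solution : exists y : R -> E,
  [/\ isSolution (affineDrift S a b eta1 eta2) setT y,
      forall t, cluster (z @ \oo) (y t),
      forall s t, `|y s - y t| <= C * `|s - t| &
      forall (l : nat -> nat) t, (forall n0, G [set n | (n0 <= l n)%N]) ->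
        (fun n => tau (l n) - tau n) @ G --> t -> (fun n => z (l n)) @ G --> y t].
Proof.
exists y; split.
- exact: (@quasi_solution_isSolution _ _ _ _ _ _ _ (Lam * C) C).
- move=> t A B [n0 _ n0A] yB.
  have h : G [set n | B (z (idx (tau n + t)))] := y_cvg yB.
  have [n [/= n1 n2]] := filter_ex (filterI (idx_G t n0) h).
  by exists (z (idx (tau n + t))); split => //; exact: n0A.
- exact: limit_lipschitz.
move=> l t lG lt.
have c0 : (fun n => `|tau (l n) - tau (idx (tau n + t))|) @ G --> 0.
  apply/norm_cvg0P; rewrite -(subrr t).
  rewrite (_ : (fun n => _) = (fun n => tau (l n) - tau n) \-
     (fun n => tau (idx (tau n + t)) - tau n)).
    by apply: cvgB lt _; exact/cvgG/idx_cvg.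
  by apply/funext => n /=; ring.
pose proof (cvgD (cvgM (cvg_cst C) c0) (w_cvg0 lG (idx_G t))) as c1.
rewrite mulr0 addr0 in c1.
suff c2 : (fun n => z (l n) - z (idx (tau n + t))) @ G --> 0.
  rewrite -[y t]add0r (_ : (fun n => _) = (fun n => z (l n) - z (idx (tau n + t))) \+
     (fun n => z (idx (tau n + t)))); first exact: cvgD c2 (@y_cvg t).
  by apply/funext => n /=; rewrite subrK.
apply/cvgrPdist_lt => e e0; move/cvgrPdist_lt : c1 => /(_ _ e0); apply: filterS => n.
rewrite !sub0r !normrN; apply: le_lt_trans; rewrite (le_trans (z_dist _ _))//.
exact: ler_norm.
Qed.

End UltraLimit.

Local Notation F := (affineDrift S a b eta1 eta2).
Local Notation L := (cluster (z @ \oo)).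

Let clS : closed S.
Proof. by apply: compact_closed cS; exact: norm_hausdorff. Qed.

Lemma limit_set_sub : L `<=` S.
Proof.
move=> p /ultra_cluster[G [uG oG zp]].
by apply: (@closed_cvg _ _ G _ z S clS _ _ zp); exact: nearW.
Qed.

Lemma limit_set_compact : compact L.
Proof.
apply: subclosed_compact cS limit_set_sub.
by rewrite clusterE; apply: closed_bigI => A _; exact: closed_closure.
Qed.

Let ultra_limit_set (G : set_system nat) : UltraFilter G -> \oo `<=` G ->
  exists2 p, L p & z @ G --> p.
Proof.
move=> uG oG; have [p Sp zp] := ultra_compact_cvg uG cS (nearW _ zS).
exists p => // A B oA pB.
have hA : G (z @^-1` A) by exact: oG.
have hB : G (z @^-1` B) by exact: zp.
by have [n [An Bn]] := filter_ex (filterI hA hB); exists (z n).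
Qed.

(** Otherwise the sequence would have a limit, along some ultrafilter, outside
    the neighbourhood. *)
Let near_limit_set (V : set E) : open V -> L `<=` V -> \forall n \near \oo, V (z n).
Proof.
move=> oV LV; apply: contrapT => nV.
have [n0|G [uG oG GP]] := @ultra_frequently [set n | ~ V (z n)].
  apply: contrapT => h; apply: nV; exists n0 => // n /= n0n.
  by apply: contrapT => nVn; apply: h; exists n.
have [p /LV Vp zp] := ultra_limit_set uG oG.
have GV : G [set n | V (z n)] by apply: zp; exact: open_nbhs_nbhs.
by have [n []] := filter_ex (filterI GP GV).
Qed.

Lemma limit_set_converges : convergesTo z L.
Proof.
pose D n := ereal_inf [set `|z n - w|%:E | w in L].
have D0 n : (0 <= D n)%E.
  by apply: le_ereal_inf_tmp => _ [q _ <-]; rewrite lee_fin.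
have De e : 0 < e -> \forall n \near \oo, (D n <= e%:E)%E.
  move=> e0; pose V := \bigcup_(p in L) ball p e.
  have oV : open V by apply: bigcup_open => p _; exact: ball_open.
  have LV : L `<=` V by move=> p Lp; exists p => //; exact: ballxx.
  apply: filterS (near_limit_set oV LV) => n [p Lp].
  rewrite -ball_normE /= => pz; apply: ge_ereal_inf; exists `|z n - p|%:E; first by exists p.
  by rewrite lee_fin distrC ltW.
have Dfin : \forall n \near \oo, D n \is a fin_num.
  apply: filterS (De 1 ltr01) => n Dn; rewrite ge0_fin_numE//.
  by rewrite (le_lt_trans Dn)// ltry.
apply/fine_cvgP; split=> //; apply/cvgrPdist_le => e e0.
apply: filterS2 Dfin (De e e0) => n Dn Dne.
have h : fine (D n) <= e by rewrite -lee_fin fineK.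
by rewrite sub0r normrN ger0_norm//=; apply: fine_ge0; exact: D0.
Qed.

Let w_diff0 (G : set_system nat) : UltraFilter G -> \oo `<=` G -> 
  (fun n => z n.+1 - z n) @ G --> 0.
Proof.
move=> uG oG; apply/cvgrPdist_lt => e e0; apply: oG.
have e20 : 0 < e / 2 by rewrite divr_gt0.
have C10 : 0 < C + 1 by rewrite ltr_wpDl.
have [n0 wn0] := w_cauchy e20.
have /cvgrPdist_lt /(_ (e / 2 / (C + 1))) := gam_cvg0.
rewrite divr_gt0// => /(_ isT) [n1 _ gn1]; exists (maxn n0 n1) => // n /=.
rewrite geq_max => /andP[n0n n1n]; rewrite sub0r normrN.
rewrite (le_lt_trans (z_bound (leqnSn n)))// (splitr e) ltr_leD//; last first.
  by apply: wn0 => //; exact: leqW.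
have := gn1 _ n1n; rewrite /= sub0r normrN gtr0_norm// ltr_pdivlMr// => h.
rewrite tauS addrAC subrr add0r; apply: le_lt_trans h.
by rewrite mulrC ler_pM2l// lerDl.
Qed.

(** Steps tend to 0, so the sequence cannot jump for ever between two
    separated pieces of its limit set. *)
Lemma limit_set_connected : connected L.
Proof.
move=> B [q Bq] [V1 oV1 BV1] [C1 cC1 BC1].
have clL : closed L by apply: compact_closed limit_set_compact; exact: norm_hausdorff.
apply/seteqP; split=> [p|p Lp]; first by rewrite BV1 => -[].
apply: contrapT => nBp.
have cB : closed B by rewrite BC1; exact: closedI.
pose B' := L `&` ~` V1.
have cB' : closed B' by apply: closedI => //; exact: open_closedC.
have BB' : B `&` B' = set0.
  by rewrite -subset0 => r [+ [_]]; rewrite BV1 => -[].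
have [OA [OB [oA oB BA BB AB0]]] : exists OA OB, [/\ open OA, open OB, B `<=` OA, B' `<=` OB & OA `&` OB = set0].
  exact: (normal_openP.1 (@pseudometric_normal R E)).
have B'p : B' p by split => // V1p; apply: nBp; rewrite BV1.
have Lcov : L `<=` OA `|` OB.
  move=> r Lr; have [V1r|nV1r] := pselect (V1 r).
    by left; apply: BA; rewrite BV1.
  by right; apply: BB.
have [n0 _ cov] := near_limit_set (openU oA oB) Lcov.
have freq (O : set E) r : open O -> L r -> O r -> forall m, exists2 n, (m <= n)%N & O (z n).
  move=> oO Lr Or m; have [//||x [[n mn <-] Ox]] := Lr (z @` [set n | (m <= n)%N]) O.
  - by exists m => // n mn; exists n.
  - exact: open_nbhs_nbhs.
  - by exists n.
have fB := freq OB p oB Lp (BB _ B'p).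
have Lq : L q by move: Bq; rewrite BV1 => -[].
have fA := freq OA q oA Lq (BA _ Bq).
have [m|G [uG oG GP]] := @ultra_frequently [set n | OA (z n) /\ OB (z n.+1)].
  have [i mi Ai] := fA (maxn m n0).
  have [j ij Bj] := fB i.
  have : exists2 n, (maxn m n0 <= n)%N & OA (z n) /\ ~ OA (z n.+1).
    apply: contrapT => h.
    have AA l : OA (z (i + l)%N).
      elim: l => [|l IH]; first by rewrite addn0.
      apply: contrapT => nA; apply: h; exists (i + l)%N; first exact: leq_trans mi (leq_addr _ _).
      by rewrite -addnS.
    have : (OA `&` OB) (z j) by split => //; rewrite -(subnKC ij).
    by rewrite AB0.
  move=> [n + [An nAn]]; rewrite geq_max => /andP[mn n0n].
  by exists n => //; split => //; have [] := cov n.+1 (leqW n0n).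
have [r Lr zr] := ultra_limit_set uG oG.
have zr' : (fun n => z n.+1) @ G --> r.
  rewrite -[r]add0r (_ : (fun n => _) = (fun n => z n.+1 - z n) \+ z).
    by apply: cvgD zr; exact: w_diff0.
  by apply/funext => n /=; rewrite subrK.
have [Ar|Br] := Lcov _ Lr.
  have h : G [set n | OA (z n.+1)] by apply: zr'; exact: open_nbhs_nbhs.
  have [n [[_ ?] ?]] := filter_ex (filterI GP h).
  have : (OA `&` OB) (z n.+1) by [].
  by rewrite AB0.
have h : G [set n | OB (z n)] by apply: zr; exact: open_nbhs_nbhs.
have [n [[? _] ?]] := filter_ex (filterI GP h).
have : (OA `&` OB) (z n) by [].
by rewrite AB0.
Qed.

(** From [p] the solution is a limit of translates of the sequence starting
    near [p]. *)
Lemma limit_set_invariant : invariantSet F L.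
Proof.
move=> p /ultra_cluster[G [uG oG zp]].
have [y [yF yL _ yc]] := limit_solution uG oG.
exists y; split => //.
have c0 : (fun n => z n) @ G --> y 0.
  apply: (yc id); first by move=> n0; apply: oG; exists n0.
  by under eq_fun do rewrite subrr; exact: cvg_cst.
exact: (cvg_unique _ c0 zp).
Qed.

(** Uniformly in the starting index, a stretch of the sequence lasting between
    [T] and [3 T] has both its ends close to those of a complete solution in the
    limit set: bad stretches would have a limit solution along an ultrafilter. *)
Let tracking e T : 0 < e -> exists n0, forall n l, (n0 <= n)%N -> (n <= l)%N ->
  T <= tau l - tau n <= 3 * T -> exists y,
  [/\ isSolution F setT y, (forall t, L (y t)), `|y 0 - z n| < e &
      `|y (tau l - tau n) - z l| < e].
Proof.
move=> e0; apply: contrapT => /forallNP bad.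
pose P n l := [/\ (n <= l)%N, T <= tau l - tau n <= 3 * T & ~ exists y,
  [/\ isSolution F setT y, (forall t, L (y t)), `|y 0 - z n| < e &
      `|y (tau l - tau n) - z l| < e]].
have [|G [uG oG GP]] := @ultra_frequently [set n | exists l, P n l].
  move=> n0; have /existsNP[n /existsNP[l /not_implyP[n0n /not_implyP[nl /not_implyP[h1 h2]]]]] := bad n0.
  by exists n => //; exists l.
have [l lP] : exists l : nat -> nat, forall n, (exists l, P n l) -> P n (l n).
  have ch n : exists l, (exists l, P n l) -> P n l.
    by have [[l Pl]|h] := pselect (exists l, P n l); [exists l|exists 0%N].
  by have [l] := choice ch; exists l.
have [y [yF yL yC yc]] := limit_solution uG oG.
have [||t _ tlim] := @ultra_compact_cvg R G `[T, 3 * T] (fun n => tau (l n) - tau n) uG.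
- exact: segment_compact.
- by apply: filterS GP => n /lP[].
have lG n0 : G [set n | (n0 <= l n)%N].
  have h : G [set n | (n0 <= n)%N] by apply: oG; exists n0.
  by apply: filterS2 h GP => n /= n0n /lP[/(leq_trans n0n)].
have c0 : (fun n => `|y 0 - z n|) @ G --> 0.
  have h : (fun n => z n) @ G --> y 0.
    apply: (yc id); first by move=> n0; apply: oG; exists n0.
    by under eq_fun do rewrite subrr; exact: cvg_cst.
  by apply/norm_cvg0P; rewrite -(subrr (y 0)); apply: cvgB h; exact: cvg_cst.
have c1 : (fun n => `|y (tau (l n) - tau n) - z (l n)|) @ G --> 0.
  apply/norm_cvg0P; rewrite -(subrr (y t)); apply: cvgB; last exact: yc.
  have ycont := lipschitz_continuous yC.
  by apply: continuous_cvg tlim; exact: ycont.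
have h0 : G [set n | `|y 0 - z n| < e] by apply: cvgr_lt c0 _ _.
have h1 : G [set n | `|y (tau (l n) - tau n) - z (l n)| < e].
  by apply: cvgr_lt c1 _ _.
have [n [[Pn n1] n2]] := filter_ex (filterI (filterI GP h0) h1).
by have [_ _] := lP _ Pn; apply; exists y.
Qed.


(** The conclusion of chain transitivity, named to build chains by induction. *)
Definition chainFrom e T (p q : E) := exists (m : nat) (pt : nat -> E)
    (x : nat -> R -> E) (t : nat -> R),
  [/\ (1 <= m)%N, pt 0%N = p, pt m = q, (forall i, (i <= m)%N -> L (pt i)) &
        forall i, (1 <= i <= m)%N ->
          [/\ isSolution F `[0, +oo[ (x i), x i 0 = pt i.-1, T < t i,
              (forall s, 0 <= s <= t i -> L (x i s)) &
              `|x i (t i) - pt i| < e]].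

Let sol_sub (J : set R) y : isSolution F setT y -> isSolution F J y.
Proof.
move=> [h1 h2]; split=> [c d cd _|]; first exact: h1.
by apply: filterS h2; first exact: (ae_filter_ringOfSetsType lebesgue_measure); move=> t /(_ I).
Qed.

Let chain1 e T y t q : isSolution F setT y -> (forall s, L (y s)) -> T < t ->
  L q -> `|y t - q| < e -> chainFrom e T (y 0) q.
Proof.
move=> yF yL Tt Lq yq.
exists 1%N, (fun i => if i is 0%N then y 0 else q), (fun=> y), (fun=> t).
split=> // [[|i] //|[//|[|//]] _]; split => //; exact: sol_sub.
Qed.

Let chainS e T y t p q : isSolution F setT y -> (forall s, L (y s)) -> T < t ->
  `|y t - p| < e -> chainFrom e T p q -> chainFrom e T (y 0) q.
Proof.
move=> yF yL Tt yp [m [pt [x [tt [m1 pt0 ptm ptL ptx]]]]].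
exists m.+1, (fun i => if i is j.+1 then pt j else y 0),
  (fun i => if i is j.+2 then x j.+1 else y), (fun i => if i is j.+2 then tt j.+1 else t).
split => // [[|i]//|]; first by rewrite ltnS => /ptL.
move=> [//|[|i]]; last by rewrite !ltnS => h; apply: (ptx i.+1).
by move=> _; split => //; [exact: sol_sub|rewrite pt0].
Qed.

(** Follow the sequence from near [p] to near [q], cut it into stretches lasting
    between [T1] and [3 T1], and replace each by a solution that tracks it. The
    first solution starts exactly at [p], as a limit along an ultrafilter. *)
Lemma limit_set_chain_transitive : chainTransitive F L.
Proof.
move=> e T p q e0 T0 Lp Lq; rewrite -/(chainFrom e T p q).
have e20 : 0 < e / 2 by rewrite divr_gt0.
pose T1 := T + 1; have TT1 : T < T1 by rewrite ltrDl.
have T10 : 0 < T1 by apply: lt_trans TT1.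
have [n0 trk] := tracking T1 e20.
have [n1 _ gT1] : \forall n \near \oo, gam n <= T1 by apply: cvgr_le gam_cvg0 _ T10.
pose n2 := maxn n0 n1.
have chain_along l : `|z l - q| < e / 2 -> forall d n, (l - n <= d)%N -> (n2 <= n)%N ->
    T1 <= tau l - tau n -> exists2 r, `|r - z n| < e / 2 & chainFrom e T r q.
  move=> lq; elim=> [|d IH] n lnd n2n Tl.
    move: lnd; rewrite leqn0 subn_eq0 -tau_le => h; move: Tl; lra.
  have nl : (n <= l)%N by rewrite -tau_le; move: Tl; lra.
  have n0n : (n0 <= n)%N by apply: leq_trans n2n; exact: leq_maxl.
  (* cutting only above 3 T1 leaves at least T1 after a stretch of at most 2 T1 *)
  have [short|long] := leP (tau l - tau n) (3 * T1).
    have [|y [yF yL y0 yl]] := trk n l n0n nl; first by rewrite Tl.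
    exists (y 0) => //; apply: (@chain1 _ _ _ (tau l - tau n)) => //.
      exact: lt_le_trans Tl.
    rewrite -(subrK (z l) (y _)) -addrA (le_lt_trans (ler_normD _ _))//.
    by rewrite (splitr e) ltrD.
  pose n' := idx (tau n + T1).
  have n'1 : tau n + T1 <= tau n' by exact: idx_ge.
  have nn' : (n < n')%N by apply: idx_lt; rewrite ltrDl.
  have n'2 : tau n' <= tau n + 2 * T1.
    move: nn' n'1; rewrite /n'; case E0 : (idx _) => [//|j]; rewrite ltnS => nj n'1.
    have : tau j <= tau n + T1.
      by rewrite leNgt; apply/negP => /ltW/idx_min; rewrite E0 ltnn.
    have : gam j <= T1.
      by apply: gT1; apply: leq_trans (leq_trans n2n nj); exact: leq_maxr.
    rewrite tauS; lra.
  have n'l : (n' <= l)%N by rewrite -tau_le; move: long n'2 T10; lra.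
  have [|||r rn' rq] := IH n'.
  - by rewrite -ltnS (leq_trans _ lnd)// ltn_sub2l// (leq_trans nn').
  - by apply: leq_trans n2n _; exact: ltnW.
  - by move: long n'2; lra.
  have [|y [yF yL y0 yn']] := trk n n' n0n (ltnW nn').
    by apply/andP; split; lra.
  exists (y 0) => //; apply: (@chainS _ _ _ (tau n' - tau n) r) => //.
    by move: n'1 TT1; lra.
  rewrite -(subrK (z n') (y _)) -addrA (le_lt_trans (ler_normD _ _))//.
  by rewrite (splitr e) ltrD// distrC.
have [G [uG oG zp]] := ultra_cluster Lp.
have [y [yF yL _ yc]] := limit_solution uG oG.
have y0 : y 0 = p.
  have c0 : (fun n => z n) @ G --> y 0.
    apply: (yc id); first by move=> m0; apply: oG; exists m0.
    by under eq_fun do rewrite subrr; exact: cvg_cst.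
  exact: (cvg_unique _ c0 zp).
pose l n := idx (tau n + T1).
have lG m0 : G [set n | (m0 <= l n)%N] by exact/oG/idx_infty.
have zl : (fun n => z (l n)) @ G --> y T1.
  by apply: yc => // A hA; apply: oG; exact: (idx_cvg hA).
have h1 : G [set n | `|y T1 - z (l n)| < e / 2].
  by move/cvgrPdist_lt : zl; apply.
have [n [/= n1l n1y]] := filter_ex (filterI (lG n2) h1).
have [l' Tl' lq] : exists2 l', T1 <= tau l' - tau (l n) & `|z l' - q| < e / 2.
  have [m0 _ hm0] := tau_infty (T1 + tau (l n)).
  have [||x [[l' ml' <-] xq]] := Lq (z @` [set l' | (m0 <= l')%N]) (ball q (e / 2)).
  - by exists m0 => // k mk; exists k.
  - exact: nbhsx_ballx.
  exists l'; first by rewrite lerBrDr; exact: hm0.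
  by move: xq; rewrite -ball_normE/= distrC.
have [r rn rq] := chain_along _ lq _ _ (leqnn _) n1l Tl'.
rewrite -y0; apply: (@chainS _ _ _ T1 r) => //.
rewrite -(subrK (z (l n)) (y _)) -addrA (le_lt_trans (ler_normD _ _))//.
by rewrite (splitr e) ltrD// distrC.
Qed.

End LimitSet.

(** * The drift on the domain of the proportions *)

Lemma derivable_pair {R : realType} {U V : normedModType R} (f : R -> U * V) (t : R) :
  derivable (fst \o f) t 1 -> derivable (snd \o f) t 1 -> derivable f t 1.
Proof.
move=> /cvg_ex[l1 h1] /cvg_ex[l2 h2]; apply/cvg_ex; exists (l1, l2).
exact: cvg_pair h1 h2.
Qed.

Section Drift.
Context {R : realType}.
Local Notation E := (R * R * R)%type.

Lemma norm3_le (x y z c : R) : (`|(x, y, z) : E| <= c) = [&& `|x| <= c, `|y| <= c & `|z| <= c].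
Proof. by rewrite !prod_normE/= !ge_max -andbA. Qed.

Lemma norm3_coord (p : E) : [/\ `|p.1.1| <= `|p|, `|p.1.2| <= `|p| & `|p.2| <= `|p|].
Proof.
case: p => -[x y] z /=; have := norm3_le x y z `|(x, y, z) : E|.
by rewrite lexx => /esym/and3P.
Qed.

Lemma aeDerivable3 : @aeDerivable R E.
Proof.
move=> x C xC.
have co s t := norm3_coord (x s - x t).
have f1 : {ae lebesgue_measure, forall t, derivable (fun t => (x t).1.1) t 1}.
  by apply: (@lipschitz_ae_derivable _ _ C) => s t; apply: le_trans (xC s t); case: (co s t).
have f2 : {ae lebesgue_measure, forall t, derivable (fun t => (x t).1.2) t 1}.
  by apply: (@lipschitz_ae_derivable _ _ C) => s t; apply: le_trans (xC s t); case: (co s t).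
have f3 : {ae lebesgue_measure, forall t, derivable (fun t => (x t).2) t 1}.
  by apply: (@lipschitz_ae_derivable _ _ C) => s t; apply: le_trans (xC s t); case: (co s t).
have F := ae_filter_ringOfSetsType (@lebesgue_measure R).
apply: filterS2 (filterI f1 f2) f3 => t [d1 d2] d3.
by apply: derivable_pair => //; exact: derivable_pair.
Qed.

Lemma Shat_compact : compact (@Shat R).
Proof.
pose K := (`[0:R, 1] `*` `[0:R, 1]) `*` `[0:R, 1].
have cK : compact K by do 2 (apply: compact_setX; last exact: segment_compact); exact: segment_compact.
apply: (subclosed_compact _ cK); last by move=> [[x y] z] [].
have -> : @Shat R = K `&` [set p : E | p.1.2 <= p.2].
  by apply/seteqP; split => [[[x y] z]|[[x y] z]] [] /=; [move=> *; split|move=> [[? ?] ?] ?; split].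
apply: closedI; first by apply: compact_closed cK; exact: norm_hausdorff.
rewrite (_ : [set p : E | _] = (fun p : E => p.2 - p.1.2) @^-1` [set x | 0 <= x]).
  apply: closed_comp; last exact: closed_ge.
  move=> p _; apply: cvgB; first exact: cvg_snd.
  by apply: (@cvg_comp _ _ _ fst snd (nbhs p) (nbhs p.1)); [exact: cvg_fst|exact: cvg_snd].
by apply/seteqP; split => p /=; rewrite subr_ge0.
Qed.

Variables (g : R -> R) (alpha Lg : R).
Hypothesis alpha0 : 0 < alpha.
Hypothesis g01 : forall x, x \in `[0, 1] -> g x \in `[0, 1].
Hypothesis Lg0 : 0 <= Lg.
Hypothesis gL : forall x y, x \in `[0, 1] -> y \in `[0, 1] -> `|g x - g y| <= Lg * `|x - y|.

Lemma qalpha01 p : Shat p -> qalpha alpha p \in `[0, 1].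
Proof.
case: p => -[a b] c [] /=; rewrite !in_itv/= => /andP[a0 a1] /andP[b0 b1] /andP[c0 c1] bc.
rewrite /qalpha /= divr_ge0 ?ler_pdivrMr ?mul1r; last 3 first.
- by rewrite ltr_wpDl.
- by rewrite addr_ge0// mulr_ge0// ltW.
- by rewrite addr_ge0// ltW.
by rewrite lerD// ler_piMr// ltW.
Qed.

(** Lipschitz constant of [qalpha], whose denominator is at least [alpha]. *)
Definition qalphaLip : R := (2 + alpha) / alpha.

Lemma qalphaLip_gt0 : 0 < qalphaLip. Proof. by rewrite divr_gt0// addr_gt0. Qed.

Lemma qalphaL p p' : Shat p -> Shat p' -> `|qalpha alpha p - qalpha alpha p'| <= qalphaLip * `|p - p'|.
Proof.
move=> Sp Sp'; have := qalpha01 Sp'; rewrite /qalpha.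
set N := p.1.2 + alpha * p.1.1; set D := p.2 + alpha.
set N' := p'.1.2 + alpha * p'.1.1; set D' := p'.2 + alpha.
rewrite in_itv/= => /andP[q0 q1].
have [n1 n2 n3] := norm3_coord (p - p'); rewrite /= in n1 n2 n3.
have aD : alpha <= D.
  by rewrite /D; case: Sp => _ _; rewrite in_itv/= => /andP[c0 _] _; rewrite lerDr.
have D0 : 0 < D by apply: lt_le_trans aD.
have D'0 : 0 < D'.
  by rewrite /D'; case: Sp' => _ _; rewrite in_itv/= => /andP[c0 _] _; rewrite ltr_wpDl.
have -> : N / D - N' / D' = ((N - N') + (N' / D') * (D' - D)) / D.
  by field; rewrite !gt_eqF.
rewrite normrM normfV (gtr0_norm D0) ler_pdivrMr//.
have x0 := normr_ge0 (p - p').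
apply: (@le_trans _ _ ((2 + alpha) * `|p - p'|)).
  apply: (le_trans (ler_normD _ _)).
  have e1 : `|N - N'| <= (1 + alpha) * `|p - p'|.
    have -> : N - N' = (p.1.2 - p'.1.2) + alpha * (p.1.1 - p'.1.1) by rewrite /N /N'; ring.
    rewrite (le_trans (ler_normD _ _))// mulrDl mul1r lerD// normrM gtr0_norm// ler_pM2l//.
  have e2 : `|N' / D' * (D' - D)| <= `|p - p'|.
    rewrite normrM ger0_norm// (le_trans (ler_piMl _ q1))//.
    have -> : D' - D = - (p.2 - p'.2) by rewrite /D /D'; ring.
    by rewrite normrN.
  by lra.
have -> : qalphaLip * `|p - p'| * D = (2 + alpha) * `|p - p'| * (D / alpha).
  by rewrite /qalphaLip; ring.
apply: ler_peMr; first by rewrite mulr_ge0// addr_ge0// ltW.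
by rewrite ler_pdivlMr// mul1r.
Qed.

(** Common Lipschitz constant of [h1], [h2] and [h3]; the factor 3 comes from
    [psi], which is [2 * phi] plus terms of slope at most 1 in [x] and in [g x]. *)
Definition driftLip : R := 3 * (1 + Lg) * qalphaLip + 1.

Lemma drift_coord_lipschitz p p' : Shat p -> Shat p' ->
  [/\ `|h1 g alpha p - h1 g alpha p'| <= driftLip * `|p - p'|,
      `|h2 g alpha p - h2 g alpha p'| <= driftLip * `|p - p'| &
      `|h3 g alpha p - h3 g alpha p'| <= driftLip * `|p - p'|].
Proof.
move=> Sp Sp'; rewrite /h1 /h2 /h3.
have q := qalpha01 Sp; have q' := qalpha01 Sp'; have qL := qalphaL Sp Sp'.
set x := qalpha alpha p in q qL *; set y := qalpha alpha p' in q' qL *.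
have [n1 n2 n3] := norm3_coord (p - p'); rewrite /= in n1 n2 n3.
have gxy : `|g x - g y| <= Lg * (qalphaLip * `|p - p'|).
  by rewrite (le_trans (gL q q'))// ler_wpM2l.
have gx := g01 q; have gy := g01 q'.
move: q q' gx gy; rewrite !in_itv/= => /andP[x0 x1] /andP[y0 y1] /andP[gx0 gx1] /andP[gy0 gy1].
have d0 : 0 <= qalphaLip * `|p - p'| by rewrite mulr_ge0// ltW// qalphaLip_gt0.
have dg0 : 0 <= Lg * (qalphaLip * `|p - p'|) by rewrite mulr_ge0.
have xg : `|x * g x - y * g y| <= (1 + Lg) * (qalphaLip * `|p - p'|).
  have -> : x * g x - y * g y = (x - y) * g x + y * (g x - g y) by ring.
  rewrite (le_trans (ler_normD _ _))// [leRHS]mulrDl mul1r lerD//.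
    by rewrite normrM (le_trans (ler_piMr _ _))// ger0_norm.
  by rewrite normrM (le_trans (ler_piMl _ _))// ger0_norm.
have -> : driftLip * `|p - p'| = 3 * ((1 + Lg) * (qalphaLip * `|p - p'|)) + `|p - p'|.
  by rewrite /driftLip; ring.
rewrite mulrDl mul1r in xg *.
set A := qalphaLip * _ in qL gxy d0 dg0 xg *; set B := Lg * A in gxy dg0 xg *.
move: xg gxy n1 n2 n3 qL; set gp := g x; set gq := g y.
rewrite !ler_norml => /andP[? ?] /andP[? ?] /andP[? ?] /andP[? ?] /andP[? ?] /andP[? ?].
split; apply/andP; split; lra.
Qed.

Lemma drift_coord_bounded p : Shat p ->
  [/\ `|h1 g alpha p| <= 1, `|h2 g alpha p| <= 1 & `|h3 g alpha p| <= 1].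
Proof.
move=> Sp; rewrite /h1 /h2 /h3.
have q := qalpha01 Sp; set x := qalpha alpha p in q *.
have gx := g01 q; set y := g x in gx *.
case: Sp; rewrite !in_itv/= in q gx *.
move: q gx => /andP[x0 x1] /andP[y0 y1] /andP[? ?] /andP[? ?] /andP[? ?] _.
have xy0 : 0 <= x * y by rewrite mulr_ge0.
have xy1 : x * y <= 1 by rewrite mulr_ile1.
have z0 : 0 <= (1 - x) * (1 - y) by rewrite mulr_ge0// subr_ge0.
have z1 : x * y + (1 - x) * (1 - y) <= 1 by nra.
by rewrite !ler_norml; split; apply/andP; split; lra.
Qed.

Variables (eta1 eta2 : R).
Hypothesis eta10 : 0 < eta1.

(** The drift is [drift0 + eta * drift1]: only the first coordinate sees the
    ratio between the two time scales. *)
Definition drift0 (p : E) : E := (0, h2 g alpha p, h3 g alpha p).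
Definition drift1 (p : E) : E := (h1 g alpha p, 0, 0).

Lemma drift01E (e : R) p : drift0 p + e *: drift1 p = (e * h1 g alpha p, h2 g alpha p, h3 g alpha p).
Proof. by rewrite /drift0 /drift1; congr (_, _, _); rewrite /= ?add0r ?scaler0 ?addr0. Qed.

Lemma drift_affine : drift g alpha eta1 eta2 = affineDrift (@Shat R) drift0 drift1 eta1 eta2.
Proof.
by apply/funext => p; apply/seteqP; split => v [Sp [e eI ->]]; split => //; exists e; rewrite ?drift01E.
Qed.

Lemma driftLip_ge0 : 0 <= driftLip.
Proof.
have h := ltW qalphaLip_gt0.
by apply: addr_ge0 => //; apply: mulr_ge0 => //; apply: mulr_ge0 => //; exact: addr_ge0.
Qed.

End Drift.

(** * Series with the Cauchy property *)

Section CauchySeries.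
Context {R : realType}.
Implicit Types a b : nat -> R.

Definition cauchySeries a := forall e, 0 < e -> exists n0, forall m n,
  (n0 <= m)%N -> (m <= n)%N -> `|\sum_(m <= i < n) a i| <= e.

Lemma cvg_cauchySeries N a : cvgn (fun n => \sum_(N <= i < n) a i) -> cauchySeries a.
Proof.
move=> /cvg_ex[l /cvgrPdist_le cl] e e0.
have [n1 _ hn1] := cl _ (divr_gt0 e0 (ltr0Sn R 1)).
exists (maxn n1 N) => m n; rewrite geq_max => /andP[n1m Nm] mn.
have := hn1 m n1m; have := hn1 n (leq_trans n1m mn).
rewrite /= (@big_cat_nat _ _ _ m N n)//=.
set A := \sum_(N <= i < m) _; set B := \sum_(m <= i < n) _.
rewrite !ler_norml => /andP[? ?] /andP[? ?]; apply/andP; split; lra.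
Qed.

Lemma cauchySeriesD a b : cauchySeries a -> cauchySeries b ->
  cauchySeries (fun n => a n + b n).
Proof.
move=> ca cb e e0; have e20 : 0 < e / 2 by rewrite divr_gt0.
have [n1 h1] := ca _ e20; have [n2 h2] := cb _ e20.
exists (maxn n1 n2) => m n; rewrite geq_max => /andP[n1m n2m] mn.
by rewrite big_split (le_trans (ler_normD _ _))// (splitr e) lerD// (h1, h2).
Qed.

Lemma cauchySeriesZ c a : cauchySeries a -> cauchySeries (fun n => c * a n).
Proof.
move=> ca e e0; have c0 : 0 < `|c| + 1 by rewrite ltr_wpDl.
have [n0 h] := ca _ (divr_gt0 e0 c0); exists n0 => m n n0m mn.
have := h _ _ n0m mn; rewrite ler_pdivlMr// -mulr_sumr normrM mulrC; apply: le_trans.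
by rewrite ler_wpM2r// lerDl.
Qed.

Lemma cauchySeries_dominated n1 a b : cauchySeries b ->
  (forall n, (n1 <= n)%N -> `|a n| <= b n) -> cauchySeries a.
Proof.
move=> cb ab e e0; have [n0 h] := cb _ e0; exists (maxn n0 n1) => m n.
rewrite geq_max => /andP[n0m n1m] mn; apply: le_trans (h _ _ n0m mn).
rewrite (le_trans (ler_norm_sum _ _ _))// (le_trans _ (ler_norm _))//.
by rewrite !big_nat ler_sum// => i /andP[mi _]; rewrite ab// (leq_trans n1m).
Qed.

Lemma cauchySeries_cvg N a : cauchySeries a -> cvgn (fun n => \sum_(N <= i < n) a i).
Proof.
move=> ca; apply: cauchy_cvg; apply/cauchy_ballP => e e0.
have e20 : 0 < e / 2 by rewrite divr_gt0.
have [n0 h] := ca _ e20.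
have key m n : (maxn n0 N <= m)%N -> (m <= n)%N ->
   `|\sum_(N <= i < m) a i - \sum_(N <= i < n) a i| < e.
  rewrite geq_max => /andP[n0m Nm] mn.
  rewrite (@big_cat_nat _ _ _ m N n)//= opprD addrA subrr add0r normrN.
  by rewrite (le_lt_trans (h _ _ n0m mn))// ltr_pdivrMr// mulr2n mulrDr mulr1 ltrDl.
pose I := (fun n => \sum_(N <= i < n) a i) @` [set m | (maxn n0 N <= m)%N].
exists (I, I) => [|[_ _] /= [[m hm <-] [n hn <-]]].
  by split; exists (maxn n0 N) => // m hm; exists m.
rewrite -ball_normE /=.
have [mn|nm] := leqP m n; first exact: key.
by rewrite distrC; apply: key => //; exact: ltnW.
Qed.

End CauchySeries.

(** * Expectations of bounded random variables *)

Section Expectation.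
Context d (T : measurableType d) (R : realType) (P : probability T R).

Definition bddMeas (f : T -> R) :=
  measurable_fun setT f /\ exists M, forall w, `|f w| <= M.

Local Notation EP f := (\int[P]_w f w).

Lemma bddMeas_integrable f : bddMeas f -> P.-integrable setT (EFin \o f).
Proof.
move=> [mf [M fM]]; apply: measurable_bounded_integrable => //.
  exact: fin_num_fun_lty.
exists M; split; first exact: num_real.
by move=> x Mx w _ /=; rewrite (le_trans (fM w))// ltW.
Qed.

Lemma bddMeas_cst c : bddMeas (fun=> c).
Proof. by split; [exact: measurable_cst|exists `|c|]. Qed.

Lemma bddMeasD f g : bddMeas f -> bddMeas g -> bddMeas (fun w => f w + g w).
Proof.
move=> [mf [M fM]] [mg [N gN]]; split; first exact: measurable_funD.
by exists (M + N) => w; rewrite (le_trans (ler_normD _ _))// lerD.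
Qed.

Lemma bddMeasM f g : bddMeas f -> bddMeas g -> bddMeas (fun w => f w * g w).
Proof.
move=> [mf [M fM]] [mg [N gN]]; split; first exact: measurable_funM.
by exists (M * N) => w; rewrite normrM ler_pM.
Qed.

Lemma bddMeasB f g : bddMeas f -> bddMeas g -> bddMeas (fun w => f w - g w).
Proof.
move=> [mf [M fM]] [mg [N gN]]; split; first exact: measurable_funB.
by exists (M + N) => w; rewrite (le_trans (ler_normB _ _))// lerD.
Qed.

Lemma bddMeas_sum (I : Type) (s : seq I) (F : I -> T -> R) :
  (forall i, bddMeas (F i)) -> bddMeas (fun w => \sum_(i <- s) F i w).
Proof.
move=> hF; elim: s => [|i s IH].
  by under eq_fun do rewrite big_nil; exact: bddMeas_cst.
by under eq_fun do rewrite big_cons; exact: bddMeasD.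
Qed.

Lemma ExpD f g : bddMeas f -> bddMeas g -> EP (fun w => f w + g w) = EP f + EP g.
Proof. by move=> /bddMeas_integrable ? /bddMeas_integrable ?; exact: RintegralD. Qed.

Lemma ExpB f g : bddMeas f -> bddMeas g -> EP (fun w => f w - g w) = EP f - EP g.
Proof. by move=> /bddMeas_integrable ? /bddMeas_integrable ?; exact: RintegralB. Qed.

Lemma ExpZ c f : bddMeas f -> EP (fun w => c * f w) = c * EP f.
Proof. by move=> /bddMeas_integrable ?; exact: RintegralZl. Qed.

Lemma Exp_cst c : EP (fun=> c) = c.
Proof. 
have P1 : fine (P [set: T]) = 1 by rewrite probability_setT.
by rewrite Rintegral_cst// -[RHS]mulr1 -[in RHS]P1. Qed.

Lemma Exp_sum (I : Type) (s : seq I) (F : I -> T -> R) :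
  (forall i, bddMeas (F i)) ->
  EP (fun w => \sum_(i <- s) F i w) = \sum_(i <- s) EP (F i).
Proof.
move=> hF; elim: s => [|i s IH].
  by rewrite big_nil; under eq_Rintegral do rewrite big_nil; rewrite Exp_cst.
rewrite big_cons -IH -ExpD//; last exact: bddMeas_sum.
by apply: eq_Rintegral => w _; rewrite big_cons.
Qed.

Lemma le_Exp f g : bddMeas f -> bddMeas g -> (forall w, f w <= g w) -> EP f <= EP g.
Proof. by move=> /bddMeas_integrable ? /bddMeas_integrable ? fg; exact: le_Rintegral. Qed.

Lemma bddMeas_indic A : measurable A -> bddMeas (\1_A).
Proof.
move=> mA; split; first exact: measurable_indic.
by exists 1 => w; rewrite ger0_norm// indicE lern1 leq_b1.
Qed.

Lemma Exp_indic A : measurable A -> EP (\1_A) = fine (P A).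
Proof. by move=> mA; rewrite /Rintegral integral_indic// setIT. Qed.

Lemma P_fine A : measurable A -> P A = (fine (P A))%:E.
Proof. by move=> mA; rewrite fineK// fin_num_measure. Qed.

End Expectation.

(** * Weighted sums of martingale differences *)

Definition determined {T S : Type} (r : T -> T -> Prop) (f : T -> S) : Prop :=
  forall w w', r w w' -> f w = f w'.

Section Martingale.
Context d (T : measurableType d) (R : realType) (P : probability T R).
(* [agree n] relates the points that are indistinguishable at time [n];
   functions constant on its classes play the role of adapted ones. *)
Variable agree : nat -> T -> T -> Prop.
Hypothesis agreeS : forall n w w', agree n.+1 w w' -> agree n w w'.
Hypothesis agree_meas : forall n (f : T -> R),
  determined (agree n) f -> measurable_fun setT f.
Variables (Y : nat -> T -> R) (c : nat -> R).
Hypothesis Y_det : forall n, determined (agree n.+1) (Y n).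
Hypothesis Y_le1 : forall n w, `|Y n w| <= 1.
Hypothesis Y_orth : forall n (f : T -> R), determined (agree n) f -> bddMeas f ->
  \int[P]_w (f w * Y n w) = 0.
Hypothesis c_sq : cauchySeries (fun n => c n ^+ 2).

Let agree_le n m w w' : (n <= m)%N -> agree m w w' -> agree n w w'.
Proof.
move=> /subnK <-; elim: (m - n)%N => [|k IH]; first by rewrite add0n.
by rewrite addSn => /agreeS.
Qed.

Let S m n w := \sum_(m <= i < n) c i * Y i w.

Let S_det m n : determined (agree n) (S m n).
Proof.
move=> w w' ww'; rewrite /S !big_nat; apply: eq_bigr => i /andP[_ i_n].
by rewrite (Y_det (agree_le i_n ww')).
Qed.

(* The walk started at [m] has not left (-e, e) by time [i]. *)
Let alive e m i w : bool := [forall j : 'I_i.+1, (m <= j)%N ==> (`|S m j w| < e)].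

Let aliveP e m i w :
  reflect (forall j, (m <= j <= i)%N -> `|S m j w| < e) (alive e m i w).
Proof.
apply: (iffP forallP) => h j.
  by move=> /andP[mj ji]; have := h (Ordinal (ji : (j < i.+1)%N)); rewrite /= mj.
by apply/implyP => mj; apply: h; rewrite mj -ltnS ltn_ord.
Qed.

Let alive_det e m i : determined (agree i) (alive e m i).
Proof.
move=> w w' ww'; rewrite /alive; apply: eq_forallb => j.
by rewrite (S_det m (agree_le _ ww')) -ltnS.
Qed.

Let stopped e m n w := \sum_(m <= i < n) (alive e m i w)%:R * (c i * Y i w).

Let stopped_det e m n : determined (agree n) (stopped e m n).
Proof.
move=> w w' ww'; rewrite /stopped !big_nat; apply: eq_bigr => i /andP[_ i_n].
by rewrite (Y_det (agree_le i_n ww')) (alive_det e m (agree_le (ltnW i_n) ww')).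
Qed.

Let Y_bdd n : bddMeas (Y n).
Proof. by split; [exact: (agree_meas (@Y_det n))|exists 1]. Qed.

Let alive_bdd e m n : bddMeas (fun w => (alive e m n w)%:R : R).
Proof.
split; last by exists 1 => w; rewrite ger0_norm// lern1 leq_b1.
by apply: (agree_meas (n := n)) => w w' ww'; rewrite (alive_det e m ww').
Qed.

Let stopped_bdd e m n : bddMeas (stopped e m n).
Proof.
apply: bddMeas_sum => i; apply: bddMeasM; first exact: alive_bdd.
by apply: bddMeasM; [exact: bddMeas_cst|exact: Y_bdd].
Qed.

(** The increment of the stopped walk is the product of a variable known at
    time [n] and of [Y n], so the cross terms of the square vanish. *)
Let stopped_sq e m n : (m <= n)%N ->
  \int[P]_w (stopped e m n w * stopped e m n w) <= \sum_(m <= i < n) c i ^+ 2.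
Proof.
elim: n => [|n IH]; first by rewrite leqn0 => /eqP->; rewrite /stopped;
  under eq_Rintegral do rewrite big_geq// mulr0; rewrite Exp_cst big_geq.
rewrite leq_eqVlt => /predU1P[->|].
  by rewrite /stopped; under eq_Rintegral do rewrite big_geq// mulr0; rewrite Exp_cst big_geq.
rewrite ltnS => mn; rewrite big_nat_recr//=.
pose A w : R := (alive e m n w)%:R.
have bR := stopped_bdd e m n; have bA : bddMeas A by exact: alive_bdd.
have bRA := bddMeasM bR bA; have bAY := bddMeasM bA (Y_bdd n).
have bRR := bddMeasM bR bR.
have -> : \int[P]_w (stopped e m n.+1 w * stopped e m n.+1 w) =
  \int[P]_w ((stopped e m n w * stopped e m n w + 
     (2 * c n) * (stopped e m n w * A w * Y n w)) + c n ^+ 2 * (A w * Y n w * (A w * Y n w))).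
  apply: eq_Rintegral => w _; rewrite /stopped big_nat_recr//= -/(A w).
  set X := \sum_(_ <= _ < _) _; ring.
have b1 := bddMeasM (bddMeas_cst T (2 * c n)) (bddMeasM bRA (Y_bdd n)).
have b2 := bddMeasM bAY bAY.
rewrite ExpD; [|exact: bddMeasD|exact: bddMeasM (bddMeas_cst T _) b2].
rewrite ExpD// ExpZ; last exact: bddMeasM.
rewrite Y_orth//; last by move=> w w' ww'; rewrite /A (stopped_det e m ww') (alive_det e m ww').
rewrite mulr0 addr0 lerD ?IH// ExpZ// -[leRHS]mulr1 ler_wpM2l ?sqr_ge0//.
rewrite -[leRHS](Exp_cst P); apply: le_Exp => //; first exact: bddMeas_cst.
move=> w; rewrite -expr2 exprMn -[leRHS]mul1r ler_pM ?sqr_ge0//.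
  by rewrite /A; case: alive; rewrite ?expr1n ?expr0n//= ler01.
by rewrite -real_normK ?num_real// expr_le1.
Qed.

Let bad e m n : set T := [set w | ~~ alive e m n w].

Let bad_indic e m n w : \1_(bad e m n) w = (~~ alive e m n w)%:R :> R.
Proof. by rewrite indicE; congr (_%:R); congr nat_of_bool; apply/idP/idP => [/set_mem|/mem_set]. Qed.

Let bad_meas e m n : measurable (bad e m n).
Proof.
apply/(@measurable_indicP _ _ R); apply: (agree_meas (n := n)) => w w' ww'.
by rewrite !bad_indic (alive_det e m ww').
Qed.

(** The stopped walk freezes where the walk first leaves (-e, e); Chebyshev's
    inequality for it is thus a maximal inequality for the walk. *)
Let stopped_on_bad e m n w : (m <= n)%N ->
  if alive e m n w then stopped e m n w = S m n w else e <= `|stopped e m n w|.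
Proof.
elim: n => [|n IH].
  rewrite leqn0 => /eqP m0; rewrite m0 /stopped /S !big_geq//; case: ifP => //.
  move=> /negbT/aliveP al; apply: contrapT => h; apply: al => j.
  rewrite leqn0 => /eqP->; rewrite /S big_geq//.
  by rewrite ltNge; apply/negP.
have key : (m = n.+1) -> if alive e m n.+1 w then stopped e m n.+1 w = S m n.+1 w else e <= `|stopped e m n.+1 w|.
  move=> mn; rewrite mn /stopped /S !big_geq//; case: ifP => //.
  move=> /negbT/aliveP al; apply: contrapT => h; apply: al => j.
  by rewrite -eqn_leq => /eqP <-; rewrite /S big_geq// ltNge; apply/negP.
rewrite leq_eqVlt => /predU1P[//|]; rewrite ltnS => mn; have {IH} := IH mn.
rewrite /stopped big_nat_recr//= -/(stopped e m n w).
case: (aliveP e m n w) => [al|nal] IH; last first.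
  rewrite mul0r addr0; case: aliveP => [al|//].
  by exfalso; apply: nal => j /andP[mj jn]; apply: al; rewrite mj leqW.
rewrite mul1r IH -[_ + _](_ : S m n.+1 w = _); last by rewrite /S big_nat_recr.
case: aliveP => // nal; rewrite leNgt; apply/negP => Sn; apply: nal => j /andP[mj].
by rewrite leq_eqVlt => /predU1P[->//|]; rewrite ltnS => jn; apply: al; rewrite mj.
Qed.

Let bad_prob e m n : 0 < e -> (m <= n)%N ->
  fine (P (bad e m n)) <= (\sum_(m <= i < n) c i ^+ 2) / e ^+ 2.
Proof.
move=> e0 mn; rewrite ler_pdivlMr ?exprn_gt0// mulrC.
apply: le_trans (stopped_sq e mn).
rewrite -Exp_indic// -ExpZ; last exact: bddMeas_indic.
apply: le_Exp; [|exact: bddMeasM|].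
  by apply: bddMeasM; [exact: bddMeas_cst|exact: bddMeas_indic].
move=> w; rewrite bad_indic.
have := stopped_on_bad e w mn; case: alive => /= h; first by rewrite mulr0 -expr2 sqr_ge0.
by rewrite mulr1 -expr2 -[leRHS]real_normK ?num_real// lerXn2r// nnegrE// ltW.
Qed.

Let bad_mono e m : nondecreasing_seq (bad e m).
Proof.
move=> n n' nn'; apply/subsetPset => w; rewrite /bad /=; apply: contra => /aliveP al.
by apply/aliveP => j /andP[mj jn]; apply: al; rewrite mj (leq_trans jn).
Qed.

Let bad_lim e m del : 0 < e -> (forall n, (m <= n)%N -> \sum_(m <= i < n) c i ^+ 2 <= del) ->
  (P (\bigcup_n bad e m n) <= (del / e ^+ 2)%:E)%E.
Proof.
move=> e0 hdel.
have mU : measurable (\bigcup_n bad e m n) by exact: bigcup_measurable.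
have := nondecreasing_cvg_mu (bad_meas e m) mU (@bad_mono e m).
move=> /(_ R P) /cvge_to_le; apply; exists m => // n /= mn.
rewrite P_fine// lee_fin (le_trans (bad_prob e0 mn))//.
by rewrite ler_wpM2r ?hdel// invr_ge0 sqr_ge0.
Qed.

Let bad_null e : 0 < e -> P.-negligible (\bigcap_m \bigcup_n bad e m n).
Proof.
move=> e0; have mU m : measurable (\bigcup_n bad e m n) by exact: bigcup_measurable.
have mI : measurable (\bigcap_m \bigcup_n bad e m n) by exact: bigcap_measurable.
exists (\bigcap_m \bigcup_n bad e m n); split => //.
apply/eqP; rewrite -measure_le0; apply/lee_addgt0Pr => del del0; rewrite add0e.
have d0 : 0 < del * e ^+ 2 by rewrite mulr_gt0// exprn_gt0.
have [n0 h] := c_sq d0.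
apply: (@le_trans _ _ (P (\bigcup_n bad e n0 n))).
  by apply: le_measure; rewrite ?inE//; exact: bigcap_inf.
rewrite -[del](mulfK (x := e ^+ 2)) ?gt_eqF ?exprn_gt0//.
apply: bad_lim => // n n0n; apply: le_trans (h _ _ (leqnn _) n0n); exact: ler_norm.
Qed.

(** A path with a non-Cauchy series leaves some (-1/(k+1), 1/(k+1)) after every
    restart [m]; the maximal inequality bounds this by the tails of [c n ^+ 2]. *)
Theorem martingale_cauchy : {ae P, forall w, cauchySeries (fun n => c n * Y n w)}.
Proof.
pose ek (k : nat) : R := (k.+1%:R)^-1.
have := negligible_bigcup (fun k => @bad_null (ek k) ltac:(by rewrite /ek invr_gt0)).
apply: negligibleS => w /= nc; apply: contrapT => nbad; apply: nc => e e0.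
have [k _ hk] : exists2 k, True & 2 * ek k <= e.
  exists (Num.truncn (2 / e)) => //; rewrite /ek ler_pdivrMr// mulrC -ler_pdivrMr//.
  by apply: ltW; exact: truncnS_gt.
have [m al] : exists m, forall n, alive (ek k) m n w.
  apply: contrapT => /forallNP h; apply: nbad; exists k => // m _.
  by have /existsNP[n /negP hn] := h m; exists n.
exists m => a b ma ab.
have -> : \sum_(a <= i < b) c i * Y i w = S m b w - S m a w.
  by rewrite /S (@big_cat_nat _ _ _ a m b)//= addrC addrK.
apply: le_trans hk; rewrite (le_trans (ler_normB _ _))// mulr_natl mulr2n.
have sa : `|S m a w| < ek k by have /aliveP := al a; apply; rewrite ma /=.
have sb : `|S m b w| < ek k by have /aliveP := al b; apply; rewrite (leq_trans ma)/=.
by rewrite lerD// ltW.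
Qed.

End Martingale.

(** * Binomial expectations *)

Section BinomialExpectation.
Context {R : realType}.
Implicit Types (q : R) (psi : nat -> R).

(** The expectation of [psi J] for [J] binomial with parameters [k] and [q], by
    conditioning on the first trial; moments follow by induction on [k]. *)
Fixpoint binExp q (k : nat) psi : R :=
  if k is k'.+1 then
    q * binExp q k' (fun j => psi j.+1) + (1 - q) * binExp q k' psi
  else psi 0%N.

Lemma eq_binExp q k psi psi' : (forall j, (j <= k)%N -> psi j = psi' j) ->
  binExp q k psi = binExp q k psi'.
Proof.
elim: k psi psi' => [|k IH] psi psi' h /=; first exact: h.
by congr (_ * _ + _ * _); apply: IH => j jk; apply: h => //; exact: leqW.
Qed.

Lemma binExpD q k psi psi' :
  binExp q k (fun j => psi j + psi' j) = binExp q k psi + binExp q k psi'.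
Proof. by elim: k psi psi' => [|k IH] psi psi' //=; rewrite !IH; ring. Qed.

Lemma binExpZ q k c psi : binExp q k (fun j => c * psi j) = c * binExp q k psi.
Proof. by elim: k psi => [|k IH] psi //=; rewrite !IH; ring. Qed.

Lemma binExp_cst q k c : binExp q k (fun=> c) = c.
Proof. by elim: k => [|k IH] //=; rewrite !IH; ring. Qed.

Lemma le_binExp q k psi psi' : 0 <= q <= 1 -> (forall j, (j <= k)%N -> psi j <= psi' j) ->
  binExp q k psi <= binExp q k psi'.
Proof.
move=> /andP[q0 q1]; elim: k psi psi' => [|k IH] psi psi' h /=; first exact: h.
apply: lerD; (apply: ler_wpM2l; first by rewrite ?subr_ge0); apply: IH => j jk; apply: h => //.
exact: leqW.
Qed.

Lemma binExp_mean q k c : binExp q k (fun j => j%:R - c) = k%:R * q - c.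
Proof.
elim: k c => [|k IH] c /=; first by rewrite mul0r.
rewrite (@eq_binExp _ _ (fun j => j.+1%:R - c) (fun j => j%:R - (c - 1))).
  by rewrite !IH -natr1; ring.
by move=> j _; rewrite -natr1; ring.
Qed.

Lemma binExp_variance q k c :
  binExp q k (fun j => (j%:R - c) ^+ 2) = k%:R * (q * (1 - q)) + (k%:R * q - c) ^+ 2.
Proof.
elim: k c => [|k IH] c /=; first by ring.
rewrite (@eq_binExp _ _ (fun j => (j.+1%:R - c) ^+ 2) (fun j => (j%:R - (c - 1)) ^+ 2)).
  by rewrite !IH -natr1; ring.
by move=> j _; rewrite -natr1; ring.
Qed.

(** The error of Bernstein's operator: the linear term has mean zero, and the
    variance of the sample mean is at most [1 / k]. *)
Lemma binExp_approx q k (u : R -> R) (D al be : R) : 0 <= q <= 1 -> (0 < k)%N -> 0 <= be ->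
  (forall y, 0 <= y <= 1 -> `|u y - u q - D * (y - q)| <= al + be * (y - q) ^+ 2) ->
  `|binExp q k (fun j => u (j%:R / k%:R)) - u q| <= al + be / k%:R.
Proof.
move=> q01 k0 be0 h; have k0' : (0 : R) < k%:R by rewrite ltr0n.
have kn0 : k%:R != 0 :> R by rewrite gt_eqF.
have y01 j : (j <= k)%N -> 0 <= (j%:R : R) / k%:R <= 1.
  by move=> jk; rewrite divr_ge0// ler_pdivrMr// mul1r ler_nat.
have meanE : binExp q k (fun j => D * (j%:R / k%:R - q)) = 0.
  rewrite binExpZ (@eq_binExp _ _ _ (fun j => k%:R^-1 * (j%:R - k%:R * q))).
    by rewrite binExpZ binExp_mean subrr !mulr0.
  by move=> j _; field.
have varE : binExp q k (fun j => be * (j%:R / k%:R - q) ^+ 2) <= be / k%:R.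
  rewrite binExpZ ler_wpM2l//.
  rewrite (@eq_binExp _ _ _ (fun j => (k%:R^-1) ^+ 2 * (j%:R - k%:R * q) ^+ 2)).
    rewrite binExpZ binExp_variance subrr expr0n/= addr0 expr2 mulrA mulfVK//.
    rewrite ler_piMr ?invr_ge0// ?ltW//.
    by case/andP: q01 => q0 q1; nra.
  by move=> j _; field.
have up : binExp q k (fun j => u (j%:R / k%:R)) <= 
    binExp q k (fun j => (u q + al) + (D * (j%:R / k%:R - q) + be * (j%:R / k%:R - q) ^+ 2)).
  apply: le_binExp => // j /y01/h; rewrite ler_norml => /andP[_]; lra.
have lo : binExp q k (fun j => (u q - al) + (D * (j%:R / k%:R - q) + (-1) * (be * (j%:R / k%:R - q) ^+ 2)))
   <= binExp q k (fun j => u (j%:R / k%:R)).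
  apply: le_binExp => // j /y01/h; rewrite ler_norml => /andP[+ _]; lra.
rewrite !binExpD !binExp_cst meanE in up lo; rewrite (binExpZ _ _ (-1)) in lo.
by rewrite ler_norml; apply/andP; split; lra.
Qed.

Lemma binExp_bounds q k psi (lo hi : R) : 0 <= q <= 1 ->
  (forall j, (j <= k)%N -> lo <= psi j <= hi) -> lo <= binExp q k psi <= hi.
Proof.
move=> q01 h; rewrite -(binExp_cst q k lo) -(binExp_cst q k hi).
by apply/andP; split; apply: le_binExp => // j /h/andP[].
Qed.

End BinomialExpectation.

(** * Moduli of continuity *)

Section Modulus.
Context {R : realType}.
Implicit Types (u du : R -> R).

Let bnd u del (M : R) : (forall x, x \in `[0, 1] -> `|u x| <= M) ->
  has_ubound [set e | exists x y : R, [/\ x \in `[0, 1], y \in `[0, 1],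
     `|x - y| < del & e = `|u x - u y|]].
Proof.
move=> uM; exists (M + M) => _ [x [y [x01 y01 _ ->]]].
by rewrite (le_trans (ler_normB _ _))// lerD// uM.
Qed.

Lemma modulus_ge u del (M x y : R) : (forall x, x \in `[0, 1] -> `|u x| <= M) ->
  x \in `[0, 1] -> y \in `[0, 1] -> `|x - y| < del -> `|u x - u y| <= modulus u del.
Proof. by move=> uM x01 y01 xy; apply: ub_le_sup; [exact: bnd uM|exists x, y]. Qed.

Lemma modulus_le u del c : 0 < del ->
  (forall x y, x \in `[0, 1] -> y \in `[0, 1] -> `|x - y| < del -> `|u x - u y| <= c) ->
  modulus u del <= c.
Proof.
move=> del0 h; apply: ge_sup; last by move=> _ [x [y [x01 y01 xy ->]]]; exact: h.
exists `|u 0 - u 0|; exists 0, 0; rewrite subrr normr0 in_itv/= lexx ler01.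
by split.
Qed.

Lemma modulus_ge0 u del : 0 <= modulus u del.
Proof.
rewrite /modulus; set A := [set e | _].
have [[_ [x [y [x01 y01 xy _]]]]|] := pselect (A !=set0); last first.
  by move=> /set0P/negP/negPn/eqP ->; rewrite sup0.
have [ub|nub] := pselect (has_ubound A); last by rewrite sup_out// => -[].
by apply: (ub_le_sup ub); exists x, x; rewrite !subrr normr0; split => //; apply: le_lt_trans xy.
Qed.

Lemma eq_modulus u v del : (forall x, x \in `[0, 1] -> u x = v x) -> modulus u del = modulus v del.
Proof.
move=> uv; rewrite /modulus; congr sup; apply/seteqP.
by split=> e [x [y [x01 y01 xy ->]]]; exists x, y; rewrite ?uv.
Qed.

(** Cut the segment from [x] to [y] into pieces shorter than [del]. *)
Lemma modulus_subadd u del (M x y : R) : 0 < del -> (forall x, x \in `[0, 1] -> `|u x| <= M) ->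
  x \in `[0, 1] -> y \in `[0, 1] -> `|u x - u y| <= (1 + `|x - y| / del) * modulus u del.
Proof.
move=> del0 uM.
have key m : forall x y, x \in `[0, 1] -> y \in `[0, 1] -> `|x - y| < m.+1%:R * del ->
    `|u x - u y| <= m.+1%:R * modulus u del.
  elim: m => [|m IH] {}x {}y x01 y01 xy.
    by rewrite mul1r; rewrite mul1r in xy; exact: modulus_ge uM _ _ _.
  have m0 : (0 : R) < m.+2%:R by rewrite ltr0n.
  pose z := y + (x - y) / m.+2%:R.
  have t0 : 0 <= (m.+2%:R)^-1 :> R by rewrite invr_ge0 ltW.
  have t1 : (m.+2%:R)^-1 <= 1 :> R by rewrite invf_le1// ler1n.
  have z01 : z \in `[0, 1].
    move: x01 y01; rewrite /z !in_itv/=; set t := _^-1 in t0 t1 *.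
    by move=> /andP[? ?] /andP[? ?]; apply/andP; split; nra.
  have zy : `|z - y| < del.
    by rewrite /z addrAC subrr add0r normrM normfV (gtr0_norm m0) ltr_pdivrMr// mulrC.
  have xz : `|x - z| < m.+1%:R * del.
    have -> : x - z = (x - y) * (m.+1%:R / m.+2%:R).
      have -> : m.+1%:R = m.+2%:R - 1 :> R by rewrite -[m.+2%:R]natr1 addrK.
      by rewrite /z; field; rewrite gt_eqF.
    have p0 : 0 <= m.+1%:R / m.+2%:R :> R by rewrite divr_ge0.
    rewrite normrM (ger0_norm p0).
    by rewrite mulrA ltr_pdivrMr// [ltRHS]mulrAC [_ * m.+1%:R]mulrC -mulrA ltr_pM2l ?ltr0n// mulrC.
  have -> : u x - u y = (u x - u z) + (u z - u y) by rewrite addrA subrK.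
  rewrite (le_trans (ler_normD _ _))// -natr1 mulrDl mul1r lerD//; first exact: IH.
  exact: modulus_ge uM _ _ _.
move=> x01 y01.
have h0 : 0 <= `|x - y| / del by rewrite divr_ge0// ltW.
apply: (le_trans (key (Num.truncn (`|x - y| / del)) _ _ x01 y01 _)).
  by rewrite -ltr_pdivrMr// truncnS_gt.
rewrite ler_wpM2r ?modulus_ge0// -natr1 addrC lerD2l.
by rewrite truncn_le.
Qed.

End Modulus.

(** * Functions on the unit interval with a derivative *)

Section Smooth.
Context {R : realType}.
Implicit Types (u du : R -> R).

(** The derivative [du] is that of an extension [v] of [u] beyond the interval,
    which gives it a meaning at the end points. *)
Definition smooth01 u du : Prop := exists v : R -> R,
  [/\ forall x : R, x \in `[0, 1] -> v x = u x,
      forall x : R, x \in `[0, 1] -> is_derive x 1 v (du x) &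
      exists M, forall x : R, x \in `[0, 1] -> `|du x| <= M].

Lemma smooth01_deriv01 u du x : smooth01 u du -> x \in `[0, 1] -> deriv01 u x = du x.
Proof.
move=> [v [vu vdu _]] x01; rewrite /deriv01.
have pF : ProperFilter (within `[0, 1] (x^')).
  apply: Build_ProperFilter_ex => B [e /= e0 eB].
  move: x01; rewrite in_itv/= => /andP[x0 x1].
  pose t := Num.min (e / 2) (1 / 2).
  have t0 : 0 < t by rewrite lt_min !divr_gt0.
  have te : t < e by rewrite gt_min ltr_pdivrMr// mulr2n mulrDr mulr1 ltrDr e0.
  have t1 : t <= 1 / 2 by rewrite ge_min lexx orbT.
  have [x2|x2] := leP x (1 / 2).
    exists (x + t); apply: eB.
    - by rewrite /ball/= opprD addrA subrr add0r normrN gtr0_norm.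
    - by rewrite gt_eqF// ltrDl.
    - by rewrite /= in_itv/=; apply/andP; split; lra.
  exists (x - t); apply: eB.
  - by rewrite /ball/= opprB addrC subrK gtr0_norm.
  - by rewrite lt_eqF// gtrBl.
  - by rewrite /= in_itv/=; apply/andP; split; lra.
apply: cvg_lim; first exact: Rhausdorff.
apply/cvgrPdist_lt => e e0.
have [dv dvE] := vdu _ x01.
have /cvgrPdist_lt /(_ e e0) [r /= r0 hr] := dv.
exists r => //= y yr yx y01; rewrite -(vu _ x01) -(vu _ y01).
have := hr (y - x); rewrite /ball/= sub0r normrN distrC => /(_ yr).
rewrite subr_eq0 => /(_ yx); rewrite -/(derive _ _ _) dvE.
by rewrite [_ *: 1]mulr1 subrK [_ *: _]mulrC.
Qed.

Lemma smooth01_MVT u du x y : smooth01 u du -> x \in `[0, 1] -> y \in `[0, 1] ->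
  exists c, [/\ c \in `[0, 1], `|c - x| <= `|y - x| & u y - u x = du c * (y - x)].
Proof.
move=> [v [vu vdu _]].
have key a b : a \in `[0, 1] -> b \in `[0, 1] -> a < b ->
    exists2 c, a <= c <= b & u b - u a = du c * (b - a).
  move=> a01 b01 ab; move: (a01) (b01); rewrite !in_itv/= => /andP[a0 a1] /andP[b0 b1].
  have sub c : a <= c <= b -> c \in `[0, 1].
    by move=> /andP[ac cb]; rewrite in_itv/= (le_trans a0 ac) (le_trans cb b1).
  have dv c : c \in `]a, b[ -> is_derive c 1 v (du c).
    rewrite in_itv/= => /andP[ac cb]; apply: vdu; apply: sub.
    by rewrite (ltW ac) (ltW cb).
  have cv : {within `[a, b], continuous v}.
    apply: derivable_within_continuous => c; rewrite in_itv/= => cab.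
    by have [] := vdu c (sub c cab).
  have [c] := MVT ab dv cv.
  rewrite in_itv/= => /andP[ac cb]; rewrite (vu _ a01) (vu _ b01) => h.
  by exists c => //; rewrite (ltW ac) (ltW cb).
have in01 a b c : a \in `[0, 1] -> b \in `[0, 1] -> a <= c <= b -> c \in `[0, 1].
  rewrite !in_itv/= => /andP[a0 _] /andP[_ b1] /andP[ac cb].
  by rewrite (le_trans a0 ac) (le_trans cb b1).
move=> x01 y01; have [xy|yx|xy] := ltgtP x y.
- have [c cI h] := key _ _ x01 y01 xy; exists c; split => //; first exact: in01 cI.
  case/andP: cI => xc cy; rewrite !ger0_norm ?subr_ge0//; [exact: lerB|exact: ltW].
- have [c cI h] := key _ _ y01 x01 yx; exists c; split => //; first exact: in01 cI.
    case/andP: cI => yc cx; rewrite [`|c - x|]distrC [`|y - x|]distrC.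
    by rewrite !ger0_norm ?subr_ge0//; [exact: lerB|exact: ltW].
  by rewrite -opprB h -mulrN opprB.
by exists x; split; rewrite // -?xy !subrr ?normr0 ?mulr0.
Qed.

Lemma smooth01_lipschitz u du : smooth01 u du -> exists2 L, 0 <= L &
  forall x y : R, x \in `[0, 1] -> y \in `[0, 1] -> `|u x - u y| <= L * `|x - y|.
Proof.
move=> udu; have [_ [_ _ [M hM]]] := udu.
exists `|M| => // x y x01 y01.
have [c [c01 _ ->]] := smooth01_MVT udu y01 x01.
by rewrite normrM ler_wpM2r// (le_trans (hM _ c01))// ler_norm.
Qed.

Lemma smooth01_bounded u du : smooth01 u du -> exists M, forall x : R, x \in `[0, 1] -> `|u x| <= M.
Proof.
move=> /smooth01_lipschitz[L L0 h]; exists (`|u 0| + L) => x x01.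
have z01 : (0 : R) \in `[0, 1] by rewrite in_itv/= lexx ler01.
rewrite -[u x](subrK (u 0)) addrC (le_trans (ler_normD _ _))// lerD2l.
apply: (le_trans (h _ _ x01 z01)); rewrite subr0; move: x01; rewrite in_itv/= => /andP[x0 x1].
by rewrite ger0_norm// ler_piMr.
Qed.

(** By the mean value theorem the remainder is at most
    [|y - x| * (1 + |y - x| / r) * modulus du r]; bounding [|y - x|] by
    [r + (y - x) ^+ 2 / r] leaves only a second moment to estimate. *)
Lemma smooth01_taylor u du x y r : smooth01 u du -> 0 < r -> x \in `[0, 1] -> y \in `[0, 1] ->
  `|u y - u x - du x * (y - x)| <= (r + (2 / r) * (y - x) ^+ 2) * modulus du r.
Proof.
move=> udu r0 x01 y01; have [_ [_ _ [M hM]]] := udu.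
have [c [c01 cx ->]] := smooth01_MVT udu x01 y01.
rewrite -mulrBl normrM.
have m0 := modulus_ge0 du r.
apply: (@le_trans _ _ ((1 + `|y - x| / r) * modulus du r * `|y - x|)).
  rewrite ler_wpM2r// (le_trans (modulus_subadd r0 hM c01 x01))// ler_wpM2r// lerD2l.
  by rewrite ler_pM2r ?invr_gt0.
rewrite mulrAC ler_wpM2r//.
rewrite -[(y - x) ^+ 2]real_normK ?num_real//; set t := `|y - x|.
have -> : (1 + t / r) * t = (t * r + t ^+ 2) / r by field; rewrite gt_eqF.
have -> : r + 2 / r * t ^+ 2 = (r ^+ 2 + 2 * t ^+ 2) / r by field; rewrite gt_eqF.
rewrite ler_pM2r ?invr_gt0//; have := sqr_ge0 (r - t); have := sqr_ge0 t; nra.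
Qed.

Lemma smooth01_C1 u : C_class 1 u -> exists du, smooth01 u du.
Proof.
move=> [V [v [oV V01 vu dv cv]]]; exists (derive1 v), v.
have in01 x : x \in `[0, 1] -> V x by move=> x01; apply: V01.
split => [x x01|x x01|]; first by rewrite vu.
  have d := dv 0%N x isT (in01 _ x01).
  by rewrite derive1E; exact: derivableP.
have : {within `[0, 1], continuous (derive1 v)}.
  apply/continuous_in_subspaceT => x /[1!inE] x01; exact: cv (V01 _ x01).
move=> /[dup] /(EVT_max ler01)[c1 _ h1] /(EVT_min ler01)[c2 _ h2].
exists (Num.max (derive1 v c1) (- derive1 v c2)) => x x01.
rewrite ler_norml lerNl !le_max h1// lerN2 h2// orbT; split.
Qed.

Lemma C_classS n u : C_class n.+1 u -> C_class n u.
Proof.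
move=> [V [v [oV V01 vu dv cv]]]; exists V, v; split => //.
  by move=> j x jn; apply: dv; exact: leqW.
move=> x Vx; apply: differentiable_continuous; apply/derivable1_diffP.
exact: dv.
Qed.

Lemma smooth01_C2 u : C_class 2 u -> exists du, smooth01 u du /\ exists2 L, 0 <= L &
  forall x y : R, x \in `[0, 1] -> y \in `[0, 1] -> `|du x - du y| <= L * `|x - y|.
Proof.
move=> [V [v [oV V01 vu dv cv]]].
have in01 x : x \in `[0, 1] -> V x by move=> x01; apply: V01.
have : C_class 1 (derive1 v).
  exists V, (derive1 v); split => //.
    by move=> [|//] x _ Vx; exact: (dv 1%N).
have C1 : C_class 1 u by apply: C_classS; exists V, v.
move=> /smooth01_C1[ddv /smooth01_lipschitz hL].
exists (derive1 v); split => //; exists v; split => [x x01|x x01|]; first by rewrite vu.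
  have d := dv 0%N x isT (in01 _ x01).
  by rewrite derive1E; exact: derivableP.
have [L L0 h] := hL; have z01 : (0 : R) \in `[0, 1] by rewrite in_itv/= lexx ler01.
exists (`|derive1 v 0| + L) => x x01.
rewrite -[derive1 v x](subrK (derive1 v 0)) addrC (le_trans (ler_normD _ _))// lerD2l.
apply: (le_trans (h _ _ x01 z01)); rewrite subr0; move: x01; rewrite in_itv/= => /andP[x0 x1].
by rewrite ger0_norm// ler_piMr.
Qed.

Lemma smooth01_phi g dg : smooth01 g dg -> smooth01 (phi g) (fun x => g x + x * dg x).
Proof.
move=> gdg; have [Mg hMg] := smooth01_bounded gdg.
have [v [vg vdg [M hM]]] := gdg.
exists (fun x => x * v x); split.
- by move=> x x01; rewrite vg.
- move=> x x01; have dv := vdg _ x01.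
  apply: is_derive_eq; rewrite /= -(vg _ x01) [_ *: 1]mulr1 addrC.
  by congr (_ + _).
exists (Mg + M) => x x01; rewrite (le_trans (ler_normD _ _))// lerD ?hMg//.
rewrite normrM (le_trans _ (hM _ x01))// ler_piMl//.
by move: x01; rewrite in_itv/= => /andP[x0 x1]; rewrite ger0_norm.
Qed.

Lemma smooth01_psi g dg : smooth01 g dg ->
  smooth01 (psi g) (fun x => 2 * g x - 1 + (2 * x - 1) * dg x).
Proof.
move=> gdg; have [Mg hMg] := smooth01_bounded gdg.
have [v [vg vdg [M hM]]] := gdg.
exists (fun x => x * v x + (1 - x) * (1 - v x)); split.
- by move=> x x01; rewrite vg.
- move=> x x01; have dv := vdg _ x01.
  apply: is_derive_eq; rewrite /= -(vg _ x01).
  by rewrite /GRing.scale/=; ring.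
exists (2 * Mg + 1 + M) => x x01; rewrite (le_trans (ler_normD _ _))// lerD//.
  by rewrite (le_trans (ler_normB _ _))// normr1 lerD2r normrM gtr0_norm// ler_pM2l// hMg.
rewrite normrM (le_trans _ (hM _ x01))// ler_piMl//.
by move: x01; rewrite in_itv/= => /andP[x0 x1]; rewrite ler_norml; apply/andP; split; lra.
Qed.

End Smooth.

(** * Random variables determined by finitely many coordinates *)

Definition agreeOn {T : Type} {I : eqType} (zeta : I -> T -> nat) (s : seq I) (w w' : T) :=
  forall i, i \in s -> zeta i w = zeta i w'.

Section Coordinates.
Variables (I : eqType).

(** Condition on the value of the first coordinate: the set is a countable
    union of pieces, each cut out by the remaining coordinates. *)
Lemma measurable_determined d (T : measurableType d) (zeta : I -> T -> nat) (s : seq I) :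
  (forall i v, i \in s -> measurable (zeta i @^-1` [set v])) ->
  forall D : set T, determined (agreeOn zeta s) D -> measurable D.
Proof.
elim: s => [|i s IH] hz D hD.
  have [->|/set0P[w Dw]] := eqVneq D set0; first exact: measurable0.
  rewrite (_ : D = setT); first exact: measurableT.
  by apply/seteqP; split => // w' _; rewrite -(hD w).
pose Dv v := [set w | exists w', [/\ D w', zeta i w' = v & agreeOn zeta s w w']].
rewrite (_ : D = \bigcup_v (zeta i @^-1` [set v] `&` Dv v)); last first.
  apply/seteqP; split => [w Dw|w [v _ [/= wv [w' [Dw' w'v ww']]]]].
    by exists (zeta i w) => //; split => //; exists w.
  rewrite (hD w w') // => j; rewrite inE => /predU1P[->|]; first by rewrite wv.
  exact: ww'.
apply: bigcup_measurable => v _; apply: measurableI.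
  by apply: hz; rewrite mem_head.
apply: IH => [j v' js|w1 w2 w12]; first by apply: hz; rewrite inE js orbT.
apply/propext; split => -[w' [Dw' w'v ww']]; exists w'; split => // j js.
  by rewrite -w12// ww'.
by rewrite w12// ww'.
Qed.

Lemma measurable_fun_determined d (T : measurableType d) (R : realType) (zeta : I -> T -> nat) (s : seq I)
    (f : T -> R) :
  (forall i v, i \in s -> measurable (zeta i @^-1` [set v])) ->
  determined (agreeOn zeta s) f -> measurable_fun setT f.
Proof.
move=> hz hf _ B mB; rewrite setTI; apply: measurable_determined hz _ _ => w w' ww'.
by rewrite /preimage/= (hf w w').
Qed.

(** Conditioning on one coordinate after the other cuts [D] into finitely many
    pieces of [G] on which [xi] is constant. *)
Lemma orth_determined d (T : measurableType d) (R : realType) (P : probability T R)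
    (zeta : I -> T -> nat) (bound : I -> nat) (s : seq I) (G : set (set T)) (Y : T -> R) :
  (forall i v, i \in s -> G (zeta i @^-1` [set v])) ->
  (forall i w, i \in s -> (zeta i w < bound i)%N) ->
  (forall A B, G A -> G B -> G (A `&` B)) ->
  (forall D, G D -> measurable D) ->
  bddMeas Y ->
  (forall D, G D -> \int[P]_w (\1_D w * Y w) = 0) ->
  forall (xi : T -> R) D, bddMeas xi -> G D ->
    (forall w w', D w -> D w' -> agreeOn zeta s w w' -> xi w = xi w') ->
    \int[P]_w (\1_D w * (xi w * Y w)) = 0.
Proof.
move=> + + GI Gm bY Y0 xi + bxi; elim: s => [|i s IH] hz hb D GD hD.
  have [->|/set0P[w0 Dw0]] := eqVneq D set0.
    under eq_Rintegral do rewrite indic0 mul0r; exact: Exp_cst.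
  rewrite (_ : \int[P]_w _ = \int[P]_w (xi w0 * (\1_D w * Y w))).
    by rewrite ExpZ ?Y0 ?mulr0//; apply: bddMeasM => //; exact/bddMeas_indic/Gm.
  apply: eq_Rintegral => w _; rewrite indicE; have [/set_mem Dw|_] := boolP (w \in D).
    by rewrite !mul1r (hD w w0).
  by rewrite !mul0r mulr0.
have zi v : G (zeta i @^-1` [set v]) by apply: hz; rewrite mem_head.
have GDv v : G (D `&` zeta i @^-1` [set v]) by exact: GI.
rewrite (_ : \int[P]_w _ = \int[P]_w (\sum_(v <- iota 0 (bound i))
     \1_(D `&` zeta i @^-1` [set v]) w * (xi w * Y w))).
  rewrite Exp_sum => [|v].
    rewrite big1// => v _; apply: IH => //.
    - by move=> j v' js; apply: hz; rewrite inE js orbT.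
    - by move=> j w js; apply: hb; rewrite inE js orbT.
    move=> w w' [Dw wv] [Dw' wv'] ww'; apply: hD => // j; rewrite inE => /predU1P[->|]; last exact: ww'.
    by rewrite wv wv'.
  by apply: bddMeasM; [exact/bddMeas_indic/Gm|exact: bddMeasM].
apply: eq_Rintegral => w _; rewrite -mulr_suml; congr (_ * _).
rewrite (bigD1_seq (zeta i w)) ?iota_uniq//=; last first.
  by rewrite mem_iota leq0n add0n hb// mem_head.
rewrite big1 => [|v vw]; last first.
  by rewrite indicI/= [X in _ * X]indicE memNset ?mulr0//= => /esym/eqP; rewrite (negbTE vw).
by rewrite addr0 indicI/= [X in _ * X]indicE mem_set//= mulr1.
Qed.

End Coordinates.

Lemma condprob_orth d (T : measurableType d) (R : realType) (P : probability T R)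
    (G : set (set T)) (E D : set T) (q : T -> R) :
  isCondProb P G E q -> bddMeas q -> measurable E -> measurable D -> G D ->
  \int[P]_w (\1_D w * (\1_E w - q w)) = 0.
Proof.
move=> [_ hq] bq mE mD GD.
have b1 : bddMeas (\1_D : T -> R) by exact: bddMeas_indic.
have b2 : bddMeas (\1_E : T -> R) by exact: bddMeas_indic.
under eq_Rintegral do rewrite mulrBr.
rewrite ExpB; [|exact: bddMeasM..].
apply/eqP; rewrite subr_eq0; apply/eqP.
rewrite (_ : \int[P]_w (\1_D w * \1_E w) = \int[P]_w (\1_(D `&` E) w)); last first.
  by apply: eq_Rintegral => w _; rewrite indicI.
rewrite Exp_indic; last exact: measurableI.
rewrite hq// /Rintegral; congr fine; rewrite [LHS]integral_mkcond.
apply: eq_integral => w _ /=; rewrite patchE indicE.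
by case: ifP => _; rewrite ?mul1r ?mul0r.
Qed.

(** * Sums over all samples *)

Section Samples.

Fixpoint samples (n k : nat) : seq (seq nat) :=
  if k is k'.+1 then [seq v :: l | v <- iota 1 n, l <- samples n k'] else [:: [::]].

Lemma mem_samples n k l :
  (l \in samples n k) = (size l == k) && all (fun v => v \in iota 1 n) l.
Proof.
elim: k l => [|k IH] l; first by rewrite /= inE; case: l.
apply/allpairsP/idP => [[[v l'] /= [vn l'k ->]]|].
  by move: l'k; rewrite IH /= eqSS vn => /andP[-> ->].
case: l => [//|v l] /=; rewrite eqSS => /and3P[lk vn ln].
by exists (v, l); rewrite IH lk.
Qed.

Lemma samples_uniq n k : uniq (samples n k).
Proof.
elim: k => [//|k IH] /=; apply: allpairs_uniq => //; first exact: iota_uniq.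
by move=> [a b] [c e] _ _ [-> ->].
Qed.

(** Under independent draws of [v] with probability [a v], the number of draws
    in [x] is binomial. *)
Lemma sum_samples (R : realType) (n k : nat) (a : nat -> R) (x : pred nat) (psi : nat -> R) :
  \sum_(v <- iota 1 n) a v = 1 ->
  \sum_(l <- samples n k) (\prod_(v <- l) a v) * psi (count x l) =
  binExp (\sum_(v <- iota 1 n | x v) a v) k psi.
Proof.
move=> a1; set q := \sum_(v <- iota 1 n | _) _; elim: k psi => [|k IH] psi.
  by rewrite /= big_seq1 big_nil mul1r.
rewrite [samples _ _]/= big_allpairs_dep /=.
transitivity (\sum_(v <- iota 1 n) a v * binExp q k (fun j => psi (x v + j)%N)).
  apply: eq_bigr => v _; rewrite -IH mulr_sumr; apply: eq_bigr => l _.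
  by rewrite big_cons mulrA.
rewrite (bigID x)/=.
have -> : 1 - q = \sum_(v <- iota 1 n | ~~ x v) a v.
  by rewrite -a1 (bigID x)/= -/q addrAC subrr add0r.
rewrite /q !mulr_suml; congr (_ + _).
  by apply: eq_bigr => v ->.
by apply: eq_bigr => v /negbTE ->.
Qed.

End Samples.

(** * Degree counts as counts of edges *)

Section GraphCounts.
Variables (N : nat) (k : nat -> nat) (x : nat -> bool) (u : nat -> nat -> nat).
Hypothesis u_range : forall n i, (N <= n)%N -> (0 < i <= k n)%N -> (0 < u n i <= n)%N.

Lemma edges_target n e : e \in edges N k x u n -> (0 < e.2 <= n)%N.
Proof.
elim: n => [//|n IH] /=; case: ltnP => // Nn; rewrite mem_cat => /orP[/IH/andP[-> /leqW->]//|].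
move=> /mapP[i]; rewrite mem_filter mem_iota add1n ltnS => /andP[_ ik] -> /=.
by have /andP[-> /leqW->] := u_range Nn ik.
Qed.

(** Summing in-degrees over vertices is counting edges by their targets, which
    are vertices. *)
Let sum_count (es : seq (nat * nat)) (p : pred nat) n :
  (forall e, e \in es -> (0 < e.2 <= n)%N) ->
  (\sum_(1 <= v < n.+1 | p v) count (fun e => e.2 == v) es)%N = count (fun e => p e.2) es.
Proof.
elim: es => [|e es IH] h /=; first by rewrite big1.
rewrite big_split/= IH => [|e' ee]; last by apply: h; rewrite inE ee orbT.
congr (_ + _)%N; have /andP[e0 en] := h e (mem_head _ _).
rewrite big_mkcond (bigD1_seq e.2) ?iota_uniq//=; last by rewrite mem_index_iota e0 ltnS.
rewrite big1 => [|v ve]; last by rewrite eq_sym (negbTE ve) if_same.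
by rewrite eqxx addn0; case: (p _).
Qed.

Lemma statBE n : statB N k x u n = count (fun e => x e.2) (edges N k x u n).
Proof. by rewrite /statB /indeg sum_count//; exact: edges_target. Qed.

Lemma statCE n : statC N k x u n = size (edges N k x u n).
Proof.
by rewrite /statC /indeg sum_count ?count_predT//; exact: edges_target.
Qed.

Lemma statAS n : statA x n.+1 = (statA x n + x n.+1)%N.
Proof. by rewrite /statA big_mkcond big_nat_recr//= -big_mkcond; case: (x n.+1). Qed.

Lemma statBS n : (N <= n)%N ->
  statB N k x u n.+1 = (statB N k x u n + (if x n.+1 then posSample k x u n else 0))%N.
Proof.
move=> Nn; rewrite !statBE /= ltnNge Nn/= count_cat count_map count_filter; congr (_ + _)%N.
rewrite /posSample; case: (x n.+1) => /=.
  by apply: eq_count => i /=; case: (x (u n i)).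
by apply/eqP; rewrite -leqn0 leqNgt -has_count; apply/hasPn => i _ /=; case: (x (u n i)).
Qed.

Lemma statCS n : (N <= n)%N ->
  statC N k x u n.+1 =
  (statC N k x u n + (if x n.+1 then posSample k x u n else k n - posSample k x u n))%N.
Proof.
move=> Nn; rewrite !statCE /= ltnNge Nn/= size_cat size_map size_filter; congr (_ + _)%N.
rewrite /posSample; case: (x n.+1) => /=.
  by apply: eq_count => i /=; case: (x (u n i)).
have := count_predC (fun i => x (u n i)) (iota 1 (k n)); rewrite size_iota => h.
rewrite -[X in (X - _)%N]h addKn.
by apply: eq_count => i /=; case: (x (u n i)).
Qed.

Lemma posSample_le n : (posSample k x u n <= k n)%N.
Proof. by rewrite /posSample -[leqRHS](size_iota 1 (k n)) count_size. Qed.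

Lemma sizeSumS n : (N <= n)%N -> sizeSum N k n.+1 = (sizeSum N k n + k n)%N.
Proof. by move=> Nn; rewrite /sizeSum big_nat_recr. Qed.

Lemma statA_le n : (statA x n <= n)%N.
Proof.
rewrite /statA sum1_count; apply: leq_trans (count_size _ _) _.
by rewrite size_iota subn1.
Qed.

Lemma statB_le n : (statB N k x u n <= statC N k x u n)%N.
Proof. by rewrite statBE statCE count_size. Qed.

Lemma statC_le n : (statC N k x u n <= sizeSum N k n)%N.
Proof.
elim: n => [|n IH]; first by rewrite statCE.
have [Nn|nN] := leqP N n; last by rewrite statCE /= nN.
rewrite statCS// sizeSumS// leq_add//; case: ifP => _; first exact: posSample_le.
exact: leq_subr.
Qed.

End GraphCounts.

(** * Conditional laws of the next sample and of the next state *)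

Section Locality.
Variables (N : nat) (k : nat -> nat) (x x' : nat -> bool) (u u' : nat -> nat -> nat) (n : nat).
Hypothesis u_range : forall n i, (N <= n)%N -> (0 < i <= k n)%N -> (0 < u n i <= n)%N.
Hypothesis xx' : forall i, (0 < i <= n)%N -> x i = x' i.

Lemma eq_edges : 
  (forall j i, (N <= j < n)%N -> (0 < i <= k j)%N -> u j i = u' j i) ->
  edges N k x u n = edges N k x' u' n.
Proof.
elim: n xx' => [//|m IH] hx hu /=; case: ltnP => // Nm; rewrite IH; last 2 first.
- by move=> i /andP[i0 im]; rewrite hx// i0 leqW.
- by move=> j i /andP[Nj jm]; apply: hu; rewrite Nj leqW.
congr (_ ++ _).
have uu i : i \in iota 1 (k m) -> u m i = u' m i.
  by rewrite mem_iota add1n ltnS => ik; apply: hu => //; rewrite Nm /=.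
rewrite (@eq_in_filter _ _ (fun i => x' (u' m i) == x' m.+1)).
  by apply/eq_in_map => i; rewrite mem_filter => /andP[_ /uu ->].
move=> i ik; rewrite -uu// -(hx m.+1) ?leqnn// -hx//.
have := ik; rewrite mem_iota add1n ltnS => ik'.
by have /andP[-> /leqW ->] := u_range Nm ik'.
Qed.

Lemma eq_posSample : (N <= n)%N -> (forall i, (0 < i <= k n)%N -> u n i = u' n i) ->
  posSample k x u n = posSample k x' u' n.
Proof.
move=> Nn hu; apply: eq_in_count => i; rewrite mem_iota add1n ltnS => ik.
by rewrite -hu// xx'// u_range.
Qed.

End Locality.

Section Model.
Context (R : realType) (d : measure_display) (T : measurableType d) (P : probability T R).
Variables (N : nat) (k : nat -> nat) (X : nat -> T -> bool) (U : nat -> nat -> T -> nat).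
Variables (g : R -> R) (beta : nat -> R).
Hypothesis rG : reinforcedGraph P N k X U g beta.
Hypothesis k_gt0 : forall n, (N <= n)%N -> (0 < k n)%N.
Hypothesis g01 : forall x : R, x \in `[0, 1] -> g x \in `[0, 1].
Hypothesis N0 : (0 < N)%N.
Hypothesis beta0 : forall n, (N <= n)%N -> 0 < beta n.

Let uw (w : T) : nat -> nat -> nat := fun j i => U j i w.

Let uw_range w n i : (N <= n)%N -> (0 < i <= k n)%N -> (0 < uw w n i <= n)%N.
Proof. by move=> Nn ik; exact: sample_range rG _ _ _ Nn ik. Qed.

(** Coordinate [inl i] is the state of vertex [i], and [inr (j, i)] the [i]th
    draw at epoch [j]. *)
Definition coordinate (i : nat + nat * nat) (w : T) : nat :=
  match i with inl i => X i w | inr ji => U ji.1 ji.2 w end.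

Definition coordinates (n m : nat) : seq (nat + nat * nat) :=
  [seq inl i | i <- iota 1 n] ++
  [seq inr (j, i) | j <- iota N (m - N), i <- iota 1 (k j)].

Definition agree n m := agreeOn coordinate (coordinates n m).

Lemma mem_coordinates_state n m i : (inl i \in coordinates n m) = (0 < i <= n)%N.
Proof.
rewrite mem_cat mem_map; last by move=> ? ? [].
rewrite mem_iota add1n ltnS; case: andP => //= _.
by apply/allpairsPdep => -[? [? []]].
Qed.

Lemma mem_coordinates_sample n m j i :
  (inr (j, i) \in coordinates n m) = (N <= j < m)%N && (0 < i <= k j)%N.
Proof.
rewrite mem_cat orbC; case: allpairsPdep => /= [[j' [i' [jN ik [-> ->]]]]|h].
  move: jN ik; rewrite !mem_iota add1n ltnS => /andP[Nj jm] ->; rewrite Nj.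
  have Nm : (N < m)%N.
    by rewrite -subn_gt0 lt0n; apply/eqP => e; move: jm; rewrite e addn0 ltnNge Nj.
  by move: jm; rewrite subnKC ?(ltnW Nm)// => ->.
have -> : (inr (j, i) \in [seq inl i0 | i0 <- iota 1 n]) = false by apply/mapP => -[].
apply/esym/negP => /andP[/andP[Nj jm] ik]; apply: h; exists j, i; split => //.
  by rewrite mem_iota Nj subnKC// (leq_trans Nj (ltnW jm)).
by rewrite mem_iota add1n ltnS.
Qed.

Lemma agree_state n m w w' i : agree n m w w' -> (0 < i <= n)%N -> X i w = X i w'.
Proof.
move=> ww' i_n; have := ww' (inl i); rewrite mem_coordinates_state => /(_ i_n) /=.
by case: (X i w); case: (X i w').
Qed.

Lemma agree_sample n m w w' j i : agree n m w w' -> (N <= j < m)%N -> (0 < i <= k j)%N ->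
  U j i w = U j i w'.
Proof. by move=> ww' jm ik; apply: (ww' (inr (j, i))); rewrite mem_coordinates_sample jm. Qed.

Lemma agree_mono n m n' m' w w' : (n <= n')%N -> (m <= m')%N -> agree n' m' w w' -> agree n m w w'.
Proof.
move=> nn' mm' h [i|[j i]] hi; apply: h.
  by move: hi; rewrite !mem_coordinates_state => /andP[-> /leq_trans]; apply.
by move: hi; rewrite !mem_coordinates_sample => /andP[/andP[-> /leq_trans->//] ->].
Qed.

Lemma coordinate_measurable n m i v : i \in coordinates n m ->
  measurable (coordinate i @^-1` [set v]).
Proof.
case: i => [i|[j i]].
  rewrite mem_coordinates_state => /andP[i0 _].
  have mX := state_measurable rG i0.
  case: v => [|[|v]].
  - rewrite (_ : _ @^-1` _ = ~` (X i @^-1` [set true])); first exact: measurableC.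
    by apply/seteqP; split => w /=; case: (X i w).
  - rewrite (_ : _ @^-1` _ = X i @^-1` [set true])//.
    by apply/seteqP; split => w /=; case: (X i w).
  - rewrite (_ : _ @^-1` _ = set0); first exact: measurable0.
    by apply/seteqP; split => w //=; case: (X i w).
rewrite mem_coordinates_sample => /andP[/andP[Nj _] ik].
exact: sample_measurable rG _ _ _ Nj ik.
Qed.

Lemma info_coordinate n m i v : i \in coordinates n m ->
  info N k X U n m (coordinate i @^-1` [set v]).
Proof.
have inf0 : info N k X U n m set0 by apply: sigma_algebra0; exact: smallest_sigma_algebra.
case: i => [i|[j i]].
  rewrite mem_coordinates_state => i_n.
  have mX : info N k X U n m (X i @^-1` [set true]).
    by apply: sub_sigma_algebra; left; exists i.
  case: v => [|[|v]].
  - rewrite (_ : _ @^-1` _ = setT `\` (X i @^-1` [set true])).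
      by apply: sigma_algebraCD mX; exact: smallest_sigma_algebra.
    apply/seteqP; split => [w /= h|w [_ /= h]]; last by move: h; case: (X i w).
    by split => //; move: h => /=; case: (X i w).
  - rewrite (_ : _ @^-1` _ = X i @^-1` [set true])//.
    by apply/seteqP; split => w /=; case: (X i w).
  - rewrite (_ : _ @^-1` _ = set0)//.
    by apply/seteqP; split => w //=; case: (X i w).
rewrite mem_coordinates_sample => /andP[jm ik].
by apply: sub_sigma_algebra; right; exists j, i, v.
Qed.

Lemma info_measurable n m D : info N k X U n m D -> measurable D.
Proof.
apply: smallest_sub; first exact: sigma_algebra_measurable.
move=> _ [[i /andP[i0 _] ->]|[j [i [v [/andP[Nj _] ik ->]]]]].
  exact: state_measurable rG _ i0.
exact: sample_measurable rG _ _ _ Nj ik.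
Qed.

Lemma info_setI n m A B : info N k X U n m A -> info N k X U n m B ->
  info N k X U n m (A `&` B).
Proof.
rewrite /info => hA hB.
exact: (@measurableI _ (g_sigma_algebraType _) A B hA hB).
Qed.

Lemma determined_bddMeas n m (f : T -> R) : determined (agree n m) f ->
  (exists M, forall w, `|f w| <= M) -> bddMeas f.
Proof.
move=> df bf; split => //; apply: measurable_fun_determined df => i v.
exact: coordinate_measurable.
Qed.

(** An identity of conditional probabilities tested on events extends to
    bounded variables that depend on the same finitely many coordinates. *)
Lemma orth_info n m (Y xi : T -> R) : bddMeas Y ->
  (forall D, info N k X U n m D -> \int[P]_w (\1_D w * Y w) = 0) ->
  determined (agree n m) xi -> bddMeas xi ->
  \int[P]_w (xi w * Y w) = 0.
Proof.
move=> bY Y0 dxi bxi.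
have := @orth_determined _ _ T R P coordinate 
  (fun i => match i with inl _ => 2 | inr ji => ji.1.+1 end)
  (coordinates n m) (info N k X U n m) Y
  (fun i v h => info_coordinate v h) _ (@info_setI n m) (@info_measurable n m) bY Y0 xi setT bxi.
rewrite (_ : \int[P]_w (\1_setT w * (xi w * Y w)) = \int[P]_w (xi w * Y w)).
  apply.
  - move=> [i|[j i]] w; first by move=> _ /=; case: (X i w).
    rewrite mem_coordinates_sample => /andP[/andP[Nj _] ik]; rewrite ltnS.
    by have /andP[] := uw_range w Nj ik.
  - exact: (@measurableT _ (g_sigma_algebraType _)).
  - by move=> w w' _ _; exact: dxi.
by apply: eq_Rintegral => w _; rewrite indicT mul1r.
Qed.

Definition posFrac n w : R := (posSample k (X ^~ w) (fun j i => U j i w) n)%:R / (k n)%:R.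

Lemma posFrac01 n w : (N <= n)%N -> posFrac n w \in `[0, 1].
Proof.
move=> Nn; rewrite in_itv/= divr_ge0// ler_pdivrMr ?ltr0n ?k_gt0// mul1r ler_nat.
exact: posSample_le.
Qed.

Lemma posSample_det n : (N <= n)%N ->
  determined (agree n n.+1) (fun w => posSample k (X ^~ w) (fun j i => U j i w) n).
Proof.
move=> Nn w w' ww'; apply: (@eq_posSample N) => //.
- by move=> n' i; exact: uw_range.
- by move=> i; exact: agree_state ww'.
by move=> i ik; apply: agree_sample ww' _ ik; rewrite Nn /=.
Qed.

Lemma edges_det n : 
  determined (agree n n) (fun w => edges N k (X ^~ w) (fun j i => U j i w) n).
Proof.
move=> w w' ww'; apply: eq_edges => //.
- by move=> n' i; exact: uw_range.
- by move=> i; exact: agree_state ww'.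
by move=> j i; exact: agree_sample ww'.
Qed.

Lemma attach_det n v :
  determined (agree n n) (fun w => attach N k (X ^~ w) (fun j i => U j i w) beta n v).
Proof.
move=> w w' /edges_det ee; rewrite /attach /indeg ee.
by congr (_ / (_ + _)).
Qed.

Lemma attach_ge0 n w v : (N <= n)%N -> 
  0 <= attach N k (X ^~ w) (fun j i => U j i w) beta n v.
Proof.
move=> Nn; rewrite divr_ge0// addr_ge0 ?sumr_ge0 ?mulr_ge0//; exact/ltW/beta0.
Qed.

Lemma sum_attach n w : (N <= n)%N ->
  \sum_(v <- iota 1 n) attach N k (X ^~ w) (fun j i => U j i w) beta n v = 1.
Proof.
move=> Nn; rewrite /attach -mulr_suml big_split/=.
have h : \sum_(v <- iota 1 n) (indeg N k (X ^~ w) (fun j i => U j i w) n v)%:R =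
  \sum_(1 <= j < n.+1) (indeg N k (X ^~ w) (fun j i => U j i w) n j)%:R :> R.
  by rewrite /index_iota subSS subn0.
have -> : \sum_(v <- iota 1 n) beta n = n%:R * beta n.
  by rewrite big_const_seq count_predT size_iota iter_addr_0 mulr_natl.
rewrite h divff// gt_eqF// ltr_wpDl//.
  by rewrite sumr_ge0.
by rewrite mulr_gt0 ?beta0// ltr0n (leq_trans N0).
Qed.

(** The conditional probability that a draw at epoch [n] has state +1. *)
Definition posProb n w : R :=
  \sum_(v <- iota 1 n | X v w) attach N k (X ^~ w) (fun j i => U j i w) beta n v.

Lemma posProb01 n w : (N <= n)%N -> 0 <= posProb n w <= 1.
Proof.
move=> Nn; rewrite sumr_ge0 => [|v _]; last exact: attach_ge0.
rewrite -(sum_attach w Nn) [leRHS](bigID (fun v => X v w))/= lerDl.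
by rewrite sumr_ge0// => v _; exact: attach_ge0.
Qed.

Lemma posProb_det n : determined (agree n n) (posProb n).
Proof.
move=> w w' ww'; rewrite /posProb big_seq_cond [RHS]big_seq_cond.
apply: eq_big => [v|v _]; last exact: attach_det.
by rewrite mem_iota add1n ltnS; case: (boolP (0 < v <= n)%N) => //= /(agree_state ww') ->.
Qed.

Lemma state_orth n (xi : T -> R) : (N <= n)%N -> determined (agree n n.+1) xi -> bddMeas xi ->
  \int[P]_w (xi w * ((X n.+1 w)%:R - g (posFrac n w))) = 0.
Proof.
move=> Nn dxi bxi.
have mX : measurable (X n.+1 @^-1` [set true]) by exact: state_measurable rG _ _.
have bg : bddMeas (fun w => g (posFrac n w)).
  apply: (@determined_bddMeas n n.+1).
    by move=> w w' ww'; rewrite /posFrac (posSample_det Nn ww').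
  exists 1 => w; have := g01 (posFrac01 w Nn); rewrite in_itv/= => /andP[? ?].
  by rewrite ger0_norm.
have XE w : (X n.+1 w)%:R = \1_(X n.+1 @^-1` [set true]) w :> R.
  by rewrite indicE; congr (_%:R); congr nat_of_bool; apply/idP/idP => [/mem_set|/set_mem].
under eq_Rintegral do rewrite XE.
apply: (@orth_info n n.+1) => //.
  by apply: bddMeasB => //; exact: bddMeas_indic.
move=> D hD; apply: (condprob_orth (state_law rG Nn)) => //.
exact: info_measurable hD.
Qed.

Let sampleSet n (l : seq nat) : set T :=
  [set w | forall i, (0 < i <= k n)%N -> U n i w = nth 0%N l i.-1].

Let sampleSet_measurable n l : (N <= n)%N -> measurable (sampleSet n l).
Proof.
move=> Nn; apply: (@measurable_determined _ _ T coordinate (coordinates 0 n.+1)).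
  by move=> i v; exact: coordinate_measurable.
move=> w w' ww'; apply/propext.
have uu i : (0 < i <= k n)%N -> U n i w = U n i w'.
  by move=> ik; apply: agree_sample ww' _ ik; rewrite Nn /=.
by split=> h i ik; rewrite -h// uu.
Qed.

Lemma prod_attach_bddMeas n l : (N <= n)%N -> l \in samples n (k n) ->
  bddMeas (fun w => \prod_(v <- l) attach N k (X ^~ w) (fun j i => U j i w) beta n v).
Proof.
move=> Nn; rewrite mem_samples => /andP[_ /allP ln].
apply: (@determined_bddMeas n n).
  by move=> w w' ww'; apply: eq_bigr => v _; exact: attach_det.
exists 1 => w; rewrite ger0_norm; last by rewrite prodr_ge0// => v _; exact: attach_ge0.
rewrite big_seq; apply: prodr_ile1 => v vl; rewrite attach_ge0//=.
rewrite -(sum_attach w Nn) (bigD1_seq v) ?iota_uniq ?ln//= lerDl.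
by rewrite sumr_ge0// => j _; exact: attach_ge0.
Qed.

Lemma sample_orth n l (xi : T -> R) : (N <= n)%N -> l \in samples n (k n) ->
  determined (agree n n) xi -> bddMeas xi ->
  \int[P]_w (xi w * (\1_(sampleSet n l) w -
     \prod_(v <- l) attach N k (X ^~ w) (fun j i => U j i w) beta n v)) = 0.
Proof.
move=> Nn ls; move: (ls); rewrite mem_samples => /andP[/eqP lk /allP ln] dxi bxi.
have lE w : \prod_(v <- l) attach N k (X ^~ w) (fun j i => U j i w) beta n v =
   \prod_(1 <= i < (k n).+1) attach N k (X ^~ w) (fun j i => U j i w) beta n (nth 0%N l i.-1).
  by rewrite [LHS](big_nth 0%N) lk [RHS]big_add1.
have bp := prod_attach_bddMeas Nn ls.
have mS := sampleSet_measurable l Nn.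
apply: (@orth_info n n) => //; first by apply: bddMeasB => //; exact: bddMeas_indic.
move=> D hD; apply: (@condprob_orth _ _ _ _ (info N k X U n n)) => //; last exact: info_measurable hD.
rewrite (_ : (fun w => \prod_(v <- l) _) = (fun w => \prod_(1 <= i < (k n).+1)
   attach N k (X ^~ w) (fun j i => U j i w) beta n (nth 0%N l i.-1))).
  apply: (sample_law rG Nn) => -[//|i] /= ik.
  have : nth 0%N l i \in iota 1 n by apply: ln; rewrite mem_nth// lk.
  by rewrite mem_iota add1n ltnS.
by apply/funext => w.
Qed.

(** Given the past, the number of positive draws is binomial. Sum the joint law
    of the sample over all possible samples, the states of the drawn vertices
    being known at epoch [n]. *)
Lemma sample_mean n (psi : nat -> R) (xi : T -> R) : (N <= n)%N ->
  determined (agree n n) xi -> bddMeas xi ->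
  \int[P]_w (xi w * psi (posSample k (X ^~ w) (fun j i => U j i w) n)) =
  \int[P]_w (xi w * binExp (posProb n w) (k n) psi).
Proof.
move=> Nn dxi bxi.
pose xil l w := xi w * psi (count (X ^~ w) l).
have dxil l : l \in samples n (k n) -> determined (agree n n) (xil l).
  rewrite mem_samples => /andP[_ /allP ln] w w' ww'; rewrite /xil (dxi _ _ ww').
  congr (_ * psi _); apply: eq_in_count => v /ln; rewrite mem_iota add1n ltnS.
  exact: agree_state ww'.
have [M hM] := bxi.2.
have bxil l : l \in samples n (k n) -> bddMeas (xil l).
  move=> ln; apply: (determined_bddMeas (dxil l ln)).
  exists (M * \big[Num.max/0]_(j < (size l).+1) `|psi j|) => w.
  rewrite normrM ler_pM//.
  have cl : (count (X ^~ w) l < (size l).+1)%N by rewrite ltnS count_size.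
  exact: (le_bigmax _ (fun j : 'I_(size l).+1 => `|psi j|) (Ordinal cl)).
pose Z l w : R := \1_(sampleSet n l) w -
     \prod_(v <- l) attach N k (X ^~ w) (fun j i => U j i w) beta n v.
have split w : xi w * psi (posSample k (X ^~ w) (fun j i => U j i w) n) -
    xi w * binExp (posProb n w) (k n) psi = \sum_(l <- samples n (k n)) xil l w * Z l w.
  rewrite /Z /xil; under [RHS]eq_bigr do rewrite mulrBr.
  rewrite sumrB; congr (_ - _).
    pose lw := [seq U n i w | i <- iota 1 (k n)].
    have lwin : lw \in samples n (k n).
      rewrite mem_samples size_map size_iota eqxx /=; apply/allP => v /mapP[i].
      rewrite mem_iota add1n ltnS => ik ->; rewrite mem_iota add1n ltnS.
      exact: uw_range.
    rewrite (bigD1_seq lw) ?samples_uniq//= big1_seq => [|l /andP[llw ls]].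
      rewrite addr0 [X in _ = _ * X](_ : _ = 1).
        by rewrite mulr1 /posSample count_map.
      rewrite indicE mem_set//= => -[//|i] ik.
      by rewrite (nth_map 0%N) ?size_iota// nth_iota// add1n.
    rewrite [X in _ * X](_ : _ = 0) ?mulr0// indicE memNset//= => h.
    move/negP: llw; apply; apply/eqP/(@eq_from_nth _ 0%N).
      by move: ls; rewrite mem_samples size_map size_iota => /andP[/eqP].
    move: ls; rewrite mem_samples => /andP[/eqP lk _]; rewrite lk => i ik.
    by rewrite (nth_map 0%N) ?size_iota// nth_iota// add1n -(h i.+1).
  rewrite /posProb -sum_samples ?sum_attach// mulr_sumr.
  by apply: eq_bigr => l _; ring.
have bP : bddMeas (fun w => xi w * psi (posSample k (X ^~ w) (fun j i => U j i w) n)).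
  apply: (@determined_bddMeas n n.+1).
    move=> w w' ww'; rewrite (posSample_det Nn ww'); congr (_ * _); apply: dxi.
    by apply: agree_mono ww' => //; exact: leqW.
  exists (M * \big[Num.max/0]_(j < (k n).+1) `|psi j|) => w.
  rewrite normrM ler_pM//.
  have cl : (posSample k (X ^~ w) (fun j i => U j i w) n < (k n).+1)%N by rewrite ltnS posSample_le.
  exact: (le_bigmax _ (fun j : 'I_(k n).+1 => `|psi j|) (Ordinal cl)).
have bB : bddMeas (fun w => xi w * binExp (posProb n w) (k n) psi).
  apply: (@determined_bddMeas n n).
    by move=> w w' ww'; rewrite (posProb_det ww') (dxi _ _ ww').
  exists (M * \big[Num.max/0]_(j < (k n).+1) `|psi j|) => w.
  rewrite normrM ler_pM// ler_norml.
  apply: binExp_bounds; first exact: posProb01.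
  move=> j jk; rewrite -ler_norml.
  have cl : (j < (k n).+1)%N by rewrite ltnS.
  exact: (le_bigmax _ (fun j : 'I_(k n).+1 => `|psi j|) (Ordinal cl)).
apply/eqP; rewrite -subr_eq0 -ExpB//; apply/eqP.
under eq_Rintegral do rewrite split big_seq big_mkcond.
rewrite Exp_sum => [|l]; last first.
  have [ls|_] := boolP (l \in samples n (k n)); last exact: bddMeas_cst.
  apply: (bddMeasM (bxil l ls)); apply: bddMeasB; last exact: prod_attach_bddMeas.
  exact/bddMeas_indic/sampleSet_measurable.
rewrite big1// => l _; have [ls|_] := boolP (l \in samples n (k n)); last exact: Exp_cst.
exact: (sample_orth Nn ls (dxil l ls) (bxil l ls)).
Qed.

End Model.

(** * The martingale differences of the proportions *)

Section Noise.
Context (R : realType) (d : measure_display) (T : measurableType d) (P : probability T R).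
Variables (N : nat) (k : nat -> nat) (X : nat -> T -> bool) (U : nat -> nat -> T -> nat).
Variables (g : R -> R) (beta : nat -> R).
Hypothesis rG : reinforcedGraph P N k X U g beta.
Hypothesis k_gt0 : forall n, (N <= n)%N -> (0 < k n)%N.
Hypothesis g01 : forall x : R, x \in `[0, 1] -> g x \in `[0, 1].
Hypothesis N0 : (0 < N)%N.
Hypothesis beta0 : forall n, (N <= n)%N -> 0 < beta n.

(** Each proportion moves towards a reward of this form, with [(a, b)] equal to
    [(1, 0)], [(y, 0)] and [(y, 1 - y)] as functions of the positive fraction
    [y] of the sample. *)
Definition reward (a b : R -> R) n w : R :=
  if X n.+1 w then a (posFrac R k X U n w) else b (posFrac R k X U n w).

Definition meanReward (a b : R -> R) (y : R) : R := g y * a y + (1 - g y) * b y.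

(** The second term is the mean of the first given the past. *)
Definition noise (a b : R -> R) n w : R :=
  reward a b n w -
  binExp (posProb N k X U beta n w) (k n) (fun j => meanReward a b (j%:R / (k n)%:R)).

Variables (a b : R -> R).
Hypothesis a01 : forall x : R, x \in `[0, 1] -> a x \in `[0, 1].
Hypothesis b01 : forall x : R, x \in `[0, 1] -> b x \in `[0, 1].

Let frac01 n j : (N <= n)%N -> (j <= k n)%N -> (j%:R / (k n)%:R : R) \in `[0, 1].
Proof.
by move=> Nn jk; rewrite in_itv/= divr_ge0// ler_pdivrMr ?ltr0n ?k_gt0// mul1r ler_nat.
Qed.

Let reward01 n w : (N <= n)%N -> 0 <= reward a b n w <= 1.
Proof.
move=> Nn; have p01 := posFrac01 R X U k_gt0 w Nn.
by rewrite /reward; case: ifP => _; [have := a01 p01|have := b01 p01]; rewrite in_itv.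
Qed.

Let meanReward01 y : y \in `[0, 1] -> 0 <= meanReward a b y <= 1.
Proof.
move=> y01; have := g01 y01; have := a01 y01; have := b01 y01; rewrite !in_itv/= /meanReward.
move=> /andP[? ?] /andP[? ?] /andP[? ?].
have h1 : 0 <= g y * a y by rewrite mulr_ge0.
have h2 : 0 <= (1 - g y) * b y by rewrite mulr_ge0// subr_ge0.
have h3 : g y * a y <= g y by rewrite ler_piMr.
have h4 : (1 - g y) * b y <= 1 - g y by rewrite ler_piMr// subr_ge0.
by apply/andP; split; lra.
Qed.

Let noise_le1 n w : (N <= n)%N -> `|noise a b n w| <= 1.
Proof.
move=> Nn; have /andP[? ?] := reward01 w Nn.
have := @binExp_bounds _ (posProb N k X U beta n w) (k n) 
  (fun j => meanReward a b (j%:R / (k n)%:R)) 0 1 (posProb01 k X U N0 beta0 w Nn).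
move=> /(_ (fun j jk => meanReward01 (frac01 Nn jk))) /andP[? ?].
by rewrite /noise ler_norml; apply/andP; split; lra.
Qed.

Let posFrac_det n : (N <= n)%N ->
  determined (agree N k X U n n.+1) (posFrac R k X U n).
Proof. by move=> Nn w w' ww'; rewrite /posFrac (posSample_det rG Nn ww'). Qed.

Let noise_det n : (N <= n)%N -> determined (agree N k X U n.+1 n.+1) (noise a b n).
Proof.
move=> Nn w w' ww'.
have ww1 : agree N k X U n n.+1 w w' by exact: agree_mono (leqnSn n) (leqnn _) ww'.
have ww2 : agree N k X U n n w w' by exact: agree_mono (leqnSn n) (leqnSn n) ww'.
rewrite /noise /reward (posFrac_det Nn ww1) (posProb_det rG ww2).
by rewrite (agree_state (i := n.+1) ww')//= leqnn.
Qed.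

(** Average first over the state given the sample, then over the sample. *)
Let noise_orth n (xi : T -> R) : (N <= n)%N -> determined (agree N k X U n n) xi -> bddMeas xi ->
  \int[P]_w (xi w * noise a b n w) = 0.
Proof.
move=> Nn dxi bxi.
pose p := posFrac R k X U n.
have dxi1 : determined (agree N k X U n n.+1) xi.
  by move=> w w' ww'; apply: dxi; exact: agree_mono (leqnn n) (leqnSn n) ww'.
have p01 w : p w \in `[0, 1] by exact: (posFrac01 R X U k_gt0 w Nn).
have bf (f : R -> R) : (forall x : R, x \in `[0, 1] -> `|f x| <= 1) -> bddMeas (fun w => f (p w)).
  move=> hf; apply: (determined_bddMeas rG (n := n) (m := n.+1)).
    by move=> w w' ww'; rewrite /p (posFrac_det Nn ww').
  by exists 1 => w; exact: hf.
have ba : bddMeas (fun w => a (p w)).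
  by apply: bf => x /a01; rewrite in_itv/= => /andP[? ?]; rewrite ger0_norm.
have bb : bddMeas (fun w => b (p w)).
  by apply: bf => x /b01; rewrite in_itv/= => /andP[? ?]; rewrite ger0_norm.
have bm : bddMeas (fun w => meanReward a b (p w)).
  by apply: bf => x /meanReward01 /andP[? ?]; rewrite ger0_norm.
have bg : bddMeas (fun w => g (p w)).
  by apply: bf => x /g01; rewrite in_itv/= => /andP[? ?]; rewrite ger0_norm.
have bX : bddMeas (fun w => (X n.+1 w)%:R : R).
  apply: (determined_bddMeas rG (n := n.+1) (m := n.+1)).
    by move=> w w' ww'; rewrite (agree_state (i := n.+1) ww')//= leqnn.
  by exists 1 => w; rewrite ger0_norm// lern1 leq_b1.
pose B w := binExp (posProb N k X U beta n w) (k n) (fun j => meanReward a b (j%:R / (k n)%:R)).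
have bB : bddMeas B.
  apply: (determined_bddMeas rG (n := n) (m := n)).
    by move=> w w' ww'; rewrite /B (posProb_det rG ww').
  exists 1 => w; have := @binExp_bounds _ (posProb N k X U beta n w) (k n) 
    (fun j => meanReward a b (j%:R / (k n)%:R)) 0 1 (posProb01 k X U N0 beta0 w Nn).
  move=> /(_ (fun j jk => meanReward01 (frac01 Nn jk))) /andP[? ?].
  by rewrite ger0_norm.
have bab : bddMeas (fun w => a (p w) - b (p w)) by exact: bddMeasB.
have bxab : bddMeas (fun w => xi w * (a (p w) - b (p w))) by exact: bddMeasM.
have bXg : bddMeas (fun w => (X n.+1 w)%:R - g (p w)) by exact: bddMeasB.
rewrite (_ : \int[P]_w _ = \int[P]_w (xi w * (a (p w) - b (p w)) * ((X n.+1 w)%:R - g (p w)) +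
   (xi w * meanReward a b (p w) - xi w * B w))); last first.
  apply: eq_Rintegral => w _; rewrite /noise /reward -/(p w) -/(B w) /meanReward.
  by case: (X n.+1 w) => /=; ring.
have b1 := bddMeasM bxi bm; have b2 := bddMeasM bxi bB.
rewrite ExpD; [|exact: bddMeasM|exact: bddMeasB].
rewrite ExpB//.
rewrite (state_orth rG k_gt0 g01)//; last first.
  by move=> w w' ww'; rewrite /p (posFrac_det Nn ww') (dxi1 _ _ ww').
have := sample_mean rG N0 beta0 (fun j => meanReward a b (j%:R / (k n)%:R)) Nn dxi bxi.
by rewrite -/(posFrac _ _ _ _ _ _) => ->; rewrite add0r subrr.
Qed.

Lemma noise_cauchy (c : nat -> R) m : (N <= m)%N -> cauchySeries (fun n => c n ^+ 2) ->
  {ae P, forall w, cauchySeries (fun n => c n * noise a b (n + m) w)}.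
Proof.
move=> Nm c2.
have Nnm n : (N <= n + m)%N by exact: leq_trans Nm (leq_addl _ _).
apply: (@martingale_cauchy _ _ _ _ (fun n => agree N k X U (n + m) (n + m))).
- by move=> n w w'; apply: agree_mono; rewrite addSn leqnSn.
- move=> n f df; apply: measurable_fun_determined df => i v.
  exact: (coordinate_measurable rG).
- by move=> n; exact: noise_det.
- by move=> n w; exact: noise_le1.
- by move=> n f df bf; exact: noise_orth.
- by [].
Qed.

End Noise.

(** * Perturbed Euler schemes for the drift *)

Section PerturbedDrift.
Context {R : realType}.
Local Notation E := (R * R * R)%type.
Variables (g : R -> R) (alpha Lg eta1 eta2 : R).
Hypothesis alpha0 : 0 < alpha.
Hypothesis g01 : forall x : R, x \in `[0, 1] -> g x \in `[0, 1].
Hypothesis Lg0 : 0 <= Lg.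
Hypothesis gL : forall x y : R, x \in `[0, 1] -> y \in `[0, 1] -> `|g x - g y| <= Lg * `|x - y|.
Hypothesis eta10 : 0 < eta1.
Variables (z : nat -> E) (e1 e2 e3 gam eta : nat -> R).
Hypothesis zS : forall n, Shat (z n).
Hypothesis gam_gt0 : forall n, 0 < gam n.
Hypothesis gam_cvg0 : gam @ \oo --> 0.
Hypothesis gam_div : forall M, exists n, M <= \sum_(0 <= i < n) gam i.
Hypothesis etaI : forall n, eta1 <= eta n <= eta2.
Hypothesis z_step : forall n, z n.+1 - z n =
  (gam n * eta n * h1 g alpha (z n) + e1 n, gam n * h2 g alpha (z n) + e2 n,
   gam n * h3 g alpha (z n) + e3 n).
Hypothesis e1_cauchy : cauchySeries e1.
Hypothesis e2_cauchy : cauchySeries e2.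
Hypothesis e3_cauchy : cauchySeries e3.

Theorem perturbed_drift_limit_set : exists L : set E,
  [/\ convergesTo z L, compact L /\ connected L,
      chainTransitive (drift g alpha eta1 eta2) L,
      invariantSet (drift g alpha eta1 eta2) L & L `<=` @Shat R].
Proof.
have eta20 : 0 < eta2.
  by have /andP[h1 h2] := etaI 0; rewrite (lt_le_trans eta10)// (le_trans h1).
pose C := 1 + eta2; pose Lam := (1 + eta2) * driftLip alpha Lg.
have C0 : 0 <= C by rewrite addr_ge0// ltW.
have Lh0 : 0 <= driftLip alpha Lg by exact: driftLip_ge0.
have Lam0 : 0 <= Lam by rewrite mulr_ge0.
have LhLam : driftLip alpha Lg <= Lam by rewrite /Lam ler_peMl// lerDl ltW.
pose w (n : nat) : E := (\sum_(0 <= i < n) e1 i, \sum_(0 <= i < n) e2 i, \sum_(0 <= i < n) e3 i).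
have bounded e p : Shat p -> eta1 <= e <= eta2 -> `|drift0 g alpha p + e *: drift1 g alpha p| <= C.
  move=> Sp /andP[e_1 e_2]; rewrite drift01E norm3_le.
  have [b1 b2 b3] := drift_coord_bounded alpha0 g01 Sp.
  have e0 : 0 < e by apply: lt_le_trans e_1.
  rewrite (le_trans b2) ?lerDl ?(ltW eta20)// (le_trans b3) ?lerDl ?(ltW eta20)//.
  rewrite !andbT normrM (gtr0_norm e0) (le_trans (ler_wpM2l (ltW e0) b1))// mulr1.
  by rewrite (le_trans e_2)// lerDr.
have lipschitz e p q : Shat p -> Shat q -> eta1 <= e <= eta2 ->
    `|(drift0 g alpha p + e *: drift1 g alpha p) - (drift0 g alpha q + e *: drift1 g alpha q)|
      <= Lam * `|p - q|.
  move=> Sp Sq /andP[e_1 e_2]; rewrite !drift01E.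
  have [b1 b2 b3] := drift_coord_lipschitz alpha0 g01 Lg0 gL Sp Sq.
  have e0 : 0 < e by apply: lt_le_trans e_1.
  have up x : x <= driftLip alpha Lg * `|p - q| -> x <= Lam * `|p - q|.
    by move=> /le_trans; apply; rewrite ler_wpM2r.
  rewrite norm3_le; apply/and3P; split; [|exact: up|exact: up].
  rewrite -mulrBr normrM (gtr0_norm e0).
  rewrite (le_trans (ler_wpM2l (ltW e0) b1))// mulrA ler_wpM2r// ler_wpM2r//.
  by rewrite (le_trans e_2)// lerDr.
have lip0 p q : Shat p -> Shat q -> `|drift0 g alpha p - drift0 g alpha q| <= Lam * `|p - q|.
  move=> Sp Sq; have [b1 b2 b3] := drift_coord_lipschitz alpha0 g01 Lg0 gL Sp Sq.
  have up x : x <= driftLip alpha Lg * `|p - q| -> x <= Lam * `|p - q|.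
    by move=> /le_trans; apply; rewrite ler_wpM2r.
  by rewrite norm3_le subrr normr0 !up// mulr_ge0.
have lip1 p q : Shat p -> Shat q -> `|drift1 g alpha p - drift1 g alpha q| <= Lam * `|p - q|.
  move=> Sp Sq; have [b1 b2 b3] := drift_coord_lipschitz alpha0 g01 Lg0 gL Sp Sq.
  have up x : x <= driftLip alpha Lg * `|p - q| -> x <= Lam * `|p - q|.
    by move=> /le_trans; apply; rewrite ler_wpM2r.
  by rewrite norm3_le subrr normr0 !up// mulr_ge0.
have wC e : 0 < e -> exists n0, forall n m, (n0 <= n)%N -> (n0 <= m)%N -> `|w n - w m| <= e.
  move=> e0; have [n1 c1] := e1_cauchy e0; have [n2 c2] := e2_cauchy e0.
  have [n3 c3] := e3_cauchy e0; exists (maxn n1 (maxn n2 n3)) => n m.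
  wlog nm : n m / (m <= n)%N.
    move=> h hn hm; have [/h|/ltnW /h] := leqP m n; first exact.
    by rewrite distrC; apply.
  rewrite !geq_max => _ /and3P[m1 m2 m3].
  have sub f : \sum_(0 <= i < n) f i - \sum_(0 <= i < m) f i = \sum_(m <= i < n) f i :> R.
    by rewrite (@big_cat_nat _ _ _ m 0 n)//= addrAC subrr add0r.
  by rewrite norm3_le /= !sub c1// c2// c3.
have step n : z n.+1 - z n =
    gam n *: (drift0 g alpha (z n) + eta n *: drift1 g alpha (z n)) + (w n.+1 - w n).
  have -> : w n.+1 - w n = (e1 n, e2 n, e3 n).
    rewrite /w !big_nat_recr//=; congr (_, _, _); rewrite /=; ring.
  by rewrite z_step drift01E; congr (_, _, _) => //=; rewrite -mulrA.
pose L := cluster (z @ \oo).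
have cS := @Shat_compact R.
exists L; rewrite drift_affine; split.
- exact: (limit_set_converges cS zS).
- split; first exact: (limit_set_compact cS zS).
  exact: (limit_set_connected cS C0 bounded zS gam_gt0 gam_cvg0 etaI wC step).
- exact: (limit_set_chain_transitive aeDerivable3 cS C0 Lam0 bounded lipschitz lip0 lip1 zS gam_gt0 gam_cvg0 gam_div etaI wC step).
- exact: (limit_set_invariant aeDerivable3 cS C0 Lam0 bounded lipschitz lip0 lip1 zS gam_gt0 gam_cvg0 gam_div etaI wC step).
- exact: (limit_set_sub cS zS).
Qed.

End PerturbedDrift.

(** * The recursion of the proportions *)

Section Recursion.
Context (R : realType) (d : measure_display) (T : measurableType d).
Variables (N : nat) (k : nat -> nat) (X : nat -> T -> bool) (U : nat -> nat -> T -> nat).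
Variables (alpha : R) (beta : nat -> R).
Hypothesis k_gt0 : forall n, (N <= n)%N -> (0 < k n)%N.
Hypothesis alpha0 : 0 < alpha.
Hypothesis betaE : forall n, (N < n)%N -> n%:R * beta n = alpha * (sizeSum N k n)%:R.
Hypothesis U_range : forall n i w, (N <= n)%N -> (0 < i <= k n)%N -> (0 < U n i w <= n)%N.

Lemma sizeSum_gt0 n : (N < n)%N -> (0 < sizeSum N k n)%N.
Proof.
case: n => // n; rewrite ltnS => Nn.
by rewrite sizeSumS// ltn_addl// k_gt0.
Qed.

Let uw_range w n i : (N <= n)%N -> (0 < i <= k n)%N -> (0 < (fun j i => U j i w) n i <= n)%N.
Proof. exact: U_range. Qed.

Lemma proportions_Shat n w : (N < n)%N -> Shat (proportions R N k X U n w).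
Proof.
move=> Nn; have s0 := sizeSum_gt0 Nn; have s0' : (0 : R) < (sizeSum N k n)%:R by rewrite ltr0n.
have n0 : (0 : R) < n%:R by rewrite ltr0n (leq_trans _ Nn).
have cs := statC_le (X ^~ w) (uw_range w) n.
have bc := statB_le (X ^~ w) (uw_range w) n.
split; rewrite /proportions /= ?in_itv/= ?divr_ge0 ?ler_pdivrMr ?mul1r ?ler_nat//.
- exact: statA_le.
- exact: leq_trans cs.
- by rewrite divfK ?gt_eqF// ler_nat.
Qed.

(** By the relation between [beta n] and the sample sizes, the law of a draw
    depends on the graph through the three proportions only. *)
Lemma posProbE n w : (N < n)%N ->
  posProb N k X U beta n w = qalpha alpha (proportions R N k X U n w).
Proof.
move=> Nn; have s0 : (0 : R) < (sizeSum N k n)%:R by rewrite ltr0n sizeSum_gt0.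
have n0 : (0 : R) < n%:R by rewrite ltr0n (leq_trans _ Nn).
have c0 : (0 : R) <= (statC N k (X ^~ w) (fun j i => U j i w) n)%:R by [].
rewrite /posProb /attach /qalpha /proportions /= -mulr_suml big_split/=.
have -> : \sum_(v <- iota 1 n | X v w) (indeg N k (X ^~ w) (fun j i => U j i w) n v)%:R =
    (statB N k (X ^~ w) (fun j i => U j i w) n)%:R :> R.
  by rewrite /statB natr_sum /index_iota subSS subn0.
have -> : \sum_(1 <= j < n.+1) (indeg N k (X ^~ w) (fun j i => U j i w) n j)%:R =
    (statC N k (X ^~ w) (fun j i => U j i w) n)%:R :> R.
  by rewrite /statC natr_sum.
have -> : \sum_(v <- iota 1 n | X v w) beta n = (statA (X ^~ w) n)%:R * beta n.
  rewrite /statA sum1_count big_const_seq iter_addr_0 mulr_natl.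
  by rewrite /index_iota subSS subn0.
have -> : beta n = alpha * (sizeSum N k n)%:R / n%:R.
  by rewrite -betaE// mulrAC mulfV ?mul1r ?gt_eqF.
field; rewrite !gt_eqF//=.
  by rewrite ltr_wpDl// mulr_gt0.
Qed.

(** The normalising constants grow by 1 and by [k n], so each proportion is
    replaced by a weighted mean of itself and of its reward. *)
Lemma proportions_step n w : (N < n)%N ->
  let z := proportions R N k X U n w in
  let gam := (k n)%:R / (sizeSum N k n.+1)%:R in
  proportions R N k X U n.+1 w - z =
  (n.+1%:R^-1 * (reward k X U (cst 1) (cst 0) n w - z.1.1),
   gam * (reward k X U id (cst 0) n w - z.1.2),
   gam * (reward k X U id (fun y => 1 - y) n w - z.2)).
Proof.
move=> Nn z gam; rewrite /z /gam /proportions /= {z gam}.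
have Nn' : (N <= n)%N by exact: ltnW.
have s0 : (0 : R) < (sizeSum N k n)%:R by rewrite ltr0n sizeSum_gt0.
have n0 : (0 : R) < n%:R by rewrite ltr0n (leq_trans _ Nn).
have k0 : (0 : R) < (k n)%:R by rewrite ltr0n k_gt0.
have pk := posSample_le k (X ^~ w) (fun j i => U j i w) n.
rewrite statAS (statBS _ (uw_range w) Nn') (statCS _ (uw_range w) Nn') sizeSumS// /reward /posFrac.
rewrite !natrD -[in LHS]natr1 -[in RHS]natr1.
congr (_, _, _) => /=.
- case: (X n.+1 w) => /=; field; rewrite ?gt_eqF//; exact: addr_gt0.
- case: (X n.+1 w) => /=; field; rewrite ?gt_eqF//; exact: addr_gt0.
case: (X n.+1 w) => /=; rewrite ?natrB//; field; rewrite ?gt_eqF//; exact: addr_gt0.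
Qed.

End Recursion.

(** * The error of replacing a sample mean by its expectation *)

Section Bias.
Context {R : realType}.
Implicit Types (u du : R -> R).

Let invsqrt_sq (K : nat) : (0 < K)%N -> (Num.sqrt K%:R)^-1 ^+ 2 = K%:R^-1 :> R.
Proof. by move=> K0; rewrite exprVn sqr_sqrtr. Qed.

(** With [r = k ^ (-1/2)], [|y - q| <= r / 2 + (y - q) ^+ 2 / (2 * r)], and the
    second moment is at most [r ^+ 2]. *)
Lemma binExp_lipschitz u (L q : R) (K : nat) : (0 < K)%N -> 0 <= q <= 1 -> 0 <= L ->
  (forall x y : R, x \in `[0, 1] -> y \in `[0, 1] -> `|u x - u y| <= L * `|x - y|) ->
  `|binExp q K (fun j => u (j%:R / K%:R)) - u q| <= L * (Num.sqrt K%:R)^-1.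
Proof.
move=> K0 q01 L0 uL; set r := (Num.sqrt _)^-1.
have r0 : 0 < r by rewrite invr_gt0 sqrtr_gt0 ltr0n.
have -> : L * r = L * r / 2 + (L / (2 * r)) / K%:R.
  by rewrite -(invsqrt_sq K0) -/r; field; rewrite gt_eqF.
apply: (@binExp_approx _ _ _ _ 0) => //.
  by rewrite divr_ge0// mulr_ge0// ltW.
move=> y y01; rewrite mul0r subr0.
apply: (le_trans (uL _ _ _ _)); rewrite ?in_itv//.
have -> : L * r / 2 + L / (2 * r) * (y - q) ^+ 2 = L * ((r ^+ 2 + (y - q) ^+ 2) / (2 * r)).
  by field; rewrite gt_eqF.
rewrite ler_wpM2l// ler_pdivlMr ?mulr_gt0//.
rewrite -[(y - q) ^+ 2]real_normK ?num_real//; have := sqr_ge0 (r - `|y - q|); nra.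
Qed.

Lemma binExp_smooth u du (q : R) (K : nat) : (0 < K)%N -> 0 <= q <= 1 -> smooth01 u du ->
  `|binExp q K (fun j => u (j%:R / K%:R)) - u q| <=
  3 * ((Num.sqrt K%:R)^-1 * modulus (deriv01 u) (Num.sqrt K%:R)^-1).
Proof.
move=> K0 q01 udu; set r := (Num.sqrt _)^-1.
have r0 : 0 < r by rewrite invr_gt0 sqrtr_gt0 ltr0n.
have -> : modulus (deriv01 u) r = modulus du r.
  by apply: eq_modulus => x; exact: smooth01_deriv01.
set m := modulus du r; have m0 : 0 <= m by exact: modulus_ge0.
have -> : 3 * (r * m) = r * m + (2 / r * m) / K%:R.
  by rewrite -(invsqrt_sq K0) -/r; field; rewrite gt_eqF.
apply: (@binExp_approx _ _ _ _ (du q)) => //.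
  by rewrite mulr_ge0// divr_ge0// ltW.
move=> y y01; apply: (le_trans (smooth01_taylor udu r0 _ _)); rewrite ?in_itv//.
by rewrite -/m le_eqVlt; apply/orP; left; apply/eqP; ring.
Qed.

(** The derivatives are [u x + x * du x] and [2 * u x - 1 + (2 * x - 1) * du x],
    and [u] is Lipschitz: only the oscillation of [du] is not linear in [del]. *)
Lemma modulus_phi_psi u du : smooth01 u du -> exists2 M, 0 <= M & forall del, 0 < del ->
  modulus (deriv01 (phi u)) del <= M * del + modulus (deriv01 u) del /\
  modulus (deriv01 (psi u)) del <= M * del + 3 * modulus (deriv01 u) del.
Proof.
move=> udu; have [L L0 uL] := smooth01_lipschitz udu.
have [_ [_ _ [M hM]]] := udu.
have M0 : 0 <= M by rewrite (le_trans _ (hM 0 _))// in_itv/= lexx ler01.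
exists (2 * L + 2 * M); first by rewrite addr_ge0// mulr_ge0.
move=> del del0.
have -> : modulus (deriv01 u) del = modulus du del.
  by apply: eq_modulus => x; exact: smooth01_deriv01.
rewrite (eq_modulus _ (fun x => smooth01_deriv01 (smooth01_phi udu) (x := x))).
rewrite (eq_modulus _ (fun x => smooth01_deriv01 (smooth01_psi udu) (x := x))).
have m0 := modulus_ge0 du del.
have key x y : x \in `[0, 1] -> y \in `[0, 1] -> `|x - y| < del ->
    [/\ `|u x - u y| <= L * del, `|(x - y) * du x| <= M * del & `|y * (du x - du y)| <= modulus du del].
  move=> x01 y01 xy; split.
  - by rewrite (le_trans (uL _ _ x01 y01))// ler_wpM2l// ltW.
  - by rewrite normrM mulrC ler_pM// ?hM// ltW.
  - rewrite normrM (le_trans _ (modulus_ge hM x01 y01 xy))// ler_piMl//.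
    by move: y01; rewrite in_itv/= => /andP[? ?]; rewrite ger0_norm.
have LD : 0 <= L * del by rewrite mulr_ge0// ltW.
have MD : 0 <= M * del by rewrite mulr_ge0// ltW.
split; apply: modulus_le => // x y x01 y01 xy; have [k1 k2 k3] := key x y x01 y01 xy.
  have -> : u x + x * du x - (u y + y * du y) =
    (u x - u y) + ((x - y) * du x + y * (du x - du y)) by ring.
  rewrite (le_trans (ler_normD _ _))//; have := ler_normD ((x - y) * du x) (y * (du x - du y)).
  lra.
have k4 := modulus_ge hM x01 y01 xy.
have -> : 2 * u x - 1 + (2 * x - 1) * du x - (2 * u y - 1 + (2 * y - 1) * du y) =
   2 * ((u x - u y) + ((x - y) * du x + y * (du x - du y))) - (du x - du y) by ring.
rewrite (le_trans (ler_normB _ _))// normrM gtr0_norm//.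
have := ler_normD (u x - u y) ((x - y) * du x + y * (du x - du y)).
have := ler_normD ((x - y) * du x) (y * (du x - du y)).
lra.
Qed.

End Bias.

(** * The limit set of the proportions *)

Lemma cauchySeries_shift {R : realType} m (a : nat -> R) :
  cauchySeries a -> cauchySeries (fun n => a (n + m)%N).
Proof.
move=> ca e e0; have [n0 h] := ca _ e0; exists n0 => i j ni ij.
have -> : \sum_(i <= l < j) a (l + m)%N = \sum_(i + m <= l < j + m) a l.
  by rewrite big_addn addnK.
by apply: h; rewrite ?leq_add2r// (leq_trans ni)// leq_addr.
Qed.

Lemma divergent_series_unbounded {R : realType} N m (a : nat -> R) : (N <= m)%N ->
  (forall n, (N <= n)%N -> 0 <= a n) -> ~ seriesCvg N a ->
  forall M, exists n, M <= \sum_(0 <= i < n) a (i + m)%N.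
Proof.
move=> Nm a0 ncv M; apply: contrapT => /forallNP h; apply: ncv.
have nd : nondecreasing_seq (fun n => \sum_(N <= i < n) a i).
  apply/nondecreasing_seqP => n; have [Nn|nN] := leqP N n.
    by rewrite big_nat_recr//= lerDl a0.
  by rewrite !big_geq// ltnW.
apply: nondecreasing_is_cvgn => //; exists (\sum_(N <= i < m) a i + M) => _ [n _ <-].
apply: (@le_trans _ _ (\sum_(N <= i < n + m) a i)); first by apply: nd; exact: leq_addr.
rewrite (@big_cat_nat _ _ _ m N (n + m))//= ?leq_addl// lerD2l.
rewrite -{1}[m]add0n big_addn addnK leNgt; apply/negP => /ltW; exact: h.
Qed.

Lemma convergesTo_shift {R : realType} {E : normedModType R} m (z : nat -> E) (L : set E) :
  convergesTo (fun n => z (n + m)%N) L -> convergesTo z L.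
Proof.
pose D n := ereal_inf [set `|z n - w|%:E | w in L].
move=> h; rewrite /convergesTo -/D.
have e := @cvg_shiftn m _ D (nbhs (0%E : \bar R)); rewrite -e; exact: h.
Qed.

Section Bias.
Context {R : realType}.
Variables (N : nat) (k : nat -> nat).
Hypothesis k_gt0 : forall n, (N <= n)%N -> (0 < k n)%N.
Local Notation r n := (Num.sqrt (k n)%:R)^-1.
Implicit Types (u c : nat -> R).

(** Sampling [k n] vertices instead of averaging over all of them biases the
    mean of [u] by at most [B n], uniformly in the composition of the graph. *)
Definition smallBias (u : R -> R) c := exists2 B : nat -> R,
  cauchySeries (fun n => c n * B n) &
  forall n q, (N <= n)%N -> 0 <= q <= 1 ->
    `|binExp q (k n) (fun j => u (j%:R / (k n)%:R)) - u q| <= B n.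

Lemma smallBias_lipschitz (u : R -> R) (L : R) c : 0 <= L ->
  (forall x y : R, x \in `[0, 1] -> y \in `[0, 1] -> `|u x - u y| <= L * `|x - y|) ->
  cauchySeries (fun n => c n * r n) -> smallBias u c.
Proof.
move=> L0 uL cc; exists (fun n => L * r n) => [|n q Nn q01]; last first.
  by apply: binExp_lipschitz => //; exact: k_gt0.
by under eq_fun do rewrite mulrCA; exact: cauchySeriesZ.
Qed.

Lemma smallBias_smooth (u du : R -> R) c : smooth01 u du ->
  cauchySeries (fun n => c n * (r n * modulus (deriv01 u) (r n))) -> smallBias u c.
Proof.
move=> udu cc; exists (fun n => 3 * (r n * modulus (deriv01 u) (r n))) => [|n q Nn q01]; last first.
  by apply: binExp_smooth udu => //; exact: k_gt0.
by under eq_fun do rewrite mulrCA; exact: cauchySeriesZ.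
Qed.

Lemma smallBias_cauchy (u : R -> R) c m (q : nat -> R) : (N <= m)%N ->
  (forall n, (N <= n)%N -> 0 <= c n) -> (forall n, (N <= n)%N -> 0 <= q n <= 1) ->
  smallBias u c ->
  cauchySeries (fun n => c (n + m)%N *
    (binExp (q (n + m)%N) (k (n + m)) (fun j => u (j%:R / (k (n + m))%:R)) - u (q (n + m)%N))).
Proof.
move=> Nm c0 q01 [B cB hB].
have Nn n : (N <= n + m)%N by exact: leq_trans Nm (leq_addl _ _).
apply: (cauchySeries_dominated (n1 := 0) (cauchySeries_shift m cB)) => n _.
rewrite normrM ger0_norm; last exact: c0.
by rewrite ler_wpM2l ?c0// hB// q01.
Qed.

End Bias.

Lemma lipschitz01_bound {R : realType} (u : R -> R) : (exists L : R, L.-lipschitz_`[0, 1] u) ->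
  exists2 L, 0 <= L &
  forall x y : R, x \in `[0, 1] -> y \in `[0, 1] -> `|u x - u y| <= L * `|x - y|.
Proof.
move=> [L uL]; exists `|L| => // x y x01 y01.
have := uL (x, y); rewrite /= => /(_ (conj x01 y01)) /le_trans; apply.
by rewrite ler_wpM2r// ler_norm.
Qed.

Lemma lipschitz01_phi_psi {R : realType} (u : R -> R) (L : R) : 0 <= L ->
  (forall x : R, x \in `[0, 1] -> u x \in `[0, 1]) ->
  (forall x y : R, x \in `[0, 1] -> y \in `[0, 1] -> `|u x - u y| <= L * `|x - y|) ->
  forall x y : R, x \in `[0, 1] -> y \in `[0, 1] ->
    `|phi u x - phi u y| <= (3 * (1 + L)) * `|x - y| /\
    `|psi u x - psi u y| <= (3 * (1 + L)) * `|x - y|.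
Proof.
move=> L0 u01 uL x y x01 y01; have uxy := uL x y x01 y01.
have ux := u01 x x01; move: y01 ux; rewrite !in_itv/= => /andP[y0 y1] /andP[u0 u1].
have d0 : 0 <= `|x - y| by [].
have Ld0 : 0 <= L * `|x - y| by rewrite mulr_ge0.
have k1 : `|(x - y) * u x| <= `|x - y| by rewrite normrM ler_piMr// ger0_norm.
have k2 : `|y * (u x - u y)| <= L * `|x - y|.
  by rewrite normrM (le_trans _ uxy)// ler_piMl// ger0_norm.
have phiE : phi u x - phi u y = (x - y) * u x + y * (u x - u y) by rewrite /phi; ring.
have k3 : `|phi u x - phi u y| <= (1 + L) * `|x - y|.
  by rewrite phiE (le_trans (ler_normD _ _))// [leRHS]mulrDl mul1r lerD.
split; first by move: k3; lra.
have -> : psi u x - psi u y = 2 * (phi u x - phi u y) - ((x - y) + (u x - u y)).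
  by rewrite /psi /phi; ring.
rewrite (le_trans (ler_normB _ _))// normrM gtr0_norm//.
by have := ler_normD (x - y) (u x - u y); move: k3; lra.
Qed.

Section Final.
Context (R : realType) (d : measure_display) (T : measurableType d) (P : probability T R).
Variables (N : nat) (k : nat -> nat) (X : nat -> T -> bool) (U : nat -> nat -> T -> nat).
Variables (g : R -> R) (alpha eta1 eta2 : R) (beta : nat -> R).
Hypothesis rG : reinforcedGraph P N k X U g beta.
Hypothesis k_gt0 : forall n, (N <= n)%N -> (0 < k n)%N.
Hypothesis g01 : forall x : R, x \in `[0, 1] -> g x \in `[0, 1].
Hypothesis N0 : (0 < N)%N.
Hypothesis beta0 : forall n, (N <= n)%N -> 0 < beta n.
Hypothesis alpha0 : 0 < alpha.
Hypothesis betaE : forall n, (N < n)%N -> n%:R * beta n = alpha * (sizeSum N k n)%:R.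

Let gam (n : nat) : R := (k n)%:R / (sizeSum N k n.+1)%:R.
Let ratio (n : nat) : R := (sizeSum N k n.+1)%:R / (n.+1%:R * (k n)%:R).
Let inv (n : nat) : R := n.+1%:R^-1.

Hypothesis gam_div : ~ seriesCvg N gam.
Hypothesis gam_sq : seriesCvg N (fun n => (k n)%:R ^+ 2 / (sizeSum N k n.+1)%:R ^+ 2 : R).
Hypothesis eta10 : 0 < eta1.
Hypothesis ratioI : forall n, (N <= n)%N -> eta1 <= ratio n <= eta2.
Variable Lg : R.
Hypothesis Lg0 : 0 <= Lg.
Hypothesis gL : forall x y : R, x \in `[0, 1] -> y \in `[0, 1] -> `|g x - g y| <= Lg * `|x - y|.
Hypothesis bias_g : smallBias N k g inv.
Hypothesis bias_phi : smallBias N k (phi g) gam.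
Hypothesis bias_psi : smallBias N k (psi g) gam.

(** The three proportions follow an Euler scheme with steps [gam n]; the first
    one has steps [1 / (n + 1)], which is [gam n] times a ratio in
    [[eta1, eta2]]. *)
Theorem proportions_limit_set :
  {ae P, forall w, exists L : set (R * R * R),
     [/\ convergesTo (fun n => proportions R N k X U n w) L,
         compact L /\ connected L,
         chainTransitive (drift g alpha eta1 eta2) L,
         invariantSet (drift g alpha eta1 eta2) L &
         L `<=` Shat (R := R)]}.
Proof.
(* The sizes [sizeSum N k n] vanish up to [n = N]: start one step later. *)
pose m := N.+1.
have Nm n : (N < n + m)%N by rewrite addnS ltnS leq_addl.
have Nm' n : (N <= n + m)%N by exact: ltnW.
have s0 n : (N <= n)%N -> (0 : R) < (sizeSum N k n.+1)%:R.
  by move=> Nn; rewrite ltr0n (sizeSum_gt0 k_gt0).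
have K0 n : (N <= n)%N -> (0 : R) < (k n)%:R by move=> Nn; rewrite ltr0n k_gt0.
have gam0 n : (N <= n)%N -> 0 < gam n by move=> Nn; rewrite divr_gt0// (s0, K0).
have inv0 n : 0 < inv n by rewrite invr_gt0.
have invE n : (N <= n)%N -> inv n = gam n * ratio n.
  by move=> Nn; rewrite /inv /gam /ratio; field; rewrite !gt_eqF ?s0 ?K0//.
have gam2 : cauchySeries (fun n => gam n ^+ 2).
  by apply: cvg_cauchySeries; under eq_fun do under eq_bigr do rewrite expr_div_n; exact: gam_sq.
have gam2m := cauchySeries_shift m gam2.
have inv2m : cauchySeries (fun n => inv (n + m)%N ^+ 2).
  apply: (cauchySeries_dominated (n1 := 0) (cauchySeriesZ (eta2 ^+ 2) gam2m)) => n _.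
  have /andP[e1 e2] := ratioI (Nm' n); have r0 := lt_le_trans eta10 e1.
  rewrite ger0_norm ?sqr_ge0// invE// exprMn mulrC ler_wpM2r ?sqr_ge0//.
  by rewrite lerXn2r// nnegrE ltW// (lt_le_trans r0).
have id01 (x : R) : x \in `[0, 1] -> id x \in `[0, 1] by [].
have one01 (x : R) : x \in `[0, 1] -> (cst 1 : R -> R) x \in `[0, 1].
  by rewrite !in_itv/= ler01 lexx.
have zero01 (x : R) : x \in `[0, 1] -> (cst 0 : R -> R) x \in `[0, 1].
  by rewrite !in_itv/= ler01 lexx.
have onem01 (x : R) : x \in `[0, 1] -> (fun y : R => 1 - y) x \in `[0, 1].
  by rewrite !in_itv/= => /andP[x0 x1]; rewrite subr_ge0 x1 gerBl x0.
have n1 := noise_cauchy rG k_gt0 g01 N0 beta0 one01 zero01 (leqnSn N) inv2m.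
have n2 := noise_cauchy rG k_gt0 g01 N0 beta0 id01 zero01 (leqnSn N) gam2m.
have n3 := noise_cauchy rG k_gt0 g01 N0 beta0 id01 onem01 (leqnSn N) gam2m.
have F := ae_filter_ringOfSetsType P.
apply: filterS2 (filterI n1 n2) n3 => w [{}n1 {}n2] {}n3.
pose q n := posProb N k X U beta n w.
have q01 n : (N <= n)%N -> 0 <= q n <= 1 by exact: posProb01.
pose bias u n := binExp (q n) (k n) (fun j => u (j%:R / (k n)%:R)) - u (q n).
have b1 := smallBias_cauchy (leqnSn N) (fun n _ => ltW (inv0 n)) q01 bias_g.
have b2 := smallBias_cauchy (leqnSn N) (fun n h => ltW (gam0 n h)) q01 bias_phi.
have b3 := smallBias_cauchy (leqnSn N) (fun n h => ltW (gam0 n h)) q01 bias_psi.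
have c1 := cauchySeriesD n1 b1; have c2 := cauchySeriesD n2 b2; have c3 := cauchySeriesD n3 b3.
have Ur n i w' : (N <= n)%N -> (0 < i <= k n)%N -> (0 < U n i w' <= n)%N.
  by move=> Nn ik; exact: (sample_range rG).
have noiseE n a b (u : R -> R) : (forall y, meanReward g a b y = u y) ->
    noise N k X U g beta a b n w + (binExp (q n) (k n) (fun j => u (j%:R / (k n)%:R)) - u (q n)) =
    reward k X U a b n w - u (q n).
  move=> ab; rewrite /noise -/(q n) (eq_binExp _ (psi' := fun j => u (j%:R / (k n)%:R))).
    by rewrite addrA subrK.
  by move=> j _; exact: ab.
have [||||n|n|L [L1 L2 L3 L4 L5]] := @perturbed_drift_limit_set R g alpha Lg eta1 eta2
  alpha0 g01 Lg0 gL eta10 (fun n => proportions R N k X U (n + m) w) _ _ _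
  (fun n => gam (n + m)) (fun n => ratio (n + m)) _ _ _ _ _ _ c1 c2 c3.
- move=> n; exact: (proportions_Shat R X k_gt0 Ur).
- by move=> n; exact: gam0.
- apply/cvgrPdist_le => e e0; have [n0 h] := gam2m _ (exprn_gt0 2 e0).
  exists n0 => // n n0n; rewrite sub0r normrN ger0_norm; last exact/ltW/gam0.
  have := h n n.+1 n0n (leqnSn n); rewrite big_nat1 ger0_norm ?sqr_ge0//.
  by rewrite ler_pXn2r// nnegrE ltW// gam0.
- by apply: (divergent_series_unbounded (leqnSn N)) gam_div => n /gam0/ltW.
- exact: ratioI.
- rewrite addSn (proportions_step R X k_gt0 Ur w (Nm n)) -/(gam (n + m)) -/(inv (n + m)).
  rewrite -!mulrDr; rewrite (@noiseE _ _ _ g); last by move=> y; rewrite /meanReward/= mulr1 mulr0 addr0.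
  rewrite (@noiseE _ _ _ (phi g)); last by move=> y; rewrite /meanReward/= mulr0 addr0 mulrC.
  rewrite (@noiseE _ _ _ (psi g)); last by move=> y; rewrite /meanReward/psi/=; ring.
  rewrite -invE// /h1 /h2 /h3 /q (posProbE X U k_gt0 alpha0 betaE w (Nm n)) /phi /psi.
  by congr (_, _, _) => /=; ring.
exists L; split; [|exact: L2|exact: L3|exact: L4|exact: L5].
exact: (convergesTo_shift L1).
Qed.

End Final.

Theorem theorem4p5 (R : realType) (d : measure_display) (T : measurableType d)
    (P : probability T R) (N : nat) (k : nat -> nat) (alpha p : R) (f : R -> R)
    (beta : nat -> R) (X : nat -> T -> bool) (U : nat -> nat -> T -> nat)
    (eta1 eta2 : R) :
  let g := reinforce p f in
  let s := sizeSum N k in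
  let ratio := fun n : nat => (s n.+1)%:R / (n.+1%:R * (k n)%:R) : R in
  let K := fun n : nat => (k n)%:R : R in
  let sR := fun n : nat => (s n.+1)%:R : R in
  let r := fun n : nat => (Num.sqrt (K n))^-1 in
  (0 < N)%N ->
  (forall n, (N <= n)%N -> (0 < k n)%N) ->
  0 < alpha ->
  p \in `[0, 1] -> p != 2^-1 ->
  (forall x, x \in `[0, 1] -> f x \in `[0, 1]) ->
  (forall n, (N <= n)%N -> 0 < beta n) ->
  (forall n, (N < n)%N -> n%:R * beta n = alpha * (s n)%:R) ->
  reinforcedGraph P N k X U g beta ->
  ~ seriesCvg N (fun n => K n / sR n) ->
  seriesCvg N (fun n => K n ^+ 2 / sR n ^+ 2) ->
  eta1%:E = ereal_inf [set (ratio n)%:E | n in [set n | (N <= n)%N]] ->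
  eta2%:E = ereal_sup [set (ratio n)%:E | n in [set n | (N <= n)%N]] ->
  0 < eta1 ->
  (C_class 1 g ->
   seriesCvg N (fun n => (sR n)^-1) ->
   seriesCvg N (fun n => (sR n)^-1 * Num.sqrt (K n) * modulus (deriv01 g) (r n)) ->
   seriesCvg N (fun n =>
     (sR n)^-1 * Num.sqrt (K n) * modulus (deriv01 (phi g)) (r n)) /\
   seriesCvg N (fun n =>
     (sR n)^-1 * Num.sqrt (K n) * modulus (deriv01 (psi g)) (r n))) /\
  ([\/ [/\ exists L : R, L.-lipschitz_`[0, 1] g,
           seriesCvg N (fun n => n.+1%:R^-1 * r n) &
           seriesCvg N (fun n => (sR n)^-1 * Num.sqrt (K n))],
       [/\ C_class 1 g,
           seriesCvg N (fun n => n.+1%:R^-1 * r n * modulus (deriv01 g) (r n)),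
           seriesCvg N (fun n =>
             (sR n)^-1 * Num.sqrt (K n) * modulus (deriv01 (phi g)) (r n)) &
           seriesCvg N (fun n =>
             (sR n)^-1 * Num.sqrt (K n) * modulus (deriv01 (psi g)) (r n))] |
       [/\ C_class 2 g,
           seriesCvg N (fun n => n.+1%:R^-1 * (K n)^-1) &
           seriesCvg N (fun n => (sR n)^-1)]] ->
   {ae P, forall w, exists L : set (R * R * R),
     [/\ convergesTo (fun n => proportions R N k X U n w) L,
         compact L /\ connected L,
         chainTransitive (drift g alpha eta1 eta2) L,
         invariantSet (drift g alpha eta1 eta2) L &
         L `<=` Shat (R := R)]}).
Proof.
move=> g s ratio K sR r N0 k0 alpha0 p01 _ f01 beta0 betaE rG gdiv gsq eta1E eta2E eta10.
have g01 (x : R) : x \in `[0, 1] -> g x \in `[0, 1].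
  move=> /f01; move: p01; rewrite /g /reinforce !in_itv/= => /andP[p0 p1] /andP[f0 f1].
  have h1 : 0 <= p * f x by rewrite mulr_ge0.
  have h2 : 0 <= (1 - p) * (1 - f x) by rewrite mulr_ge0 ?subr_ge0.
  have h3 : p * f x <= p by rewrite ler_piMr.
  have h4 : (1 - p) * (1 - f x) <= 1 - p by rewrite ler_piMr ?subr_ge0// gerBl.
  by apply/andP; split; lra.
have K0 n : (N <= n)%N -> 0 < K n by move=> Nn; rewrite ltr0n k0.
have sR0 n : (N <= n)%N -> 0 < sR n by move=> Nn; rewrite ltr0n (sizeSum_gt0 k0).
have r0 n : (N <= n)%N -> 0 < r n by move=> Nn; rewrite invr_gt0 sqrtr_gt0 K0.
have Kr n : (N <= n)%N -> Num.sqrt (K n) * r n = 1.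
  by move=> Nn; rewrite mulfV// gt_eqF// sqrtr_gt0 K0.
have KsR n : (N <= n)%N -> K n / sR n * r n = (sR n)^-1 * Num.sqrt (K n).
  move=> Nn; transitivity ((sR n)^-1 * (Num.sqrt (K n) * (Num.sqrt (K n) * r n))).
    rewrite [X in _ = _ * X]mulrA -expr2 sqr_sqrtr; last exact/ltW/K0.
    by rewrite mulrA [_^-1 * _]mulrC.
  by rewrite Kr// mulr1.
split.
  move=> /smooth01_C1[dg gdg] /cvg_cauchySeries c1 /cvg_cauchySeries c2.
  have [M M0 hM] := modulus_phi_psi gdg.
  have bnd n (m0 mg c : R) : (N <= n)%N -> 0 <= m0 -> m0 <= M * r n + c * mg ->
      `|(sR n)^-1 * Num.sqrt (K n) * m0| <=
      M * (sR n)^-1 + c * ((sR n)^-1 * Num.sqrt (K n) * mg).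
    move=> Nn m00 h; have s0 : 0 <= (sR n)^-1 * Num.sqrt (K n).
      by rewrite mulr_ge0 ?invr_ge0 ?sqrtr_ge0// ltW// sR0.
    rewrite (ger0_norm (mulr_ge0 s0 m00)); apply: le_trans (ler_wpM2l s0 h) _.
    rewrite le_eqVlt; apply/orP; left; apply/eqP.
    rewrite mulrDr; congr (_ + _); last by rewrite mulrCA.
    by rewrite mulrCA -mulrA Kr// mulr1.
  split; apply: cauchySeries_cvg.
    apply: (cauchySeries_dominated (n1 := N) (cauchySeriesD (cauchySeriesZ M c1) (cauchySeriesZ 1 c2))).
    move=> n Nn; apply: bnd => //; first exact: modulus_ge0.
    by rewrite mul1r; have [] := hM _ (r0 n Nn).
  apply: (cauchySeries_dominated (n1 := N) (cauchySeriesD (cauchySeriesZ M c1) (cauchySeriesZ 3 c2))).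
  move=> n Nn; apply: bnd => //; first exact: modulus_ge0.
  by have [] := hM _ (r0 n Nn).
have ratioI n : (N <= n)%N -> eta1 <= ratio n <= eta2.
  move=> Nn; apply/andP; split.
    by rewrite -lee_fin eta1E; apply: ereal_inf_lbound; exists n.
  by rewrite -lee_fin eta2E; apply: ereal_sup_ubound; exists n.
(* what each of the three sets of assumptions provides *)
pose tame := exists Lg : R, [/\ 0 <= Lg,
  forall x y : R, x \in `[0, 1] -> y \in `[0, 1] -> `|g x - g y| <= Lg * `|x - y|,
  smallBias N k g (fun n => n.+1%:R^-1),
  smallBias N k (phi g) (fun n => K n / sR n) &
  smallBias N k (psi g) (fun n => K n / sR n)].
move=> hyp; suff [Lg [Lg0 gL bg bphi bpsi]] : tame.
  exact: (proportions_limit_set rG k0 g01 N0 beta0 alpha0 betaE gdiv gsq eta10 ratioI Lg0 gL bg bphi bpsi).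
move: hyp.
have smooth : C_class 1 g ->
    seriesCvg N (fun n => n.+1%:R^-1 * r n * modulus (deriv01 g) (r n)) ->
    seriesCvg N (fun n => (sR n)^-1 * Num.sqrt (K n) * modulus (deriv01 (phi g)) (r n)) ->
    seriesCvg N (fun n => (sR n)^-1 * Num.sqrt (K n) * modulus (deriv01 (psi g)) (r n)) -> tame.
  move=> /smooth01_C1[dg gdg] /cvg_cauchySeries c1 /cvg_cauchySeries c2 /cvg_cauchySeries c3.
  have [L L0 gL] := smooth01_lipschitz gdg.
  have bnd u : cauchySeries (fun n => (sR n)^-1 * Num.sqrt (K n) * modulus (deriv01 u) (r n)) ->
      cauchySeries (fun n => K n / sR n * (r n * modulus (deriv01 u) (r n))).
    move=> c; apply: (cauchySeries_dominated (n1 := N) c) => n Nn.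
    rewrite ger0_norm; first by rewrite mulrA KsR.
    by rewrite mulr_ge0 ?divr_ge0 ?mulr_ge0 ?modulus_ge0// ltW// (K0, sR0, r0).
  exists L; split => //.
  - apply: (smallBias_smooth k0 gdg); under eq_fun do rewrite mulrA; exact: c1.
  - apply: (smallBias_smooth k0 (smooth01_phi gdg)); exact: bnd.
  - apply: (smallBias_smooth k0 (smooth01_psi gdg)); exact: bnd.
case=> [[/lipschitz01_bound[L L0 gL] /cvg_cauchySeries c1 /cvg_cauchySeries c2]|[]|].
- have c2' : cauchySeries (fun n => K n / sR n * r n).
    apply: (cauchySeries_dominated (n1 := N) c2) => n Nn.
    by rewrite KsR// ger0_norm// mulr_ge0 ?invr_ge0 ?sqrtr_ge0// ltW// sR0.
  have L'0 : 0 <= 3 * (1 + L) by rewrite mulr_ge0// addr_ge0.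
  exists L; split => //; first exact: smallBias_lipschitz gL c1.
    apply: (smallBias_lipschitz k0 L'0) c2' => x y x01 y01.
    by have [] := lipschitz01_phi_psi L0 g01 gL x01 y01.
  apply: (smallBias_lipschitz k0 L'0) c2' => x y x01 y01.
  by have [] := lipschitz01_phi_psi L0 g01 gL x01 y01.
- exact: smooth.
move=> [C2 /cvg_cauchySeries c1 /cvg_cauchySeries c2].
have [dg [gdg [L L0 dgL]]] := smooth01_C2 C2.
have [M M0 hM] := modulus_phi_psi gdg.
have mg n : (N <= n)%N -> modulus (deriv01 g) (r n) <= L * r n.
  move=> Nn; rewrite (eq_modulus _ (fun x => smooth01_deriv01 gdg (x := x))).
  apply: modulus_le => [|x y x01 y01 xy]; first exact: r0.
  by rewrite (le_trans (dgL _ _ x01 y01))// ler_wpM2l// ltW.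
have C1 := C_classS C2.
have bnd u D : (forall n, (N <= n)%N -> modulus (deriv01 u) (r n) <= D * r n) ->
    seriesCvg N (fun n => (sR n)^-1 * Num.sqrt (K n) * modulus (deriv01 u) (r n)).
  move=> h; apply: cauchySeries_cvg.
  apply: (cauchySeries_dominated (n1 := N) (cauchySeriesZ D c2)) => n Nn.
  have q0 : 0 <= (sR n)^-1 * Num.sqrt (K n).
    by rewrite mulr_ge0 ?invr_ge0 ?sqrtr_ge0// ltW// sR0.
  rewrite (ger0_norm (mulr_ge0 q0 (modulus_ge0 _ _))).
  apply: (le_trans (ler_wpM2l q0 (h n Nn))).
  by rewrite mulrCA -mulrA Kr// mulr1.
apply: (smooth C1).
- apply: cauchySeries_cvg.
  apply: (cauchySeries_dominated (n1 := N) (cauchySeriesZ L c1)) => n Nn.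
  have q0 : 0 <= n.+1%:R^-1 * r n by rewrite mulr_ge0 ?invr_ge0// ltW// r0.
  rewrite (ger0_norm (mulr_ge0 q0 (modulus_ge0 _ _))).
  apply: (le_trans (ler_wpM2l q0 (mg n Nn))).
  rewrite mulrCA -mulrA -expr2 exprVn sqr_sqrtr//; exact/ltW/K0.
- apply: (bnd _ (M + L)) => n Nn; have [h _] := hM _ (r0 n Nn).
  by have := mg n Nn; rewrite mulrDl; lra.
- apply: (bnd _ (M + 3 * L)) => n Nn; have [_ h] := hM _ (r0 n Nn).
  by have := mg n Nn; rewrite mulrDl -mulrA; lra.
Qed.
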